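(* Let $p\ge1$, let $A$ be a commutative unital complex Banach algebra and let $(F,H)$ be an odd $2p$-summable Fredholm module over $A$ such that the representation $\pi:A\to\mathcal L(H)$ and the linear map $A\to\mathcal L^{2p}(H)$, $a\mapsto[F,\pi(a)]$, are continuous. Let $P=\frac{F+1}{2}$. For $a_0,\ldots,a_{2p-1}\in M_\infty(A)$ put $$\langle a_0,\ldots,a_{2p-1}\rangle=(-1)^pc_p\sum_{s\in SE_{2p-1}}\mathrm{sgn}(s)\,\mathrm{Tr}\Big([P\,\mathrm{TR}(a_0)P,P\,\mathrm{TR}(a_{s(1)})P]\cdots[P\,\mathrm{TR}(a_{s(2p-2)})P,P\,\mathrm{TR}(a_{s(2p-1)})P]\Big)\in\mathbb C.$$ If $i\in\{0,\ldots,2p-1\}$ and $b_i\in M_\infty(A)$ satisfies $e^{b_i}=e^{a_i}$, then $$\langle a_0,\ldots,a_i,\ldots,a_{2p-1}\rangle-\langle a_0,\ldots,b_i,\ldots,a_{2p-1}\rangle\in(2\pi i)^p\mathbb Z,$$ where in $(2\pi i)^p$ the symbol $i$ denotes the imaginary unit.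
   Context: $c_p=(-1)^{p-1}\frac{(2p-1)!}{(p-1)!}$. $\Sigma_{2p-1}$ is the group of permutations of $\{1,\ldots,2p-1\}$ and $SE_{2p-1}\subseteq\Sigma_{2p-1}$ is the subset of those $s$ with $s(2j)<s(2j+1)$ for all $j\in\{1,\ldots,p-1\}$. In each summand the product consists of the $p$ commutators $[P\,\mathrm{TR}(a_0)P,P\,\mathrm{TR}(a_{s(1)})P]$ and $[P\,\mathrm{TR}(a_{s(2j)})P,P\,\mathrm{TR}(a_{s(2j+1)})P]$, $j=1,\ldots,p-1$, in this order. $M_\infty(A)=\bigcup_kM_k(A)$; for $a\in M_k(A)$, $e^a\in GL_k(A)\subseteq GL(A)=\bigcup_kGL_k(A)$ (stabilization by $g\mapsto g\oplus1$), and $\mathrm{TR}(a)=\sum_ja_{jj}\in A$. An odd $2p$-summable Fredholm module $(F,H)$ over $A$ consists of a Hilbert space $H$, a representation $\pi:A\to\mathcal L(H)$ (suppressed from the notation) and an operator $F=F^*$ with $F^2=1$ and $[F,\pi(a)]\in\mathcal L^{2p}(H)$ (the $2p$-th Schatten ideal) for all $a\in A$. *)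

(* Defs.v *)
From HB Require Import structures.
From mathcomp Require Import all_boot all_order all_fingroup all_algebra.
From mathcomp Require Import sesquilinear complex.
From mathcomp Require Import all_classical all_reals all_analysis.
From mathcomp Require Import summability.

Set Implicit Arguments.
Unset Strict Implicit.
Unset Printing Implicit Defensive.

Import Order.TTheory GRing.Theory Num.Theory.
Import numFieldNormedType.Exports.

Local Open Scope classical_set_scope.
Local Open Scope complex_scope.
Local Open Scope ring_scope.

(* Commutative unital Banach algebras over K: nonzero, with a submultiplicative
   norm; no normalisation of the norm of the unit is imposed. The ring axioms
   are spelled out because Hierarchy Builder does not allow a join of the ring
   and normed module structures above numDomainType. *)
HB.mixin Record CompleteNormedModule_isComBanachAlgebra (K : numFieldType) A
    & CompleteNormedModule K A := {
  bone : A;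
  bmul : A -> A -> A;
  bmulA : associative bmul;
  bmulC : commutative bmul;
  bmul1l : left_id bone bmul;
  bmulDl : left_distributive bmul +%R;
  bmulZl : forall (k : K) x y, bmul (k *: x) y = k *: bmul x y;
  bone_neq0 : bone != 0;
  ler_norm_bmul : forall x y, `|bmul x y| <= `|x| * `|y|
}.

#[short(type="comBanachAlgType")]
HB.structure Definition ComBanachAlgebra (K : numFieldType) :=
  {A of CompleteNormedModule K A & CompleteNormedModule_isComBanachAlgebra K A}.

(* The carrier of A, seen as a commutative K-algebra without its norm. *)
Definition alg_of (K : numFieldType) (A : comBanachAlgType K) : Type := A.

Section AlgOf.
Context (K : numFieldType) (A : comBanachAlgType K).

HB.instance Definition _ := GRing.Lmodule.copy (alg_of A) A.

HB.instance Definition _ := GRing.Zmodule_isComNzRing.Build (alg_of A)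
  (@bmulA K A) (@bmulC K A) (@bmul1l K A) (@bmulDl K A) (@bone_neq0 K A).

Fact alg_of_scaleAl (k : K) (x y : alg_of A) : k *: (x * y) = (k *: x) * y.
Proof. exact: (esym (@bmulZl K A k x y)). Qed.

HB.instance Definition _ :=
  GRing.Lmodule_isLalgebra.Build K (alg_of A) alg_of_scaleAl.

Fact alg_of_scaleAr (k : K) (x y : alg_of A) : k *: (x * y) = x * (k *: y).
Proof. by rewrite mulrC alg_of_scaleAl mulrC. Qed.

HB.instance Definition _ :=
  GRing.Lalgebra_isAlgebra.Build K (alg_of A) alg_of_scaleAr.

End AlgOf.

(* Complex Hilbert spaces, of arbitrary dimension and not assumed separable;
   the inner product is linear in its first argument. *)
HB.mixin Record CompleteNormedModule_isHilbert (R : realType) H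
    & CompleteNormedModule R[i] H := {
  hdot : {dot H for (@Num.conj R[i])};
  hdotxx : forall x : H, hdot x x = `|x| ^+ 2
}.

#[short(type="hilbertType")]
HB.structure Definition Hilbert (R : realType) :=
  {H of CompleteNormedModule R[i] H & CompleteNormedModule_isHilbert R H}.

Section Operators.
Context {R : realType} {H : hilbertType R}.
Implicit Types (S T : H -> H) (E : set H).

Definition bounded_op T := linear T /\ continuous T.

Definition op_commutator S T : H -> H := (S \o T) \- (T \o S).

Definition is_adjoint T S := forall x y, hdot (T x) y = hdot x (S y).

Definition op_adjoint T : H -> H := xget (id : H -> H) [set S | is_adjoint T S].

Definition is_onb E :=
  [/\ forall e, E e -> hdot e e = 1,
      forall e f, E e -> E f -> e <> f -> hdot e f = 0
    & forall x, (forall e, E e -> hdot x e = 0) -> x = 0].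

Definition onb : set H := xget set0 [set E | is_onb E].

(* The trace, meaningful for trace-class operators, for which the family of
   diagonal coefficients is summable with a sum independent of the basis; the
   sum is the limit of the net of finite partial sums. *)
Definition op_trace T : R[i] :=
  summability.sum ((fun e => hdot (T e) e : R[i]^o) \_ onb).

(* The Schatten norm of exponent 2p, (Tr |T|^(2p))^(1/(2p)): as |T|^2 is
   T^* T, the operator |T|^(2p) is (T^* T)^p. *)
Definition schatten_norm (p : nat) T : \bar R :=
  ((\esum_(e in onb) (complex.Re (hdot (iter p (op_adjoint T \o T) e) e))%:E)
     `^ (p.*2%:R^-1))%E.

Definition schatten_class (p : nat) T :=
  bounded_op T /\ (schatten_norm p T < +oo)%E.

End Operators.

Section FredholmModules.
Context {R : realType} {A : comBanachAlgType R[i]} {H : hilbertType R}.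

(* Unitality of the representation is not required. *)
Definition is_representation (rho : A -> H -> H) :=
  [/\ forall a, bounded_op (rho a),
      forall (c : R[i]) a b, rho (c *: a + b) = c \*: rho a \+ rho b
    & forall a b, rho (bmul a b) = rho a \o rho b].

Definition odd_fredholm_module (p : nat) (rho : A -> H -> H) (F : H -> H) :=
  [/\ is_representation rho, bounded_op F, is_adjoint F F, F \o F = id
    & forall a, schatten_class p (op_commutator F (rho a))].

Definition opnorm_continuous (rho : A -> H -> H) :=
  forall (a : A) (eps : R), 0 < eps ->
    \forall b \near a, forall x, `|rho b x - rho a x| <= eps%:C * `|x|.

Definition schatten_continuous (p : nat) (delta : A -> H -> H) :=
  forall (a : A) (eps : R), 0 < eps ->
    \forall b \near a, (schatten_norm p (delta b \- delta a)%R < eps%:E)%E.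

End FredholmModules.

Section StableMatrices.
Context {R : realType}.
Implicit Types A : comBanachAlgType R[i].

(* M_oo(A), each element being given with a size; two matrices that agree up to
   padding by zeros represent the same element. *)
Definition Minf A := {k : nat & 'M[alg_of A]_k}.

Definition expmx A (k : nat) (a : 'M[alg_of A]_k) : 'M[alg_of A]_k :=
  \matrix_(i, j)
    limn (series (fun n => (n`!%:R : R[i])^-1 *: ((a ^+ n) i j : A))).

(* Image in GL(A) of a k x k matrix, as an infinite matrix: g (+) 1 (+) 1 ... *)
Definition stabilize A (k : nat) (g : 'M[alg_of A]_k) :
    nat -> nat -> alg_of A :=
  fun i j => if (insub i, insub j) is (Some i', Some j') then g i' j'
             else (i == j)%:R.

Definition expGL A (a : Minf A) := stabilize (expmx (tagged a)).

Definition TR A (a : Minf A) : A := \tr (tagged a).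

End StableMatrices.

Section Bracket.
Context {R : realType} {A : comBanachAlgType R[i]} {H : hilbertType R}.

Definition cp (p : nat) : R[i] :=
  (-1) ^+ p.-1 * ((p.*2.-1)`!%:R / (p.-1)`!%:R).

(* A permutation s of {1, ..., n} is an element of 'S_n, i standing for the
   ordinal i - 1; lift0_perm s is s extended to {0, ..., n} by s(0) = 0. *)
Definition SE (p : nat) : {set 'S_(p.*2.-1)} :=
  [set s | [forall j : 'I_p, (0 < j)%N ==>
     (lift0_perm s (inord j.*2) < lift0_perm s (inord j.*2.+1))%N]].

Definition pos_proj (F : H -> H) : H -> H := fun x => 2^-1 *: (F x + x).

(* Since lift0_perm s fixes 0, the factor j = 0 is the commutator of the
   compressions of a_0 and a_(s(1)). *)
Definition bracket (p : nat) (rho : A -> H -> H) (F : H -> H)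
    (a : 'I_(p.*2.-1).+1 -> Minf A) : R[i] :=
  let P := pos_proj F in
  let T i := P \o rho (TR (a i)) \o P in
  (-1) ^+ p * cp p * \sum_(s in SE p) (-1) ^+ s *
    op_trace (\big[comp/id]_(j < p)
      op_commutator (T (lift0_perm s (inord j.*2)))
                    (T (lift0_perm s (inord j.*2.+1)))).

End Bracket.

(* Main.v *)
Require Import Defs.
From HB Require Import structures.
From mathcomp Require Import all_boot all_order all_fingroup all_algebra.
From mathcomp Require Import complex.
From mathcomp Require Import all_classical all_reals all_analysis.
From mathcomp Require Import summability cyclic separable cyclotomic ring lra zify.
Set Implicit Arguments.
Unset Strict Implicit.
Unset Printing Implicit Defensive.
Import Order.TTheory GRing.Theory Num.Theory.
Import numFieldNormedType.Exports.
Local Open Scope classical_set_scope.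
Local Open Scope complex_scope.
Local Open Scope ring_scope.

(* The difference of the two brackets is in fact [0].

   Put [x = TR a_i - TR b]. Since [det (e^a) = e^(TR a)], the hypothesis gives
   [e^x = 1]. For [m] large, [y = e^(x / m)] is an [m]-th root of [1] close to [1],
   and the idempotents [E_z = (1 / m) sum_j z^(-j) y^j], [z^m = 1], diagonalise [x]:
   [x = sum_z c_z E_z]. By multilinearity it remains to see that the bracket
   vanishes when one of its arguments is a multiple of an idempotent [e].

   Up to a positive integer factor the sum over [SE_(2p-1)] is the sum over all
   permutations of the [2p] arguments of the signed traces of products of
   commutators. This alternating trace depends on the Toeplitz operators [P a P]
   only modulo [L^p]: if [X_0] is in [L^p], then in [[X_0, X_1] [X_2, X_3] ...] the
   two halves of the first commutator cancel after antisymmetrisation, by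
   cyclicity of the trace. With [Q = 1 - P], the commutators do not change when
   [P e P] is replaced by [P e P + Q e Q], which is congruent modulo [L^p] to an
   idempotent [E], a conjugate of [e] by unipotents. As [E] commutes modulo [L^p]
   with every [X = P a P], one may replace [X] by [E X E + (1 - E) X (1 - E)], which
   commutes with [E] exactly, so that every term vanishes.

   Schatten ideals are handled through dyadic approximation by finite-rank
   operators. Orthonormal vectors [x_n] chosen greedily, with [|T x_n|] nearly the
   norm of [T] on the complement of the previous ones, produce such approximants
   from the finiteness of [Tr (T^* T)^p], by the moment inequality
   [|T x|^p <= |... T T^* T x|] for unit vectors ([p] factors). Traces are limits of
   traces of finite-rank approximants, and [Tr (w j) = Tr (j w)] holds because [w j]
   and [j w] have approximants of equal trace. *)


(** * Identities in additive groups and alternating traces *)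

(** The obstacle is that a term of the alternating trace vanishes only when one of its commutators
    is exactly 0, whereas Toeplitz operators commute, and [P e P] is idempotent, only up to an
    ideal. Errors in a single argument can be absorbed by antisymmetry, but that does not help until
    some exact identity is available; the exact idempotent supplies it. The corner [Q e Q] matters
    because [P e P + Q e Q] differs from the honest idempotent [e] only by terms off-diagonal for
    [P], so the correction can be made by conjugating [e] itself. Finitely many idempotents suffice
    because [e^x = 1] confines the spectrum of [x] to finitely many multiples of [2 pi i]; averaging
    over roots of unity extracts the spectral projections by finite sums, with no contour integrals.
    In the same spirit the determinant of an exponential is reached through [(1 + a / m)^m]:
    matrices over [A] offer no eigenvalues to work with. *)

(* A reflexive decision procedure for identities in abelian groups: [ring] does
   not apply to non-commutative products, which [abel] treats as atoms. *)
Inductive zterm := ZVar of nat | ZZero | ZAdd of zterm & zterm | ZOpp of zterm.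

Section ZTerm.
Context {V : zmodType}.
Implicit Types (t : zterm) (env : seq V).

Fixpoint zeval env t : V :=
  match t with
  | ZVar i => nth 0 env i
  | ZZero => 0
  | ZAdd t1 t2 => zeval env t1 + zeval env t2
  | ZOpp t1 => - zeval env t1
  end.

Fixpoint zcoef t (i : nat) : int :=
  match t with
  | ZVar j => (i == j)%:R
  | ZZero => 0
  | ZAdd t1 t2 => zcoef t1 i + zcoef t2 i
  | ZOpp t1 => - zcoef t1 i
  end.

Lemma zevalE env t : zeval env t = \sum_(i < size env) nth 0 env i *~ zcoef t i.
Proof.
elim: t => [j||t1 IH1 t2 IH2|t1 IH1] /=.
- have [lt_j|le_j] := ltnP j (size env).
    rewrite (bigD1 (Ordinal lt_j)) //= eqxx mulr1z big1 ?addr0 // => i.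
    by rewrite -val_eqE /= => /negPf->; rewrite mulr0z.
  rewrite nth_default // big1 // => i _.
  by rewrite ltn_eqF ?mulr0z // (leq_trans (ltn_ord i)).
- by rewrite big1 // => i _; rewrite mulr0z.
- by rewrite IH1 IH2 -big_split; apply: eq_bigr => i _; rewrite mulrzDr.
- by rewrite IH1 -sumrN; apply: eq_bigr => i _; rewrite mulrNz.
Qed.

Lemma zterm_eq env t1 t2 :
  all (fun i => zcoef t1 i == zcoef t2 i) (iota 0 (size env)) ->
  zeval env t1 = zeval env t2.
Proof.
move=> /allP eq12; rewrite !zevalE; apply: eq_bigr => i _.
by rewrite (eqP (eq12 _ _)) // mem_iota ltn_ord.
Qed.

End ZTerm.

(** Atoms are compared up to conversion: type-checking [erefl x : x = y] decides, and the match on a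
    dummy term lets a failure fall through to the next entry. *)
Ltac zmem x env :=
  lazymatch env with
  | [::] => constr:(false)
  | ?y :: ?env' =>
    match constr:(isT) with
    | _ => let _ := constr:(erefl x : x = y) in constr:(true)
    | _ => zmem x env'
    end
  end.
Ltac zindex x env :=
  lazymatch env with
  | ?y :: ?env' =>
    match constr:(isT) with
    | _ => let _ := constr:(erefl x : x = y) in constr:(0%N)
    | _ => let n := zindex x env' in constr:(n.+1)
    end
  end.
Ltac zenv t env :=
  lazymatch t with
  | ?x + ?y => let env1 := zenv x env in zenv y env1
  | - ?x => zenv x env
  | 0 => env
  | ?x => lazymatch zmem x env with
          | true => env
          | false => constr:(x :: env)
          end
  end.
Ltac zreify t env :=
  lazymatch t with
  | ?x + ?y => let a := zreify x env in let b := zreify y env in constr:(ZAdd a b)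
  | - ?x => let a := zreify x env in constr:(ZOpp a)
  | 0 => constr:(ZZero)
  | ?x => let n := zindex x env in constr:(ZVar n)
  end.
Ltac abel :=
  lazymatch goal with
  | |- @eq ?T ?l ?r =>
    let e0 := constr:(@nil T) in
    let e1 := zenv l e0 in let e2 := zenv r e1 in
    let a := zreify l e2 in let b := zreify r e2 in
    refine (@zterm_eq _ e2 a b _); vm_compute; reflexivity
  end.
Ltac ncring := rewrite ?(mulrDl, mulrDr, mulrBl, mulrBr, mulNr, mulrN, opprK, mulrA, mul1r, mulr1, mul0r, mulr0); abel.

Definition commr (B : pzRingType) (x y : B) : B := x * y - y * x.

Lemma prod_split_at (B : pzRingType) (n i : nat) (F : nat -> B) : (i < n)%N ->
  \prod_(j < n) F j =
  \prod_(0 <= j < i) F j * F i * \prod_(i.+1 <= j < n) F j.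
Proof.
move=> lt_in; rewrite -(big_mkord xpredT F) (@big_cat_nat _ _ _ i) ?(ltnW lt_in) //=.
by rewrite (big_ltn lt_in) mulrA.
Qed.

(** * Alternating traces of products of commutators, over a ring filtered by ideals *)

Section AlternatingTrace.

Context {B : pzRingType} {K : numFieldType} (q : nat).
Variables (L : nat -> B -> Prop) (tr : B -> K).

Local Notation p := q.+1.
Local Notation N := q.*2.+2.

(* [L k] plays the role of the Schatten ideal of exponent [2 p / k], so that
   [L p.*2] is the trace class. *)
Record trace_filtration := TraceFiltration {
  tfL_all : forall x, L 0 x;
  tfL0 : forall k, L k 0;
  tfLD : forall k x y, L k x -> L k y -> L k (x + y);
  tfLN : forall k x, L k x -> L k (- x);
  tfLM : forall j k x y, L j x -> L k y -> L (j + k) (x * y);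
  tfL_decr : forall k x, L k.+1 x -> L k x;
  tf_trD : forall x y, L p.*2 x -> L p.*2 y -> tr (x + y) = tr x + tr y;
  tf_trC : forall j k x y, (j + k)%N = p.*2 -> L j x -> L k y ->
    tr (x * y) = tr (y * x)
}.

Hypothesis tf : trace_filtration.

Let LB k x y : L k x -> L k y -> L k (x - y).
Proof. by move=> Lx Ly; apply: (tfLD tf Lx); apply: (tfLN tf). Qed.

Let LMl k x y : L k y -> L k (x * y).
Proof. by move=> Ly; have := tfLM tf (tfL_all tf x) Ly. Qed.

Let LMr k x y : L k x -> L k (x * y).
Proof. by move=> Lx; have := tfLM tf Lx (tfL_all tf y); rewrite addn0. Qed.

Lemma tf_tr0 : tr 0 = 0.
Proof.
have := tf_trD tf (tfL0 tf _) (tfL0 tf _); rewrite addr0 => /eqP.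
by rewrite -subr_eq0 opprD addrA subrr sub0r oppr_eq0 => /eqP.
Qed.

Lemma tf_trN x : L p.*2 x -> tr (- x) = - tr x.
Proof.
move=> Lx; apply/eqP; rewrite -addr_eq0 -(tf_trD tf) //; last exact: (tfLN tf).
by rewrite addNr tf_tr0.
Qed.

Lemma tf_trB x y : L p.*2 x -> L p.*2 y -> tr (x - y) = tr x - tr y.
Proof. by move=> Lx Ly; rewrite (tf_trD tf) ?tf_trN //; apply: (tfLN tf). Qed.

Lemma tf_L_sum k (I : Type) (r : seq I) (P : pred I) (F : I -> B) :
  (forall i, P i -> L k (F i)) -> L k (\sum_(i <- r | P i) F i).
Proof.
by move=> LF; apply: big_ind => //; [exact: (tfL0 tf) | exact: (tfLD tf)].
Qed.

Lemma tf_tr_sum (I : Type) (r : seq I) (P : pred I) (F : I -> B) :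
  (forall i, P i -> L p.*2 (F i)) ->
  tr (\sum_(i <- r | P i) F i) = \sum_(i <- r | P i) tr (F i).
Proof.
move=> LF.
have [] // : L p.*2 (\sum_(i <- r | P i) F i) /\
  tr (\sum_(i <- r | P i) F i) = \sum_(i <- r | P i) tr (F i).
elim/big_rec2: _ => [|i y x Pi [Lx Ey]]; first by split; [exact: (tfL0 tf) | exact: tf_tr0].
split; first by apply: (tfLD tf) => //; exact: LF.
by rewrite (tf_trD tf) ?Ey //; exact: LF.
Qed.

Lemma tf_L_sign k (b : bool) x : L k x -> L k ((-1) ^+ b * x).
Proof. by case: b => Lx; rewrite ?expr0 ?expr1 ?mul1r ?mulN1r //; exact: (tfLN tf). Qed.

Lemma tf_tr_sign (b : bool) x : L p.*2 x -> tr ((-1) ^+ b * x) = (-1) ^+ b * tr x.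
Proof. by case: b => Lx; rewrite ?expr0 ?expr1 ?mul1r ?mulN1r ?tf_trN. Qed.

Implicit Types (X Y Z : 'I_N -> B) (s t : 'S_N).

Definition pcomm X (j : nat) : B := commr (X (inord j.*2)) (X (inord j.*2.+1)).

Definition comm_prod X : B := \prod_(j < p) pcomm X j.

Definition perm_args X s : 'I_N -> B := fun i => X (s i).

Definition alt_term X s : K := (-1) ^+ s * tr (comm_prod (perm_args X s)).

Definition alt_trace X : K := \sum_s alt_term X s.

Definition almost_commuting X := forall i j, L 2 (commr (X i) (X j)).

Let inordK_lt j k : (j < N)%N -> (k < N)%N ->
  (inord j == inord k :> 'I_N) = (j == k).
Proof. by move=> ltj ltk; rewrite -val_eqE /= !inordK. Qed.

(** [(s * t)%g] applies [s] first: a left factor acts on the positions, a right factor on the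
    arguments. *)
Lemma perm_argsM X s t : perm_args X (s * t)%g = perm_args (perm_args X t) s.
Proof. by apply: boolp.funext => i; rewrite /perm_args permM. Qed.

Lemma almost_commuting_perm X s :
  almost_commuting X -> almost_commuting (perm_args X s).
Proof. by move=> aX i j; exact: aX. Qed.

Lemma L_prod_pcomm X a b : almost_commuting X ->
  L (b - a).*2 (\prod_(a <= j < b) pcomm X j).
Proof.
move=> aX; elim: b => [|b IHb]; first by rewrite big_geq //; exact: (tfL_all tf).
have [le_ab|lt_ba] := leqP a b.
  rewrite big_nat_recr //= subSn // doubleS -addn2.
  by apply: (tfLM tf) => //; exact: aX.
by rewrite big_geq // (eqP (lt_ba : b.+1 - a == 0)%N); exact: (tfL_all tf).
Qed.

Lemma L_comm_prod X : almost_commuting X -> L p.*2 (comm_prod X).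
Proof.
by move=> aX; rewrite /comm_prod -(big_mkord xpredT); have := L_prod_pcomm 0 p aX; rewrite subn0.
Qed.

Lemma alt_trace_perm X t : alt_trace (perm_args X t) = (-1) ^+ t * alt_trace X.
Proof.
rewrite /alt_trace (reindex_inj (mulIg t^-1%g)) /= mulr_sumr; apply: eq_bigr => s _.
rewrite /alt_term -perm_argsM mulgKV odd_permM odd_permV.
by rewrite addbC signr_addb -!mulrA.
Qed.

Definition flip (j : nat) : 'S_N := tperm (inord j.*2) (inord j.*2.+1).

Lemma comm_prod_flip X j : (j < p)%N ->
  comm_prod (perm_args X (flip j)) = - comm_prod X.
Proof.
move=> lt_jp; rewrite /comm_prod !(prod_split_at _ lt_jp).
have -> : pcomm (perm_args X (flip j)) j = - pcomm X j.
  by rewrite /pcomm /perm_args /flip tpermL tpermR /commr opprB.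
have E k : (k < p)%N -> k != j -> pcomm (perm_args X (flip j)) k = pcomm X k.
  move=> ltk nkj; rewrite /pcomm /perm_args /flip !tpermD //; rewrite inordK_lt; lia.
rewrite mulrN mulNr; congr (- (_ * _ * _)); apply: eq_big_nat => k Hk; apply: E; lia.
Qed.

Definition rotation : 'S_N := perm (can_inj (@ordSK N)).

Lemma rotationE (i : 'I_N) : val (rotation i) = (i.+1 %% N)%N.
Proof. by rewrite permE /=. Qed.

Lemma rotation2_inord (k : nat) : (k < N)%N ->
  (rotation * rotation)%g (inord k) = inord ((k + 2) %% N).
Proof.
move=> ltk; apply: val_inj; rewrite permM !rotationE !inordK ?ltn_mod //=.
by rewrite -addn1 modnDml addn1 addn2 inordK ?ltn_mod.
Qed.

(** A shift of the positions by two carries the first commutator to the end of the product;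
    cyclicity of the trace, between [L q.*2] and [L 2], brings it back. *)
Lemma comm_prod_rotation X : almost_commuting X ->
  tr (comm_prod (perm_args X (rotation * rotation)%g)) = tr (comm_prod X).
Proof.
move=> aX; rewrite {2}/comm_prod big_ord_recl /= -[in RHS](big_mkord xpredT (fun i => pcomm X i.+1)).
have -> : comm_prod (perm_args X (rotation * rotation)%g) =
  (\prod_(0 <= i < q) pcomm X i.+1) * pcomm X 0.
  rewrite /comm_prod big_ord_recr /= -(big_mkord xpredT (fun i => pcomm _ i)).
  have E (j : nat) : (j < p)%N ->
      pcomm (perm_args X (rotation * rotation)%g) j = pcomm X (j.+1 %% p).
    move=> ltj; rewrite /pcomm /perm_args !rotation2_inord; [|lia|lia].
    have [->|nj] := eqVneq j q.
      have -> : ((q.*2 + 2) %% N = 0)%N by rewrite addn2 modnn.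
      have -> : ((q.*2.+1 + 2) %% N = 1)%N.
        by rewrite addn2 -addn1 modnDl modn_small.
      by rewrite modnn.
    by rewrite !modn_small ?doubleS ?addn2 ?addSn //; lia.
  congr (_ * _); last by rewrite E // modnn.
  by apply: eq_big_nat => j Hj; rewrite E ?modn_small //; lia.
apply: (tf_trC tf (j := q.*2) (k := 2)); first by rewrite addn2.
- rewrite -(big_add1 _ _ 0 p.-1.+1 xpredT (pcomm X)).
  by have := L_prod_pcomm 1 p aX; rewrite subn1.
- exact: aX.
Qed.

Lemma alt_term_flip X s j : almost_commuting X -> (j < p)%N ->
  alt_term X (flip j * s)%g = alt_term X s.
Proof.
move=> aX ltj; rewrite /alt_term perm_argsM comm_prod_flip // tf_trN; last first.
  exact/L_comm_prod/almost_commuting_perm.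
rewrite odd_permM odd_tperm inordK_lt; [|lia|lia].
by rewrite neq_ltn leqnn /= signrN mulrNN.
Qed.

Lemma alt_term_rotation X s : almost_commuting X ->
  alt_term X (rotation * rotation * s)%g = alt_term X s.
Proof.
move=> aX; rewrite /alt_term perm_argsM comm_prod_rotation; last first.
  exact: almost_commuting_perm.
by rewrite !odd_permM addbb.
Qed.

(** Shifts by two reach every even position and a flip reaches the odd position next to it; neither
    changes the signed trace. *)
Lemma move_to_front X (k : 'I_N) : almost_commuting X ->
  exists2 g : 'S_N, g k = ord0 & forall s, alt_term X (g * s)%g = alt_term X s.
Proof.
move=> aX.
have even_case j : (j < p)%N -> exists2 g : 'S_N, g (inord j.*2) = ord0 &
    forall s, alt_term X (g * s)%g = alt_term X s.
  elim: j => [_|j IHj ltj].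
    exists 1%g; last by move=> s; rewrite mul1g.
    by rewrite perm1; apply: val_inj; rewrite /= inordK.
  have [g g0 gX] := IHj (ltnW ltj).
  exists ((rotation * rotation)^-1 * g)%g.
    rewrite permM -g0; congr (g _); apply: (canLR (permK _)).
    by rewrite rotation2_inord ?modn_small ?addn2 -?doubleS //; lia.
  by move=> s; rewrite -mulgA -[LHS]alt_term_rotation // mulKVg gX.
have [g g0 gX] : exists2 g : 'S_N, g (inord k./2.*2) = ord0 &
    forall s, alt_term X (g * s)%g = alt_term X s.
  by apply: even_case; have := ltn_ord k; lia.
have Ek := odd_double_half k; case: (boolP (odd k)) Ek => odd_k; rewrite ?add0n ?add1n => Ek.
  exists (flip k./2 * g)%g.
    rewrite permM -g0; congr (g _).
    have -> : flip k./2 = tperm (inord k./2.*2) k by rewrite /flip Ek inord_val.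
    exact: tpermR.
  by move=> s; rewrite -mulgA alt_term_flip //; have := ltn_ord k; lia.
by exists g => //; rewrite -g0 Ek inord_val.
Qed.

(** Sort the permutations by the position of argument 0: by [move_to_front] the [N] classes
    contribute equally. *)
Lemma alt_trace_fix0 X : almost_commuting X ->
  alt_trace X = (\sum_(s : 'S_N | s ord0 == ord0) alt_term X s) *+ N.
Proof.
move=> aX; rewrite /alt_trace.
rewrite (partition_big (fun s : 'S_N => s^-1%g ord0) xpredT) //=.
rewrite -[X in _ *+ X](card_ord N) -sumr_const.
apply: eq_bigr => k _; have [g gk gX] := move_to_front k aX.
rewrite (reindex_inj (mulgI g)) /=; apply: eq_big => [s|s _]; last exact: gX.
rewrite invMg permM (canF_eq (permKV g)) gk (canF_eq (permKV s)) eq_sym.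
by rewrite [LHS]eq_sym.
Qed.

Definition increasing_pairs k (s : 'S_N) : bool :=
  all (fun j => s (inord j.*2) < s (inord j.*2.+1))%N (iota 1 k).

(** Flipping a pair exchanges the permutations increasing on it with the others and keeps the term,
    so each pair gives a factor 2. Pair 0, which holds the fixed argument 0, is left alone. *)
Lemma sum_alt_term_increasing X k : almost_commuting X -> (k <= q)%N ->
  \sum_(s : 'S_N | s ord0 == ord0) alt_term X s =
  (\sum_(s : 'S_N | (s ord0 == ord0) && increasing_pairs k s) alt_term X s) *+ (2 ^ k).
Proof.
move=> aX; elim: k => [_|k IHk lt_kq]; first by under [in RHS]eq_bigl do rewrite andbT.
rewrite IHk ?(ltnW lt_kq) // expnS mulrnA; congr (_ *+ _).
set c := fun s : 'S_N => (s (inord k.+1.*2) < s (inord k.+1.*2.+1))%N.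
have ipS s : increasing_pairs k.+1 s = increasing_pairs k s && c s.
  have iotaE : iota 1 k.+1 = iota 1 k ++ [:: k.+1] by have := iotaD 1 k 1; rewrite addn1 add1n.
  by rewrite /increasing_pairs iotaE all_cat /= andbT.
rewrite (bigID c) /= mulr2n; congr (_ + _).
  by apply: eq_bigl => s; rewrite ipS andbA.
rewrite (reindex_inj (mulgI (flip k.+1))) /=; apply: eq_big => [s|s _]; last first.
  by rewrite alt_term_flip.
have fix_arg i : (i < N)%N -> (i < k.+1.*2)%N -> (flip k.+1 * s)%g (inord i) = s (inord i).
  by move=> ltiN lti; rewrite permM tpermD // inordK_lt //; lia.
rewrite ipS andbA; congr (_ && _ && _).
- have -> : ord0 = inord 0 :> 'I_N by apply: val_inj; rewrite /= inordK.
  by rewrite fix_arg.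
- apply: eq_in_all => j; rewrite mem_iota => Hj; rewrite !fix_arg //; lia.
- rewrite /c !permM /flip tpermL tpermR -leqNgt leq_eqVlt.
  have /negPf -> // : s (inord k.+1.*2) != s (inord k.+1.*2.+1) :> nat.
  rewrite val_eqE (inj_eq perm_inj) inordK_lt; lia.
Qed.

(** Antisymmetrisation takes place in the ring, before any trace: the monomials acquire a trace only
    after multiplication by an argument in [L 2]. *)
Definition alt_sum (U : ('I_N -> B) -> B) X : B :=
  \sum_(s : 'S_N | s ord0 == ord0) (-1) ^+ s * U (perm_args X s).

Lemma alt_sum_odd U U' t X : odd_perm t -> t ord0 = ord0 ->
  (forall Z, U' Z = U (perm_args Z t)) -> alt_sum U X + alt_sum U' X = 0.
Proof.
move=> odd_t t0 UU'; apply/eqP; rewrite addr_eq0; apply/eqP; rewrite /alt_sum -sumrN.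
rewrite (reindex_inj (mulgI t)) /=; apply: eq_big => [s|s _].
  by rewrite permM t0.
by rewrite UU' -perm_argsM odd_permM odd_t signrN mulNr.
Qed.

Lemma eq_alt_sum U V X : (forall Z, U Z = V Z) -> alt_sum U X = alt_sum V X.
Proof. by move=> UV; apply: eq_bigr => s _; rewrite UV. Qed.

Lemma alt_sumB U V X : alt_sum (fun Z => U Z - V Z) X = alt_sum U X - alt_sum V X.
Proof. by rewrite /alt_sum -sumrB; apply: eq_bigr => s _; rewrite mulrBr. Qed.

Lemma alt_sumD U V X : alt_sum (fun Z => U Z + V Z) X = alt_sum U X + alt_sum V X.
Proof. by rewrite /alt_sum -big_split; apply: eq_bigr => s _; rewrite mulrDr. Qed.

(* Position 1 moves past one commutator at a time: on three positions the
   antisymmetrisation of [x [y, z] - [y, z] x] vanishes. *)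
Lemma alt_sum_move X :
  alt_sum (fun Z => Z (inord 1) * \prod_(j < q) pcomm Z j.+1) X =
  alt_sum (fun Z => (\prod_(j < q) pcomm Z j.+1) * Z (inord 1)) X.
Proof.
(* In [V k], the argument at position 1 stands after [k] of the commutators. *)
pose V k Z := (\prod_(0 <= j < k) pcomm Z j.+1) * Z (inord 1) *
              (\prod_(k <= j < q) pcomm Z j.+1).
have step k : (k < q)%N -> alt_sum (V k) X = alt_sum (V k.+1) X.
  move=> lt_kq; apply/eqP; rewrite -subr_eq0 -alt_sumB.
  pose a : 'I_N := inord 1; pose b : 'I_N := inord k.+1.*2; pose c : 'I_N := inord k.+1.*2.+1.
  (* [a [b, c] - [b, c] a] is [(abc + cba) - (acb + bca)], and in each parenthesis the two monomials
     differ by a transposition. *)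
  pose w x y z Z := (\prod_(0 <= j < k) pcomm Z j.+1) * (Z x * Z y * Z z) *
              (\prod_(k.+1 <= j < q) pcomm Z j.+1).
  have -> : alt_sum (fun Z => V k Z - V k.+1 Z) X =
      alt_sum (fun Z => (w a b c Z + w c b a Z) - (w a c b Z + w b c a Z)) X.
    apply: eq_alt_sum => Z; rewrite /V /w (big_ltn lt_kq) big_nat_recr //=.
    rewrite /(pcomm Z k.+1) -/a -/b -/c /commr !(mulrBr, mulrBl, mulrA).
    rewrite !opprB !opprD -!addrA; congr (_ + _).
    by rewrite [RHS]addrC -!addrA; congr (_ + _); rewrite [RHS]addrC.
  have ab : a != b by rewrite /a /b inordK_lt //; lia.
  have ac : a != c by rewrite /a /c inordK_lt //; lia.
  have bc : b != c by rewrite /b /c inordK_lt //; lia.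
  have inv t Z : (forall i, (1 < i)%N -> i != k.+1.*2 -> i != k.+1.*2.+1 -> (i < N)%N ->
        t (inord i) = inord i) ->
      (\prod_(0 <= j < k) pcomm (perm_args Z t) j.+1 = \prod_(0 <= j < k) pcomm Z j.+1) /\
      (\prod_(k.+1 <= j < q) pcomm (perm_args Z t) j.+1 =
       \prod_(k.+1 <= j < q) pcomm Z j.+1).
    move=> ft; split; apply: eq_big_nat => j Hj; rewrite /pcomm /perm_args !ft //; lia.
  have fixt u v i : u \in [:: a; b; c] -> v \in [:: a; b; c] ->
      (1 < i)%N -> i != k.+1.*2 -> i != k.+1.*2.+1 -> (i < N)%N ->
      tperm u v (inord i) = inord i.
    move=> uabc vabc i1 ib ic iN.
    have nabc d : d \in [:: a; b; c] -> d != inord i.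
      rewrite !inE => /or3P[] /eqP->; rewrite inordK_lt //; lia.
    by rewrite tpermD ?nabc.
  have odd1 u v : u != v -> odd_perm (tperm u v) by rewrite odd_tperm.
  have fix0 u v : u \in [:: a; b; c] -> v \in [:: a; b; c] -> tperm u v ord0 = ord0.
    move=> uabc vabc.
    have nabc d : d \in [:: a; b; c] -> d != ord0.
      have -> : ord0 = inord 0 :> 'I_N by apply: val_inj; rewrite /= inordK.
      by rewrite !inE => /or3P[] /eqP->; rewrite inordK_lt //; lia.
    by rewrite tpermD ?nabc.
  rewrite alt_sumB !alt_sumD.
  rewrite (@alt_sum_odd (w a b c) _ (tperm a c)) ?odd1 ?fix0 ?inE ?eqxx ?orbT //; last first.
    move=> Z; rewrite /w; have [] := inv (tperm a c) Z; first by move=> i; apply: fixt; rewrite !inE eqxx ?orbT.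
    by move=> -> ->; rewrite /perm_args tpermL tpermR tpermD // eq_sym.
  rewrite (@alt_sum_odd (w a c b) _ (tperm a b)) ?odd1 ?fix0 ?inE ?eqxx ?orbT //; last first.
    move=> Z; rewrite /w; have [] := inv (tperm a b) Z; first by move=> i; apply: fixt; rewrite !inE eqxx ?orbT.
    by move=> -> ->; rewrite /perm_args tpermL tpermR tpermD // eq_sym.
  by rewrite subr0.
rewrite [LHS](_ : _ = alt_sum (V 0%N) X); last first.
  by apply: eq_alt_sum => Z; rewrite /V big_geq // mul1r -(big_mkord xpredT (fun j => pcomm Z j.+1)).
rewrite [RHS](_ : _ = alt_sum (V q) X); last first.
  apply: eq_alt_sum => Z; rewrite /V [X in _ * _ * X]big_geq // mulr1.
  by rewrite -(big_mkord xpredT (fun j => pcomm Z j.+1)).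
have: (q <= q)%N by []. elim: {1 3}q => // k IHk lt_kq.
by rewrite IHk ?(ltnW lt_kq) // step.
Qed.

Lemma alt_trace_L2_head X : almost_commuting X -> L 2 (X ord0) -> alt_trace X = 0.
Proof.
move=> aX LX0; rewrite alt_trace_fix0 // (_ : \sum_(_ | _) _ = 0) ?mul0rn //.
pose U Z := Z (inord 1) * \prod_(j < q) pcomm Z j.+1.
pose V Z := (\prod_(j < q) pcomm Z j.+1) * Z (inord 1).
have LO s : L q.*2 (\prod_(j < q) pcomm (perm_args X s) j.+1).
  rewrite -(big_mkord xpredT (fun j => pcomm _ j.+1)).
  rewrite -(big_add1 _ _ 0 q.+1 xpredT (pcomm _)).
  by have := L_prod_pcomm 1 p (almost_commuting_perm s aX); rewrite subn1.
have LX0M y : L q.*2 y -> L p.*2 (X ord0 * y).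
  by rewrite doubleS -add2n; exact: (tfLM tf).
have LU s : L p.*2 (X ord0 * ((-1) ^+ s * U (perm_args X s))).
  by apply: LX0M; exact/tf_L_sign/LMl.
have LV s : L p.*2 (X ord0 * ((-1) ^+ s * V (perm_args X s))).
  by apply: LX0M; exact/tf_L_sign/LMr.
have sgnC (s : 'S_N) x : (-1) ^+ s * (X ord0 * x) = X ord0 * ((-1) ^+ s * x).
  by case: (odd_perm s); rewrite ?expr1 ?expr0 ?mulN1r ?mul1r // mulrN.
(* Since [X ord0] lies in [L 2], each half of the first commutator gives a product with a trace of
   its own; in the second half cyclicity moves position 1 to the end. *)
have term s : s ord0 = ord0 -> alt_term X s =
    tr (X ord0 * ((-1) ^+ s * U (perm_args X s))) -
    tr (X ord0 * ((-1) ^+ s * V (perm_args X s))).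
  move=> s0.
  have LU1 : L p.*2 (X ord0 * U (perm_args X s)) by apply/LX0M/LMl.
  have LV1 : L p.*2 (X ord0 * V (perm_args X s)) by apply/LX0M/LMr.
  rewrite -!sgnC !tf_tr_sign // -mulrBr; congr (_ * _).
  rewrite /comm_prod big_ord_recl /=.
  have -> : pcomm (perm_args X s) 0 = commr (X ord0) (perm_args X s (inord 1)).
    rewrite /pcomm {1}/perm_args (_ : inord 0.*2 = ord0) ?s0 //.
    by apply: val_inj; rewrite /= inordK.
  rewrite /commr mulrBl -!mulrA tf_trB //.
    rewrite [in RHS](_ : tr (X ord0 * V _) = tr (X ord0 * \prod_(j < q) pcomm (perm_args X s) j.+1 * perm_args X s (inord 1))); last by rewrite -mulrA.
    congr (_ - _); apply: (tf_trC tf (add0n p.*2)); first exact: (tfL_all tf).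
    exact/LX0M/LO.
  exact/LMl/LX0M/LO.
rewrite (eq_bigr _ (fun s (s0 : s ord0 == ord0) => term s (eqP s0))) sumrB -!tf_tr_sum // -!mulr_sumr.
by rewrite (alt_sum_move X : \sum_(s | _) _ = \sum_(s | _) _) subrr.
Qed.

Lemma alt_trace_L2 X i : almost_commuting X -> L 2 (X i) -> alt_trace X = 0.
Proof.
move=> aX LXi.
have : alt_trace (perm_args X (tperm ord0 i)) = 0.
  apply: alt_trace_L2_head; first exact: almost_commuting_perm.
  by rewrite /perm_args tpermL.
by rewrite alt_trace_perm => /eqP; rewrite mulf_eq0 signr_eq0 => /eqP.
Qed.

Lemma comm_prod_add X Y Z i : X i = Y i + Z i ->
  (forall j, j != i -> X j = Y j /\ X j = Z j) ->
  comm_prod X = comm_prod Y + comm_prod Z.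
Proof.
move=> Xi Xj; have lti : (i./2 < p)%N by have := ltn_ord i; lia.
rewrite /comm_prod !(prod_split_at _ lti).
have out j : (j < p)%N -> j != i./2 -> pcomm X j = pcomm Y j /\ pcomm X j = pcomm Z j.
  move=> ltj nj; rewrite /pcomm.
  have [] := Xj (inord j.*2); first by rewrite -val_eqE /= inordK; lia.
  have [] := Xj (inord j.*2.+1); first by rewrite -val_eqE /= inordK; lia.
  by move=> <- <- <- <-.
have outY a b : (b <= p)%N -> (b <= i./2)%N || (i./2 < a)%N ->
    \prod_(a <= j < b) pcomm X j = \prod_(a <= j < b) pcomm Y j /\
    \prod_(a <= j < b) pcomm X j = \prod_(a <= j < b) pcomm Z j.
  move=> lebp Hab; split; apply: eq_big_nat => j Hj; have [] // := out j; lia.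
have [] := outY 0%N i./2; [exact: ltnW | by rewrite leqnn | move=> <- <-].
have [] := outY i./2.+1 p; [by [] | by rewrite leqnn orbT | move=> <- <-].
rewrite -mulrDl -mulrDr; congr (_ * _ * _).
have Ek := odd_double_half i; case: (boolP (odd i)) Ek => odd_i; rewrite ?add0n ?add1n => Ek.
  have [E1 E2] : X (inord i./2.*2) = Y (inord i./2.*2) /\ X (inord i./2.*2) = Z (inord i./2.*2).
    by apply: Xj; rewrite -val_eqE /= inordK; have := ltn_ord i; lia.
  have Ei : inord i./2.*2.+1 = i by rewrite Ek inord_val.
  by rewrite /pcomm Ei -E1 -E2 Xi /commr mulrDr mulrDl opprD addrACA.
have [E1 E2] : X (inord i./2.*2.+1) = Y (inord i./2.*2.+1) /\
    X (inord i./2.*2.+1) = Z (inord i./2.*2.+1).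
  by apply: Xj; rewrite -val_eqE /= inordK; have := ltn_ord i; lia.
have Ei : inord i./2.*2 = i by rewrite Ek inord_val.
by rewrite /pcomm Ei -E1 -E2 Xi /commr mulrDr mulrDl opprD addrACA.
Qed.

Lemma alt_trace_add X Y Z i : almost_commuting Y -> almost_commuting Z ->
  X i = Y i + Z i -> (forall j, j != i -> X j = Y j /\ X j = Z j) ->
  alt_trace X = alt_trace Y + alt_trace Z.
Proof.
move=> aY aZ Xi Xj; rewrite /alt_trace -big_split; apply: eq_bigr => s _ /=.
rewrite /alt_term -mulrDr -(tf_trD tf); [|exact/L_comm_prod/almost_commuting_perm..].
rewrite (@comm_prod_add _ (perm_args Y s) (perm_args Z s) (s^-1%g i)) //.
  by rewrite /perm_args permKV.
by move=> j nj; apply: Xj; rewrite (canF_eq (permK s)).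
Qed.

Lemma commrC (x y : B) : commr x y = - commr y x.
Proof. by rewrite /commr opprB. Qed.

Lemma L_commr_mod x y z : L 2 (x - y) -> L 2 (commr x z) -> L 2 (commr y z).
Proof.
move=> Lxy Lxz; have -> : commr y z = commr x z - ((x - y) * z - z * (x - y)).
  by rewrite /commr; ncring.
by apply: LB => //; apply: LB; [exact: LMr | exact: LMl].
Qed.

Lemma almost_commuting_mod X Y : almost_commuting X ->
  (forall j, L 2 (X j - Y j)) -> almost_commuting Y.
Proof.
move=> aX LXY i j; apply: (L_commr_mod (LXY i)); rewrite commrC; apply: (tfLN tf).
by apply: (L_commr_mod (LXY j)).
Qed.

Lemma alt_trace_mod X Y : almost_commuting X ->
  (forall j, L 2 (X j - Y j)) -> alt_trace X = alt_trace Y.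
Proof.
(* Hybrids: [Hy k] has its first [k] arguments replaced. Consecutive hybrids differ in one argument
   by an element of [L 2], which contributes nothing by [alt_trace_L2]. *)
move=> aX LXY; pose Hy (k : nat) (j : 'I_N) := if (j < k)%N then Y j else X j.
have aH k : almost_commuting (Hy k).
  apply: (almost_commuting_mod aX) => j; rewrite /Hy; case: ifP => // _.
  by rewrite subrr; exact: (tfL0 tf).
have step k : (k < N)%N -> alt_trace (Hy k) = alt_trace (Hy k.+1).
  move=> lt_kN; pose i : 'I_N := Ordinal lt_kN.
  pose D j := if j == i then X i - Y i else Hy k j.
  have LD0 j : L 2 (commr (X i - Y i) j) by apply: LB; [exact: LMr | exact: LMl].
  have aD : almost_commuting D.
    move=> j l; rewrite /D; case: (j == i); case: (l == i).
    - exact: LD0.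
    - exact: LD0.
    - by rewrite commrC; apply: (tfLN tf); exact: LD0.
    - exact: aH.
  rewrite (@alt_trace_add (Hy k) (Hy k.+1) D i) //.
  - by rewrite (@alt_trace_L2 D i) ?addr0 // /D eqxx.
  - by rewrite /Hy /D ltnn ltnSn eqxx addrC subrK.
  move=> j nj; rewrite /D (negPf nj) /Hy ltnS (leq_eqVlt j k); split=> //.
  by move: nj; rewrite -val_eqE /= => /negPf->.
have -> : X = Hy 0%N by [].
have -> : Y = Hy N by apply: boolp.funext => j; rewrite /Hy ltn_ord.
have: (N <= N)%N by []. elim: {1 3}N => // k IHk lt_kN.
by rewrite IHk ?(ltnW lt_kN) // step.
Qed.

(** In every term the argument [i] sits in exactly one commutator, which is 0. *)
Lemma alt_trace_commuting X i : (forall j, commr (X i) (X j) = 0) -> alt_trace X = 0.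
Proof.
move=> Xi; rewrite /alt_trace big1 // => s _; rewrite /alt_term.
suff -> : comm_prod (perm_args X s) = 0 by rewrite tf_tr0 mulr0.
set k := s^-1%g i; have ltk : (k./2 < p)%N by have := ltn_ord k; lia.
rewrite /comm_prod (prod_split_at _ ltk) (_ : pcomm _ _ = 0) ?mulr0 ?mul0r //.
have sk : s k = i by rewrite permKV.
rewrite /pcomm /perm_args.
have Ek := odd_double_half k; case: (odd k) Ek; rewrite ?add0n ?add1n => Ek.
  by rewrite Ek inord_val sk commrC Xi oppr0.
by rewrite Ek inord_val sk Xi.
Qed.

(** The argument [i] enters only through its commutators with the others, so its own value is
    free. *)
Lemma eq_alt_trace X Y i : (forall j, j != i -> X j = Y j) ->
  (forall j, j != i -> commr (X i) (X j) = commr (Y i) (Y j)) -> alt_trace X = alt_trace Y.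
Proof.
move=> Xj Xij; apply: eq_bigr => s _; congr (_ * tr _); apply: eq_bigr => j _.
rewrite /pcomm /perm_args; set a := s _; set b := s _.
have ab : a != b by rewrite (inj_eq perm_inj) inordK_lt; have := ltn_ord j; lia.
have [ai|ai] := eqVneq a i; first by rewrite ai Xij // -ai eq_sym.
have [bi|bi] := eqVneq b i; first by rewrite bi commrC Xij // commrC opprK.
by rewrite !Xj.
Qed.

(** * Compressions of commuting elements by an idempotent *)

Lemma pierce_decomposition (e x : B) :
  x = e * x * e + e * x * (1 - e) + (1 - e) * x * e + (1 - e) * x * (1 - e).
Proof. by ncring. Qed.

(** When [n1] and [n2] have square 0, [(1 - n1) * (1 + n2)] is the inverse of [(1 - n2) * (1 + n1)],
    so this is a conjugate of [e]. The signs make [- n1 - n2] its first-order part. *)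
Definition conj_idem (e n1 n2 : B) : B := (1 - n2) * (1 + n1) * e * (1 - n1) * (1 + n2).

Section ConjIdem.
Variables e n1 n2 : B.
Hypotheses (ee : e * e = e) (en1 : e * n1 = n1) (n1e : n1 * e = 0)
  (en2 : e * n2 = 0) (n2e : n2 * e = n2).

Let n11 : n1 * n1 = 0. Proof. by rewrite -{2}en1 mulrA n1e mul0r. Qed.
Let n22 : n2 * n2 = 0. Proof. by rewrite -{1}n2e -mulrA en2 mulr0. Qed.

Lemma conj_idemK : conj_idem e n1 n2 * conj_idem e n1 n2 = conj_idem e n1 n2.
Proof.
have uK : (1 - n1) * (1 + n2) * ((1 - n2) * (1 + n1)) = 1.
  rewrite -mulrA (mulrA (1 + n2)) (_ : (1 + n2) * (1 - n2) = 1); last first.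
    by rewrite mulrDl !mulrBr n22; ncring.
  by rewrite mul1r mulrBl !mulrDr n11; ncring.
rewrite /conj_idem -[X in X * _]mulrA -[X in _ * X]mulrA.
set u := (1 - n2) * (1 + n1); set v := (1 - n1) * (1 + n2).
rewrite -[u * e * v * _]mulrA -(mulrA u e v) [v * _]mulrA uK mul1r.
by rewrite !mulrA -(mulrA u) ee.
Qed.

(** Everything in the last parenthesis is a product of at least two of the [n], hence in [L 2] once
    they are in [L 1]. *)
Lemma conj_idemE :
  conj_idem e n1 n2 = e - n1 - n2 + (n2 * n1 - n1 * n2 + n2 * n1 * n2).
Proof.
have -> : conj_idem e n1 n2 = (1 - n2) * ((1 + n1) * e * (1 - n1)) * (1 + n2).
  by rewrite /conj_idem !mulrA.
have -> : (1 + n1) * e * (1 - n1) = e - n1.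
  by rewrite mulrDl mul1r n1e addr0 mulrBr mulr1 en1.
have -> : (1 - n2) * (e - n1) = e - n1 - n2 + n2 * n1.
  by rewrite mulrBl mul1r mulrBr n2e; abel.
rewrite mulrDr mulr1 !(mulrDl, mulrBl, mulNr) en2 n22; abel.
Qed.

End ConjIdem.

Section Compression.
Variables (P : B) (b : 'I_N -> B) (i : 'I_N) (e z : B).
Hypotheses (PP : P * P = P) (ee : e * e = e) (zC : forall x, z * x = x * z).
Hypotheses (bC : forall j k, b j * b k = b k * b j) (eC : forall j, e * b j = b j * e).
Hypotheses (LPb : forall j, L 1 (commr P (b j))) (LPe : L 1 (commr P e)).
Hypothesis bi : b i = z * e.

Local Notation Q := (1 - P).
Local Notation f := (1 - e).

Let QP : Q * P = 0. Proof. by rewrite mulrBl mul1r PP subrr. Qed.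
Let PQ : P * Q = 0. Proof. by rewrite mulrBr mulr1 PP subrr. Qed.
Let QQ : Q * Q = Q. Proof. by rewrite {1}mulrBl mul1r PQ subr0. Qed.

Let LPQ x : L 1 (commr P x) -> L 1 (P * x * Q).
Proof.
move=> LPx; have -> : P * x * Q = commr P x * Q.
  by rewrite /commr mulrBl -(mulrA x) PQ mulr0 subr0.
exact: LMr.
Qed.

Let LQP x : L 1 (commr P x) -> L 1 (Q * x * P).
Proof.
move=> LPx; have -> : Q * x * P = - (Q * commr P x).
  by rewrite /commr mulrBr !mulrA QP !mul0r sub0r opprK.
exact/(tfLN tf)/LMl.
Qed.

Let L11 x y : L 1 x -> L 1 y -> L 2 (x * y).
Proof. exact: (tfLM tf (j := 1) (k := 1)). Qed.

(** The defect of multiplicativity of a compression is a product of off-diagonal corners: [P x y P -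
    (P x P) (P y P) = (P x Q) (Q y P)]. Each corner is in [L 1]. *)
Lemma compression_commr x y : x * y = y * x -> L 1 (commr P x) -> L 1 (commr P y) ->
  L 2 (commr (P * x * P) (P * y * P)).
Proof.
move=> xy Lx Ly.
have -> : commr (P * x * P) (P * y * P) =
    (P * y * Q) * (Q * x * P) - (P * x * Q) * (Q * y * P).
  have cut u v : (P * u * Q) * (Q * v * P) = P * (u * v) * P - (P * u * P) * (P * v * P).
    rewrite -2!mulrA (mulrA Q) (mulrA Q) QQ !mulrA mulrBr mulr1 !mulrBl.
    by rewrite -!mulrA; do ?rewrite (mulrA P P) PP.
  by rewrite !cut xy /commr; abel.
by apply: LB; apply: L11; rewrite ?LPQ ?LQP //; [exact: LPQ | exact: LQP | exact: LPQ | exact: LQP].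
Qed.

(** [O] is the off-diagonal part of [e] relative to [P]. Only its off-diagonal parts [n1], [n2]
    relative to [e] have to be removed by conjugation: the two diagonal ones are already in
    [L 2]. *)
Local Notation O := (P * e * Q + Q * e * P).
Local Notation n1 := (e * O * f).
Local Notation n2 := (f * O * e).
Local Notation E := (conj_idem e n1 n2).

Let ef : e * f = 0. Proof. by rewrite mulrBr mulr1 ee subrr. Qed.
Let fe : f * e = 0. Proof. by rewrite mulrBl mul1r ee subrr. Qed.

Let PPr x : x * P * P = x * P. Proof. by rewrite -mulrA PP. Qed.
Let eer x : x * e * e = x * e. Proof. by rewrite -mulrA ee. Qed.

Local Ltac idem_ring :=
  rewrite ?(mulrDl, mulrDr, mulrBl, mulrBr, mulNr, mulrN, opprK, mulrA,
            mul1r, mulr1, ee, eer, PP, PPr); abel.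

Let LO : L 1 O.
Proof. by apply: (tfLD tf); [exact: LPQ | exact: LQP]. Qed.

Let LePf : L 1 (e * P * f).
Proof.
have -> : e * P * f = - (e * commr P e) by rewrite /commr; idem_ring.
exact/(tfLN tf)/LMl.
Qed.

Let LfPe : L 1 (f * P * e).
Proof.
have -> : f * P * e = f * commr P e by rewrite /commr; idem_ring.
exact: LMl.
Qed.

(** [e * O * e] is twice [e * P * f * P * e], and [e * P * f] and [f * P * e] are both in [L 1]. *)
Let LeOe : L 2 (e * O * e).
Proof.
have -> : e * O * e = (e * P * f) * (f * P * e) + (e * P * f) * (f * P * e).
  idem_ring.
by apply: (tfLD tf); exact: L11.
Qed.

Let LfOf : L 2 (f * O * f).
Proof.
have -> : f * O * f = - ((f * P * e) * (e * P * f) + (f * P * e) * (e * P * f)).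
  idem_ring.
by apply/(tfLN tf)/(tfLD tf); exact: L11.
Qed.

Let en1 : e * n1 = n1. Proof. by rewrite !mulrA ee. Qed.
Let n1e : n1 * e = 0. Proof. by rewrite -mulrA fe mulr0. Qed.
Let en2 : e * n2 = 0. Proof. by rewrite !mulrA ef !mul0r. Qed.
Let n2e : n2 * e = n2. Proof. by rewrite -mulrA ee. Qed.

(** The left term is [e - O] and [E] is [e - n1 - n2] up to second order; the Pierce decomposition
    of [O] leaves only elements of [L 2]. *)
Let LE : L 2 ((P * e * P + Q * e * Q) - E).
Proof.
rewrite conj_idemE //; set m1 := n1; set m2 := n2.
have -> : P * e * P + Q * e * Q - (e - m1 - m2 + (m2 * m1 - m1 * m2 + m2 * m1 * m2)) =
   - (e * O * e + f * O * f + (m2 * m1 - m1 * m2 + m2 * m1 * m2)).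
  have -> : P * e * P + Q * e * Q = e - O by ncring.
  have {1}-> : O = e * O * e + m1 + m2 + f * O * f.
    exact: pierce_decomposition.
  abel.
have Lm1 : L 1 m1 by exact/LMr/LMl.
have Lm2 : L 1 m2 by exact/LMr/LMl.
apply/(tfLN tf)/(tfLD tf); first exact: (tfLD tf).
apply: (tfLD tf); last exact/LMr/L11.
by apply: LB; exact: L11.
Qed.

Let EE : E * E = E. Proof. exact: conj_idemK. Qed.

Let commr_zl x y : commr (z * x) y = z * commr x y.
Proof. by rewrite /commr mulrBr !mulrA (zC y). Qed.

Lemma alt_trace_compression : alt_trace (fun j => P * b j * P) = 0.
Proof.
have aX0 : almost_commuting (fun j => P * b j * P).
  by move=> j k; apply: compression_commr.
(* [Q * e * Q] is annihilated on both sides by [P * x * P], so it can be added for free. *)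
pose E0 := P * e * P + Q * e * Q.
have E0C x : commr E0 (P * x * P) = commr (P * e * P) (P * x * P).
  rewrite /commr /E0 (mulrDl (P * e * P)) (mulrDr (P * x * P)).
  have -> : Q * e * Q * (P * x * P) = 0 by rewrite -mulrA !(mulrA Q) QP !mul0r mulr0.
  have -> : P * x * P * (Q * e * Q) = 0.
    by rewrite -mulrA -(mulrA Q) (mulrA P) PQ mul0r mulr0.
  by rewrite !addr0.
pose X j := if j == i then z * E0 else P * b j * P.
have bziP : P * b i * P = z * (P * e * P) by rewrite bi !mulrA zC.
have commX j : j != i -> commr (P * b i * P) (P * b j * P) = commr (X i) (X j).
  by move=> nj; rewrite /X eqxx (negPf nj) bziP !commr_zl E0C.
have -> : alt_trace (fun j => P * b j * P) = alt_trace X.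
  by apply: (@eq_alt_trace _ _ i) => j nj; [rewrite /X (negPf nj) | exact: commX].
have aX : almost_commuting X.
  move=> j k; have [->|nj] := eqVneq j i; have [->|nk] := eqVneq k i.
  - by rewrite /commr subrr; exact: (tfL0 tf).
  - by rewrite -commX.
  - by rewrite commrC -commX //; exact: (tfLN tf).
  - by rewrite /X (negPf nj) (negPf nk).
(* From here on only these two properties of [E] matter; hiding its formula keeps the expansions
   small. *)
have [g gg Lg] : exists2 g, g * g = g & L 2 (E0 - g) by exists E; [exact: EE | exact: LE].
have ggr x : x * g * g = x * g by rewrite -mulrA gg.
have LgX x : e * x = x * e -> L 1 (commr P x) -> L 2 (commr g (P * x * P)).
  by move=> ex Lx; apply: (L_commr_mod Lg); rewrite E0C; exact: compression_commr.
(* The other arguments are made block diagonal for [g], hence commute with it exactly. What is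
   removed is a combination of multiples of their commutator with [g]. *)
pose Y j := if j == i then z * g
  else g * (P * b j * P) * g + (1 - g) * (P * b j * P) * (1 - g).
rewrite (@alt_trace_mod X Y) //.
  apply: (@alt_trace_commuting _ i) => j; rewrite {1}/Y eqxx commr_zl /Y.
  case: ifP => _; first by rewrite commrC commr_zl /commr subrr mulr0 oppr0 mulr0.
  move: (P * b j * P) => W; rewrite (_ : commr _ _ = 0) ?mulr0 // /commr.
  by rewrite ?(mulrDl, mulrDr, mulrBl, mulrBr, mulNr, mulrN, opprK, mulrA, mul1r, mulr1, gg, ggr); abel.
move=> j; rewrite /X /Y; case: ifP => _; first by rewrite -mulrBr; exact/LMl/Lg.
have := LgX _ (eC j) (LPb j); move: (P * b j * P) => W LgW.
have -> : W - (g * W * g + (1 - g) * W * (1 - g)) =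
    g * commr g W * (1 - g) - (1 - g) * commr g W * g.
  rewrite /commr ?(mulrDl, mulrDr, mulrBl, mulrBr, mulNr, mulrN, opprK, mulrA, mul1r, mulr1, gg, ggr).
  abel.
by apply: LB; exact/LMr/LMl.
Qed.

End Compression.

Lemma almost_commuting_compression (P : B) (b : 'I_N -> B) : P * P = P ->
  (forall j k, b j * b k = b k * b j) -> (forall j, L 1 (commr P (b j))) ->
  almost_commuting (fun j => P * b j * P).
Proof. by move=> PP bC LPb j k; apply: (compression_commr PP). Qed.

Lemma alt_trace_compression_sum (P : B) (b : 'I_N -> B) (i : 'I_N) (n : nat)
    (z e : 'I_n -> B) :
  P * P = P -> (forall j k, b j * b k = b k * b j) -> (forall j, L 1 (commr P (b j))) ->
  (forall k, e k * e k = e k) -> (forall k l, e k * e l = e l * e k) ->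
  (forall k x, z k * x = x * z k) ->
  (forall k j, e k * b j = b j * e k) -> (forall k, L 1 (commr P (e k))) ->
  b i = \sum_k z k * e k ->
  alt_trace (fun j => P * b j * P) = 0.
Proof.
move=> PP; elim: n => [|n IHn] in b z e *; move=> bC LPb ee eeC zC eC LPe bi.
  apply: (@alt_trace_L2 _ i); first exact: almost_commuting_compression.
  by rewrite bi big_ord0 mulr0 mul0r; exact: (tfL0 tf).
(* The summand of index 0 is split off from argument [i]: [b2] holds it alone, [b1] holds the rest
   for the induction. *)
pose b1 j := if j == i then \sum_(k < n) z (lift ord0 k) * e (lift ord0 k) else b j.
pose b2 j := if j == i then z ord0 * e ord0 else b j.
have LPz k : L 1 (commr P (z k * e k)).
  have -> : commr P (z k * e k) = z k * commr P (e k) by rewrite /commr mulrBr !mulrA (zC k P).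
  exact: LMl.
have sumC k j : (z k * e k) * b j = b j * (z k * e k).
  by rewrite -mulrA eC !mulrA (zC k (b j)).
have eszC k l : e k * (z l * e l) = (z l * e l) * e k.
  by rewrite mulrA -(zC l (e k)) -!mulrA eeC.
have [b1C LPb1] : (forall j k, b1 j * b1 k = b1 k * b1 j) /\ (forall j, L 1 (commr P (b1 j))).
  split=> [j k|j]; rewrite /b1.
    case: (j == i); case: (k == i) => //; rewrite mulr_suml mulr_sumr;
      apply: eq_bigr => l _; by rewrite sumC.
  case: eqP => // _; rewrite /commr mulr_sumr mulr_suml -sumrB.
  by apply: tf_L_sum => k _; exact: LPz.
have [b2C LPb2] : (forall j k, b2 j * b2 k = b2 k * b2 j) /\ (forall j, L 1 (commr P (b2 j))).
  by split=> [j k|j]; rewrite /b2; [case: (j == i); case: (k == i) => // | case: (j == i)].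
rewrite (@alt_trace_add _ (fun j => P * b1 j * P) (fun j => P * b2 j * P) i).
- rewrite (IHn b1 (fun k => z (lift ord0 k)) (fun k => e (lift ord0 k))) //; last 2 first.
  + move=> k j; rewrite /b1; case: eqP => // _; rewrite mulr_sumr mulr_suml.
    apply: eq_bigr => l _; exact: eszC.
  + by rewrite /b1 eqxx.
  rewrite add0r; apply: (@alt_trace_compression P b2 i (e ord0) (z ord0)) => //.
    move=> j; rewrite /b2; by case: eqP.
  by rewrite /b2 eqxx.
- exact: almost_commuting_compression.
- exact: almost_commuting_compression.
- by rewrite /b1 /b2 eqxx bi big_ord_recl addrC mulrDr mulrDl.
by move=> j nj; rewrite /b1 /b2 (negPf nj).
Qed.

(** Both full alternating traces are the same multiple, by [N * 2 ^ q], of the restricted sums, and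
    [K] has characteristic 0. *)
Lemma eq_sum_increasing X Y : almost_commuting X -> almost_commuting Y ->
  alt_trace X = alt_trace Y ->
  \sum_(s : 'S_N | (s ord0 == ord0) && increasing_pairs q s) alt_term X s =
  \sum_(s : 'S_N | (s ord0 == ord0) && increasing_pairs q s) alt_term Y s.
Proof.
move=> aX aY; rewrite !alt_trace_fix0 // !(@sum_alt_term_increasing _ q) // => /eqP.
rewrite -!mulrnA -subr_eq0 -mulrnBl mulrn_eq0 muln_eq0 expn_eq0 /= subr_eq0.
by move=> /eqP.
Qed.

End AlternatingTrace.

Lemma sum_lift0_perm (V : zmodType) (n : nat) (Q : pred 'S_n.+1) (F : 'S_n.+1 -> V) :
  \sum_(s : 'S_n | Q (lift0_perm s)) F (lift0_perm s) =
  \sum_(s : 'S_n.+1 | (s ord0 == ord0) && Q s) F s.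
Proof.
(* Unlifting at [s ord0] rather than at [ord0] makes [r s] injective for every [s], so it defines a
   permutation without assuming that [s] fixes 0. *)
pose r (s : 'S_n.+1) k := odflt k (unlift (s ord0) (s (lift ord0 k))).
have rK (s : 'S_n.+1) k : lift (s ord0) (r s k) = s (lift ord0 k).
  have /unlift_some[l sl ul] : s ord0 != s (lift ord0 k).
    by rewrite (inj_eq perm_inj) neq_lift.
  by rewrite /r ul sl.
have r_inj s : injective (r s).
  by move=> k l kl; have := rK s k; rewrite kl rK => /perm_inj/lift_inj.
rewrite [RHS](reindex (fun s : 'S_n => lift0_perm s)) /=.
  by apply: eq_bigl => s; rewrite lift0_perm0 eqxx.
exists (fun s => perm (r_inj s)) => [s _|s /andP[/eqP s0 _]]; apply/permP => k.
  rewrite permE; apply: (@lift_inj _ ord0).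
  by have := rK (lift0_perm s) k; rewrite lift0_perm0 => ->; rewrite lift0_perm_lift.
case: (unliftP ord0 k) => [l|] ->; last by rewrite lift0_perm0 s0.
by rewrite lift0_perm_lift permE -(rK s) s0.
Qed.

(** * Hilbert spaces and bounded operators *)

(** Norms over [R[i]] take values in [R[i]]; the real part gives access to suprema and to the order
    of [R]. *)
Definition nrm {R : realType} {V : normedZmodType R[i]} (x : V) : R := complex.Re `|x|.

Section RealNorm.
Context {R : realType}.
Local Notation C := R[i].

Section Normed.
Context {V : normedZmodType C}.
Implicit Types x y : V.

Lemma nrmE x : `|x| = (nrm x)%:C.
Proof. by rewrite /nrm RRe_real // ger0_real. Qed.

Lemma nrm_ge0 x : 0 <= nrm x.
Proof. by have := normr_ge0 x; rewrite nrmE lecR. Qed.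

Lemma nrmD x y : nrm (x + y) <= nrm x + nrm y.
Proof. by rewrite -lecR rmorphD /= -!nrmE; exact: ler_normD. Qed.

Lemma nrmN x : nrm (- x) = nrm x.
Proof. by rewrite /nrm normrN. Qed.

Lemma nrmB x y : nrm (x - y) = nrm (y - x).
Proof. by rewrite -nrmN opprB. Qed.

Lemma nrm0 : nrm (0 : V) = 0.
Proof. by rewrite /nrm normr0. Qed.

Lemma nrm_eq0 x : nrm x = 0 -> x = 0.
Proof. by move=> x0; apply/eqP; rewrite -normr_eq0 nrmE x0. Qed.

Lemma nrm_triangle z x y : nrm (x - y) <= nrm (x - z) + nrm (z - y).
Proof. by have := nrmD (x - z) (z - y); rewrite addrA subrK. Qed.

Lemma nrm_sum (I : Type) (r : seq I) (P : pred I) (F : I -> V) :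
  nrm (\sum_(i <- r | P i) F i) <= \sum_(i <- r | P i) nrm (F i).
Proof.
elim/big_rec2: _ => [|i y x _ IH]; first by rewrite nrm0.
by apply: (le_trans (nrmD _ _)); rewrite lerD2l.
Qed.

Definition tends (u : nat -> V) (l : V) :=
  forall eps : R, 0 < eps -> exists N, forall n, (N <= n)%N -> nrm (u n - l) <= eps.

Lemma eq_nrm0 x : (forall eps : R, 0 < eps -> nrm x <= eps) -> x = 0.
Proof.
move=> x0; apply: nrm_eq0; apply/eqP; rewrite eq_le nrm_ge0 andbT.
by apply/ler_addgt0Pr => e e0; rewrite add0r; exact: x0.
Qed.

Lemma tends_unique u l l' : tends u l -> tends u l' -> l = l'.
Proof.
move=> ul ul'; apply/eqP; rewrite -subr_eq0; apply/eqP/eq_nrm0 => e e0.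
have e2 : 0 < e / 2 by rewrite divr_gt0.
have [N1 H1] := ul _ e2; have [N2 H2] := ul' _ e2.
apply: (le_trans (nrm_triangle (u (maxn N1 N2)) _ _)); rewrite (splitr e).
apply: lerD; first by rewrite nrmB; apply: H1; rewrite leq_maxl.
by apply: H2; rewrite leq_maxr.
Qed.

Lemma tends_cst l : tends (fun=> l) l.
Proof. by move=> e e0; exists 0%N => n _; rewrite subrr nrm0 ltW. Qed.

Lemma tendsD u v l k : tends u l -> tends v k -> tends (fun n => u n + v n) (l + k).
Proof.
move=> ul vk e e0; have e2 : 0 < e / 2 by rewrite divr_gt0.
have [N1 H1] := ul _ e2; have [N2 H2] := vk _ e2.
exists (maxn N1 N2) => n; rewrite geq_max => /andP[n1 n2].
rewrite opprD addrACA (splitr e); apply: (le_trans (nrmD _ _)).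
by apply: lerD; [exact: H1 | exact: H2].
Qed.

End Normed.

Lemma nrmM (a b : C) : nrm (a * b) = nrm a * nrm b.
Proof. by apply: complexI; rewrite rmorphM /= -!nrmE normrM. Qed.

Lemma nrm1 : nrm (1 : C) = 1.
Proof. by rewrite /nrm normr1. Qed.

Lemma nrm_conj (a : C) : nrm (Num.conj a) = nrm a.
Proof. by rewrite /nrm norm_conjC. Qed.

Lemma nrm_real (r : R) : nrm (r%:C) = `|r|.
Proof. by rewrite /nrm normc_def /= expr0n addr0 sqrtr_sqr. Qed.

Lemma Re_le_nrm (a : C) : `|complex.Re a| <= nrm a.
Proof. by rewrite -lecR -nrmE; exact: normc_ge_Re. Qed.

Section NormedModule.
Context {V : normedModType C}.

Lemma nrmZ (a : C) (x : V) : nrm (a *: x) = nrm a * nrm x.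
Proof. by apply: complexI; rewrite rmorphM /= -!nrmE normrZ. Qed.

Lemma cvg_tends (u : nat -> V) l : u @ \oo --> l -> tends u l.
Proof.
move=> /cvgrPdist_le ul e e0.
have /ul[N _ HN] : 0 < e%:C by rewrite ltcR.
by exists N => n Nn; rewrite nrmB -lecR -nrmE; exact: HN.
Qed.

Lemma tends_cvg (u : nat -> V) l : tends u l -> u @ \oo --> l.
Proof.
move=> ul; apply/cvgrPdist_le => e e0.
have eE : e = (complex.Re e)%:C by rewrite RRe_real // gtr0_real.
have [|N HN] := ul (complex.Re e); first by rewrite -ltcR -eE.
by exists N => // n /= Nn; rewrite eE nrmE lecR nrmB; exact: HN.
Qed.

End NormedModule.

Lemma nrm_complete (V : completeNormedModType C) (u : nat -> V) :
  (forall eps : R, 0 < eps -> exists N, forall n m, (N <= n)%N -> (N <= m)%N ->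
     nrm (u n - u m) <= eps) -> exists l, tends u l.
Proof.
move=> uC; suff: cvg (u @ \oo) by move=> /cvg_tends ul; eexists; exact: ul.
apply: cauchy_cvg; apply/cauchyP => e e0.
have eE : e = (complex.Re e)%:C by rewrite RRe_real // gtr0_real.
have e1 : 0 < complex.Re e by rewrite -ltcR -eE.
have [|N HN] := uC (complex.Re e / 2); first by rewrite divr_gt0.
exists (u N); exists N => // n /= Nn; rewrite -ball_normE /= nrmE eE ltcR.
by apply: (le_lt_trans (HN _ _ _ Nn)); rewrite // ltr_pdivrMr // mulr_natr mulr2n ltrDl.
Qed.

End RealNorm.

(** * Inner products, orthonormal lists and projections *)

Section InnerProduct.
Context {R : realType} {H : hilbertType R}.
Local Notation C := R[i].
Implicit Types (x y z u v : H) (s : seq H).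

Definition ip x y : C := hdot x y.

Lemma ipDl x y z : ip (x + y) z = ip x z + ip y z.
Proof. by rewrite /ip linearDl. Qed.

Lemma ipZl (a : C) x y : ip (a *: x) y = a * ip x y.
Proof. by rewrite /ip linearZl_LR. Qed.

Lemma ipC x y : ip x y = Num.conj (ip y x).
Proof. by rewrite /ip hermC expr0 mul1r. Qed.

Lemma conjCreal (r : R) : Num.conj (r%:C : C) = r%:C.
Proof. by apply: conj_Creal; rewrite complex_real. Qed.

Lemma ip0l x : ip 0 x = 0.
Proof. by rewrite -(scale0r x) ipZl mul0r. Qed.

Lemma ipNl x y : ip (- x) y = - ip x y.
Proof. by rewrite -scaleN1r ipZl mulN1r. Qed.

Lemma ipBl x y z : ip (x - y) z = ip x z - ip y z.
Proof. by rewrite ipDl ipNl. Qed.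

Lemma ip_suml (I : Type) (r : seq I) (P : pred I) (F : I -> H) z :
  ip (\sum_(i <- r | P i) F i) z = \sum_(i <- r | P i) ip (F i) z.
Proof.
by elim/big_rec2: _ => [|i a b _ <-]; rewrite ?ip0l ?ipDl.
Qed.

Lemma ip0r x : ip x 0 = 0.
Proof. by rewrite ipC ip0l rmorph0. Qed.

Lemma ipDr x y z : ip x (y + z) = ip x y + ip x z.
Proof. by rewrite ipC ipDl rmorphD /= -!ipC. Qed.

Lemma ipNr x y : ip x (- y) = - ip x y.
Proof. by rewrite ipC ipNl rmorphN /= -ipC. Qed.

Lemma ipBr x y z : ip x (y - z) = ip x y - ip x z.
Proof. by rewrite ipDr ipNr. Qed.

Lemma ipZr (a : C) x y : ip x (a *: y) = Num.conj a * ip x y.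
Proof. by rewrite ipC ipZl rmorphM /= -ipC. Qed.

Lemma ip_sumr (I : Type) (r : seq I) (P : pred I) (F : I -> H) z :
  ip z (\sum_(i <- r | P i) F i) = \sum_(i <- r | P i) ip z (F i).
Proof.
by elim/big_rec2: _ => [|i a b _ <-]; rewrite ?ip0r ?ipDr.
Qed.

Lemma ipxx x : ip x x = (nrm x ^+ 2)%:C.
Proof. by rewrite /ip hdotxx nrmE rmorphXn. Qed.

Lemma nrm_sqrE (a : C) : (nrm a ^+ 2)%:C = a * Num.conj a.
Proof. by rewrite rmorphXn /= -nrmE normCK. Qed.

Lemma ip_ge0_eq x : ip x x = 0 -> x = 0.
Proof. by rewrite ipxx => -[/eqP]; rewrite sqrf_eq0 => /eqP/nrm_eq0. Qed.

Lemma cauchy_schwarz x y : nrm (ip x y) <= nrm x * nrm y.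
Proof.
have [->|y0] := eqVneq y 0; first by rewrite ip0r !nrm0 mulr0.
have ny : 0 < nrm y.
  by rewrite lt_neqAle nrm_ge0 andbT eq_sym; apply: contra_neq y0; exact: nrm_eq0.
have nyC : (nrm y ^+ 2)%:C != 0 :> C by rewrite fmorph_eq0 expf_eq0 gt_eqF.
set c := ip x y; pose t := c / (nrm y ^+ 2)%:C.
have cJ : ip y x = Num.conj c by rewrite ipC.
have tJ : Num.conj t = Num.conj c / (nrm y ^+ 2)%:C.
  by rewrite /t fmorph_div /= conjCreal.
have : ip (x - t *: y) (x - t *: y) = ip x x - (nrm c ^+ 2 / nrm y ^+ 2)%:C.
  rewrite ipBl !ipBr !ipZl !ipZr cJ -/c (ipxx y) tJ fmorph_div /= nrm_sqrE /t.
  move: (_%:C) nyC (Num.conj c) => n n0 d; by field.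
rewrite !ipxx -rmorphB /= => -[] E.
have : 0 <= nrm x ^+ 2 - nrm c ^+ 2 / nrm y ^+ 2 by rewrite -E sqr_ge0.
rewrite subr_ge0 ler_pdivrMr ?exprn_gt0 // -exprMn ler_sqr ?nnegrE ?mulr_ge0 ?nrm_ge0 //.
Qed.

Definition ortho s : bool :=
  pairwise (fun x y => ip x y == 0) s && all (fun x => (x == 0) || (ip x x == 1)) s.

Definition proj s x : H := \sum_(e <- s) ip x e *: e.

Lemma ortho_cons e s : ortho (e :: s) =
  [&& all (fun y => ip e y == 0) s, (e == 0) || (ip e e == 1) & ortho s].
Proof. by rewrite /ortho /= -!andbA; congr andb; rewrite andbCA. Qed.

Lemma ip_proj s x e : ortho s -> e \in s -> ip (proj s x) e = ip x e.
Proof.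
elim: s => // e' s IHs; rewrite ortho_cons => /and3P[/allP ee' e'1 os].
rewrite /proj big_cons ipDl ipZl inE => /orP[/eqP->|es].
  rewrite ip_suml big_seq big1 ?addr0.
    by case/orP: e'1 => /eqP->; rewrite ?ip0r ?mulr1 ?mulr0.
  by move=> d /ee' /eqP d0; rewrite ipZl [ip d _]ipC d0 rmorph0 mulr0.
by rewrite (eqP (ee' _ es)) mulr0 add0r IHs.
Qed.

Lemma ip_sub_proj s x e : ortho s -> e \in s -> ip (x - proj s x) e = 0.
Proof. by move=> os es; rewrite ipBl ip_proj // subrr. Qed.

Lemma ip_projl s x y : ip (proj s x) y = \sum_(e <- s) ip x e * ip e y.
Proof. by rewrite ip_suml; apply: eq_bigr => e _; rewrite ipZl. Qed.

Lemma ip_projx s x : ip (proj s x) x = (\sum_(e <- s) nrm (ip x e) ^+ 2)%:C.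
Proof.
by rewrite ip_projl rmorph_sum; apply: eq_bigr => e _; rewrite /= nrm_sqrE -ipC.
Qed.

Lemma ip_sub_proj_proj s x y : ortho s -> ip (x - proj s x) (proj s y) = 0.
Proof.
move=> os; rewrite ip_sumr big_seq big1 // => e es.
by rewrite ipZr ip_sub_proj // mulr0.
Qed.

Lemma pythagoras s x : ortho s ->
  nrm (x - proj s x) ^+ 2 = nrm x ^+ 2 - \sum_(e <- s) nrm (ip x e) ^+ 2.
Proof.
move=> os; apply: complexI; rewrite rmorphB /= -!ipxx -ip_projx ipBr.
by rewrite ip_sub_proj_proj // subr0 ipBl.
Qed.

Lemma bessel s x : ortho s -> \sum_(e <- s) nrm (ip x e) ^+ 2 <= nrm x ^+ 2.
Proof. by move=> os; rewrite -subr_ge0 -pythagoras // sqr_ge0. Qed.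

Lemma nrm_sub_proj s x : ortho s -> nrm (x - proj s x) <= nrm x.
Proof.
move=> os; rewrite -ler_sqr ?nnegrE ?nrm_ge0 // pythagoras // gerBl.
by apply: sumr_ge0 => e _; rewrite sqr_ge0.
Qed.

Lemma nrm_proj s x : ortho s -> nrm (proj s x) <= nrm x.
Proof.
move=> os; rewrite -ler_sqr ?nnegrE ?nrm_ge0 //.
have -> : nrm (proj s x) ^+ 2 = \sum_(e <- s) nrm (ip x e) ^+ 2.
  apply: complexI; rewrite -ip_projx -ipxx; apply/eqP.
  by rewrite eq_sym -subr_eq0 -ipBr ipC ip_sub_proj_proj // rmorph0.
exact: bessel.
Qed.

Lemma gram_schmidt (us : seq H) :
  exists s, [/\ ortho s, size s = size us & {in us, forall u, proj s u = u}].
Proof.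
elim: us => [|u us [s [os ss us_s]]]; first by exists [::].
pose r := u - proj s u; pose e := (nrm r)^-1%:C *: r.
have re d : d \in s -> ip e d = 0 by move=> ds; rewrite ipZl ip_sub_proj // mulr0.
have e1 : (e == 0) || (ip e e == 1).
  have [r0|r0] := eqVneq r 0; first by rewrite /e r0 scaler0 eqxx.
  have nr : nrm r != 0 by apply: contra_neq r0; exact: nrm_eq0.
  rewrite /e ipZl ipZr ipxx conjCreal -!rmorphM /=.
  apply/orP; right; apply/eqP.
  by have -> : (nrm r)^-1 * ((nrm r)^-1 * nrm r ^+ 2) = 1 by field.
exists (e :: s); split; first by rewrite ortho_cons e1 os !andbT; apply/allP => d /re ->.
  by rewrite /= ss.
have ipe y : ip (proj s y) e = 0.
  by rewrite ip_projl big_seq big1 // => d /re de; rewrite [ip d e]ipC de rmorph0 mulr0.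
move=> v; rewrite inE => /orP[/eqP->|vus]; rewrite {1}/proj big_cons -/(proj s _).
  rewrite -[ip u e](subr0) -(ipe u) -ipBl -/r.
  have [r0|r0] := eqVneq r 0; first by rewrite r0 ip0l scale0r add0r -[RHS](subrK (proj s u)) -/r r0 add0r.
  have nr : nrm r != 0 by apply: contra_neq r0; exact: nrm_eq0.
  rewrite /e ipZr ipxx conjCreal scalerA -!rmorphM /=.
  have -> : (nrm r)^-1 * nrm r ^+ 2 / nrm r = 1 by field.
  by rewrite scale1r subrK.
by rewrite -{1}(us_s v vus) ipe scale0r add0r us_s.
Qed.

Lemma parallelogram x y : nrm (x - y) ^+ 2 = nrm x ^+ 2 *+ 2 + nrm y ^+ 2 *+ 2 - nrm (x + y) ^+ 2.
Proof.
apply: complexI; rewrite rmorphB rmorphD !rmorphMn /= -!ipxx !ipDl !ipDr !ipNl !ipNr; ring.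
Qed.

End InnerProduct.

Section BoundedOperators.
Context {R : realType} {H : hilbertType R}.
Local Notation C := R[i].
Implicit Types (x y z : H).

Definition lin_bounded (V : normedModType C) (T : H -> V) :=
  linear T /\ exists2 M : R, 0 <= M & forall x, nrm (T x) <= M * nrm x.

Lemma small_sequence : exists2 r : nat -> R, forall n, 0 < r n &
  forall e, 0 < e -> exists N, forall n, (N <= n)%N -> r n <= e.
Proof.
exists (fun n => n.+1%:R^-1) => [n|e e0]; first by rewrite invr_gt0.
exists (Num.truncn e^-1) => n Nn; rewrite -[e]invrK lef_pV2 ?posrE ?invr_gt0 //.
by apply: ltW; apply: lt_le_trans (truncnS_gt _) _; rewrite ler_nat.
Qed.

(** The representing vector minimises [J x = |x|^2 - 2 Re (f x)]. By the parallelogram law a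
    minimising sequence is Cauchy. *)
Lemma riesz_representation (f : H -> C^o) : lin_bounded f ->
  exists z, forall x, f x = ip x z.
Proof.
move=> [f_lin [M M0 fM]].
have fD x y : f (x + y) = f x + f y by rewrite -{1}[x]scale1r f_lin scale1r.
have f0 : f 0 = 0 by apply: (addrI (f 0)); rewrite -fD !addr0.
have fZ a x : f (a *: x) = a * f x by rewrite -{1}[a *: x]addr0 f_lin f0 addr0.
pose J x : R := nrm x ^+ 2 - complex.Re (f x) *+ 2.
have J_ge x : - M ^+ 2 <= J x.
  have : complex.Re (f x) <= M * nrm x.
    by apply: le_trans (fM x); apply: le_trans (Re_le_nrm _); exact: ler_norm.
  by rewrite /J; have := sqr_ge0 (nrm x - M); lra.
pose S : set R := range J.
have S_inf : has_inf S.
  by split; [exists (J 0), 0 | exists (- M ^+ 2) => _ [x _ <-]].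
set d := inf S.
have d_le x : d <= J x by apply: ge_inf; [exact: S_inf.2 | exists x].
have [r r0 inv_small] := small_sequence.
have /choice[u Ju] : forall n : nat, exists x, J x < d + r n.
  by move=> n; have [_ [x _ <-] Jx] := inf_adherent (r0 n) S_inf; exists x.
have Jmid x y : nrm (x - y) ^+ 2 <= (J x + J y - d *+ 2) *+ 2.
  have := d_le ((2^-1 : R)%:C *: (x + y)).
  rewrite /J parallelogram nrmZ nrm_real fZ fD.
  have -> : complex.Re ((2^-1 : R)%:C * (f x + f y)) = (complex.Re (f x) + complex.Re (f y)) / 2.
    by case: (f x) (f y) => [a b] [a' b'] /=; rewrite mul0r subr0 mulrC.
  by rewrite ger0_norm ?invr_ge0 // exprMn; set a := nrm (x + y) ^+ 2; lra.
have [z uz] : exists z, tends u z.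
  apply: nrm_complete => e e0; have e4 : 0 < e ^+ 2 / 4 by rewrite divr_gt0 ?exprn_gt0.
  have [N HN] := inv_small _ e4; exists N => n m Nn Nm.
  rewrite -ler_sqr ?nnegrE ?nrm_ge0 ?(ltW e0) //; apply: (le_trans (Jmid _ _)).
  have := Ju n; have := Ju m; have := HN _ Nn; have := HN _ Nm; lra.
have Re_eq h : complex.Re (ip z h) = complex.Re (f h).
  pose k := nrm h ^+ 2 + 1; have k0 : 0 < k by rewrite ltr_wpDl ?sqr_ge0.
  pose g n := complex.Re (ip (u n) h) - complex.Re (f h).
  (* First variation at an approximate minimiser: moving [u n] by [t h] lowers [J] by at most
     [r n]. *)
  have var n (t : R) : - r n <= (t * g n) *+ 2 + t ^+ 2 * nrm h ^+ 2.
    have := d_le (u n + t%:C *: h); have := Ju n; rewrite /J fD fZ.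
    have -> : nrm (u n + t%:C *: h) ^+ 2 =
        nrm (u n) ^+ 2 + (t * complex.Re (ip (u n) h)) *+ 2 + t ^+ 2 * nrm h ^+ 2.
      have -> : forall x, nrm x ^+ 2 = complex.Re (ip x x) by move=> x; rewrite ipxx.
      rewrite ipDl !ipDr !ipZl !ipZr conjCreal (ipxx h) (ipxx (u n)).
      have -> : ip h (u n) = Num.conj (ip (u n) h) by exact: ipC.
      by case: (ip (u n) h) => a b /=; ring.
    have -> : complex.Re (f (u n) + t%:C * f h) =
        complex.Re (f (u n)) + t * complex.Re (f h).
      by case: (f (u n)) (f h) => [a b] [a' b'] /=; rewrite mul0r subr0.
    rewrite /g; lra.
  have g_small n : g n ^+ 2 <= k * r n.
    (* A nearly optimal step; [k] exceeds [|h|^2] by 1 so that one can divide by it. *)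
    have := var n (- g n / k).
    have -> : (- g n / k * g n) *+ 2 + (- g n / k) ^+ 2 * nrm h ^+ 2 =
       - (g n ^+ 2 / k) - g n ^+ 2 / k ^+ 2.
      by rewrite /k; field; rewrite gt_eqF.
    have : 0 <= g n ^+ 2 / k ^+ 2 by rewrite divr_ge0 ?sqr_ge0.
    move=> g1 g2; have : g n ^+ 2 / k <= r n by lra.
    by rewrite ler_pdivrMr // mulrC.
  apply/eqP; rewrite -subr_eq0 -normr_le0; apply/ler_addgt0Pr => e e0; rewrite add0r.
  have e2 : 0 < e / 2 by rewrite divr_gt0.
  have [N1 HN1] := inv_small ((e / 2) ^+ 2 / k) (divr_gt0 (exprn_gt0 2 e2) k0).
  have [|N2 HN2] := uz (e / 2 / (nrm h + 1)).
    by rewrite divr_gt0 // ltr_wpDl ?nrm_ge0.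
  pose n := maxn N1 N2.
  have gn : `|g n| <= e / 2.
    rewrite -ler_sqr ?nnegrE ?(ltW e2) // real_normK ?num_real //.
    apply: (le_trans (g_small n)); have := HN1 n (leq_maxl _ _).
    by rewrite ler_pdivlMr // mulrC.
  have dn : `|complex.Re (ip z h) - complex.Re (ip (u n) h)| <= e / 2.
    have -> : complex.Re (ip z h) - complex.Re (ip (u n) h) = complex.Re (ip (z - u n) h).
      by rewrite ipBl; case: (ip z h) (ip (u n) h) => [a b] [a' b'].
    apply: (le_trans (Re_le_nrm _)); apply: (le_trans (cauchy_schwarz _ _)).
    rewrite nrmB; have := HN2 n (leq_maxr _ _); rewrite ler_pdivlMr ?ltr_wpDl ?nrm_ge0 //.
    by apply: le_trans; rewrite ler_wpM2l ?nrm_ge0 // lerDl.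
  rewrite (_ : _ - _ = (complex.Re (ip z h) - complex.Re (ip (u n) h)) + g n); last first.
    by rewrite /g addrA subrK.
  by rewrite (splitr e); apply: (le_trans (ler_normD _ _)); exact: lerD.
(* Imaginary parts are reached by testing the equality of real parts at ['i *: x]. *)
exists z => x; have R1 := Re_eq x; have := Re_eq ('i *: x).
rewrite ipZr fZ ipC; move: R1; rewrite ipC.
case: (f x) (ip x z) => [a b] [a' b'] /= -> .
by rewrite !mul0r !mul1r !sub0r ?opprK ?mulrN1 ?mulN1r ?opprK => /oppr_inj ->.
Qed.

End BoundedOperators.

(** * The ring of bounded operators and adjoints *)

Section OperatorRing.
Context {R : realType} {H : hilbertType R}.
Local Notation C := R[i].

Record op := Op {opf :> H -> H; opfP : lin_bounded opf}.

HB.instance Definition _ := gen_eqMixin op.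
HB.instance Definition _ := gen_choiceMixin op.

Implicit Types (S T U : op) (x y : H).

Lemma op_ext S T : (forall x, S x = T x) -> S = T.
Proof.
case: S T => [f fP] [g gP] /= /funext fg; rewrite -{}fg in gP *.
by rewrite (Prop_irrelevance fP gP).
Qed.

Lemma opD T x y : T (x + y) = T x + T y.
Proof. by have [lin _] := opfP T; rewrite -{1}[x]scale1r lin scale1r. Qed.

Lemma op0 T : T 0 = 0.
Proof. by apply: (addrI (T 0)); rewrite -opD !addr0. Qed.

Lemma opZ T (a : C) x : T (a *: x) = a *: T x.
Proof. by have [lin _] := opfP T; rewrite -{1}[a *: x]addr0 lin op0 addr0. Qed.

Lemma opN T x : T (- x) = - T x.
Proof. by rewrite -scaleN1r opZ scaleN1r. Qed.

Lemma opB T x y : T (x - y) = T x - T y.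
Proof. by rewrite opD opN. Qed.

Lemma op_sum T (I : Type) (r : seq I) (P : pred I) (F : I -> H) :
  T (\sum_(i <- r | P i) F i) = \sum_(i <- r | P i) T (F i).
Proof. by elim/big_rec2: _ => [|i a b _ <-]; rewrite ?op0 ?opD. Qed.

Lemma op_bounded T : exists2 M : R, 0 <= M & forall x, nrm (T x) <= M * nrm x.
Proof. by have [_] := opfP T. Qed.

Fact op_zero_subproof : lin_bounded (fun _ : H => 0 : H).
Proof.
split=> [a x y|]; first by rewrite scaler0 addr0.
by exists 0 => // x; rewrite nrm0 mul0r.
Qed.

Fact op_one_subproof : lin_bounded (fun x : H => x).
Proof. by split=> [//|]; exists 1 => // x; rewrite mul1r. Qed.

Fact op_add_subproof S T : lin_bounded (fun x => S x + T x).
Proof.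
split=> [a x y|]; first by rewrite !opD !opZ scalerDr addrACA.
have [M M0 HM] := op_bounded S; have [N N0 HN] := op_bounded T.
exists (M + N) => [|x]; first exact: addr_ge0.
by apply: (le_trans (nrmD _ _)); rewrite mulrDl lerD.
Qed.

Fact op_opp_subproof T : lin_bounded (fun x => - T x).
Proof.
split=> [a x y|]; first by rewrite opD opZ opprD scalerN.
by have [M M0 HM] := op_bounded T; exists M => // x; rewrite nrmN.
Qed.

Fact op_mul_subproof S T : lin_bounded (fun x => S (T x)).
Proof.
split=> [a x y|]; first by rewrite !opD !opZ.
have [M M0 HM] := op_bounded S; have [N N0 HN] := op_bounded T.
exists (M * N) => [|x]; first exact: mulr_ge0.
by apply: (le_trans (HM _)); rewrite -mulrA ler_wpM2l.
Qed.

Fact op_scalar_subproof (a : C) : lin_bounded (fun x : H => a *: x).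
Proof.
split=> [b x y|]; first by rewrite scalerDr !scalerA mulrC.
by exists (nrm a) => [|x]; [exact: nrm_ge0 | rewrite nrmZ].
Qed.

Definition op_zero := Op op_zero_subproof.
Definition op_one := Op op_one_subproof.
Definition op_add S T := Op (op_add_subproof S T).
Definition op_opp T := Op (op_opp_subproof T).
Definition op_mul S T := Op (op_mul_subproof S T).
Definition op_scalar a := Op (op_scalar_subproof a).

Fact op_addA : associative op_add.
Proof. by move=> S T U; apply: op_ext => x /=; rewrite addrA. Qed.
Fact op_addC : commutative op_add.
Proof. by move=> S T; apply: op_ext => x /=; rewrite addrC. Qed.
Fact op_add0 : left_id op_zero op_add.
Proof. by move=> T; apply: op_ext => x /=; rewrite add0r. Qed.
Fact op_addN : left_inverse op_zero op_opp op_add.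
Proof. by move=> T; apply: op_ext => x /=; rewrite addNr. Qed.

HB.instance Definition _ := GRing.isZmodule.Build op op_addA op_addC op_add0 op_addN.

Fact op_mulA : associative op_mul.
Proof. by move=> S T U; apply: op_ext. Qed.
Fact op_mul1 : left_id op_one op_mul.
Proof. by move=> T; apply: op_ext. Qed.
Fact op_mulr1 : right_id op_one op_mul.
Proof. by move=> T; apply: op_ext. Qed.
Fact op_mulDl : left_distributive op_mul +%R.
Proof. by move=> S T U; apply: op_ext. Qed.
Fact op_mulDr : right_distributive op_mul +%R.
Proof. by move=> S T U; apply: op_ext => x; exact: opD. Qed.

HB.instance Definition _ := GRing.Zmodule_isPzRing.Build op
  op_mulA op_mul1 op_mulr1 op_mulDl op_mulDr.

(** Alternating traces are developed over a bare ring; complex scalars enter it as these central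
    elements. *)
Lemma op_scalarC a T : op_scalar a * T = T * op_scalar a.
Proof. by apply: op_ext => x /=; rewrite opZ. Qed.

Lemma adjoint_bound T (S : H -> H) M : (forall x y, ip (T x) y = ip x (S y)) ->
  0 <= M -> (forall x, nrm (T x) <= M * nrm x) -> forall y, nrm (S y) <= M * nrm y.
Proof.
move=> TS M0 HM y; have [->|Sy] := eqVneq (S y) 0.
  by rewrite nrm0 mulr_ge0 ?nrm_ge0.
have nS : 0 < nrm (S y).
  by rewrite lt_neqAle nrm_ge0 andbT eq_sym; apply: contra_neq Sy; exact: nrm_eq0.
rewrite -(ler_pM2l nS).
have : nrm (ip (T (S y)) y) <= M * nrm (S y) * nrm y.
  by apply: (le_trans (cauchy_schwarz _ _)); rewrite ler_wpM2r ?nrm_ge0.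
by rewrite TS ipxx nrm_real ger0_norm ?sqr_ge0 // expr2 mulrCA mulrA.
Qed.

Lemma op_adjoint_exists T : exists S : op, forall x y, ip (T x) y = ip x (S y).
Proof.
have [M M0 HM] := op_bounded T.
have /choice[S TS] : forall y, exists z, forall x, ip (T x) y = ip x z.
  move=> y; apply: (@riesz_representation _ _ (fun x => ip (T x) y)); split.
    by move=> a u v; rewrite opD opZ ipDl ipZl.
  exists (M * nrm y) => [|x]; first by rewrite mulr_ge0 ?nrm_ge0.
  apply: (le_trans (cauchy_schwarz _ _)).
  by rewrite mulrAC ler_wpM2r ?nrm_ge0.
have ip_inj y z : (forall x, ip x y = ip x z) -> y = z.
  move=> yz; apply/eqP; rewrite -subr_eq0; apply/eqP/ip_ge0_eq.
  by rewrite [LHS]ipBr yz subrr.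
have S_bd : lin_bounded S.
  split=> [a u v|].
    by apply: ip_inj => x; rewrite -TS ipDr ipZr !TS ipDr ipZr.
  by exists M => //; apply: adjoint_bound M0 HM => x y; exact: TS.
by exists (Op S_bd).
Qed.

Definition adj T : op := projT1 (cid (op_adjoint_exists T)).

Lemma adjP T x y : ip (T x) y = ip x (adj T y).
Proof. by rewrite /adj; case: cid => S /= ->. Qed.

Lemma adjPr T x y : ip x (T y) = ip (adj T x) y.
Proof. by rewrite ipC adjP -ipC. Qed.

Lemma adj_bound T M : 0 <= M -> (forall x, nrm (T x) <= M * nrm x) ->
  forall x, nrm (adj T x) <= M * nrm x.
Proof.
by apply: adjoint_bound => x y; exact: adjP.
Qed.

(** [op_adjoint] chooses by [xget]; as [adj T] is an adjoint the choice does not default, and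
    adjoints are unique. *)
Lemma op_adjointE T : op_adjoint T = adj T :> (H -> H).
Proof.
rewrite /op_adjoint; case: xgetP => [S _ TS|/(_ (adj T)) []]; last by move=> x y; exact: adjP.
apply/funext => y; apply/eqP; rewrite -subr_eq0; apply/eqP/ip_ge0_eq.
have TS' u v : ip u (S v) = ip (T u) v by rewrite /ip TS.
by rewrite ipBr -adjP TS' subrr.
Qed.

Lemma bounded_opP (T : H -> H) : bounded_op T -> lin_bounded T.
Proof.
move=> [lin cT]; split=> //.
have TD x y : T (x + y) = T x + T y by rewrite -{1}[x]scale1r lin scale1r.
have T0 : T 0 = 0 by apply: (addrI (T 0)); rewrite -TD !addr0.
have TZ a x : T (a *: x) = a *: T x by rewrite -{1}[a *: x]addr0 lin T0 addr0.
have /cvgrPdist_le/(_ 1 ltr01) /nbhs_ballP[d /= d0 Hd] := cT 0.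
have dE : d = (complex.Re d)%:C by rewrite RRe_real // gtr0_real.
have d1 : 0 < complex.Re d by rewrite -ltcR -dE.
exists (2 / complex.Re d) => [|x]; first by rewrite divr_ge0 ?ltW.
have [->|x0] := eqVneq x 0; first by rewrite T0 nrm0 mulr0.
have nx : 0 < nrm x.
  by rewrite lt_neqAle nrm_ge0 andbT eq_sym; apply: contra_neq x0; exact: nrm_eq0.
pose c := complex.Re d / 2 / nrm x; have c0 : 0 < c by rewrite !divr_gt0.
have /Hd : ball 0 d (c%:C *: x).
  rewrite -ball_normE /= sub0r normrN nrmE nrmZ nrm_real gtr0_norm // dE ltcR.
  rewrite /c divfK ?gt_eqF // ltr_pdivrMr // mulr_natr mulr2n ltrDl //.
rewrite /= T0 sub0r normrN TZ nrmE nrmZ nrm_real gtr0_norm // lecR => Hc.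
rewrite -(ler_pM2l c0); apply: (le_trans Hc).
have -> : c * (2 / complex.Re d * nrm x) = 1 by rewrite /c; field; rewrite !gt_eqF.
exact: lexx.
Qed.

End OperatorRing.
Arguments op {R} H.

(** * Expansion along an orthonormal basis *)

Section Parseval.
Context {R : realType} {H : hilbertType R}.
Local Notation C := R[i].
Implicit Types (x y z : H) (s w : seq H).

Lemma nrm_ip_eq0 x y z : ip x y = 0 -> x + y = z -> nrm z ^+ 2 = nrm x ^+ 2 + nrm y ^+ 2.
Proof.
move=> xy <-; apply: complexI; rewrite rmorphD /= -!ipxx !ipDl !ipDr.
by rewrite xy [ip y x]ipC xy rmorph0 addr0 add0r.
Qed.

Lemma proj_subset s w x : ortho s -> ortho w -> {subset s <= w} ->
  nrm (x - proj s x) ^+ 2 = nrm (x - proj w x) ^+ 2 + nrm (proj w x - proj s x) ^+ 2.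
Proof.
move=> os ow sw; apply: nrm_ip_eq0; last by rewrite addrA subrK.
rewrite ipBr ip_sub_proj_proj // sub0r ip_sumr big_seq big1 ?oppr0 // => e /sw ew.
by rewrite ipZr ip_sub_proj // mulr0.
Qed.

Variable E : set H.
Hypothesis Eonb : is_onb E.

Definition finite_in s := uniq s /\ forall e, e \in s -> E e.

Lemma finite_in_cons e s : E e -> e \notin s -> finite_in s -> finite_in (e :: s).
Proof.
by move=> Ee es [us sE]; split=> [|d]; [rewrite /= es | rewrite inE => /orP[/eqP->|/sE]].
Qed.

Lemma finite_in_ortho s : finite_in s -> ortho s.
Proof.
have [E1 Eo _] := Eonb; elim: s => [|e s IHs] [] //= /andP[es us] sE.
have Ee : E e by apply: sE; rewrite inE eqxx.
have sE' d : d \in s -> E d by move=> ds; apply: sE; rewrite inE ds orbT.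
rewrite ortho_cons IHs // andbT; apply/andP; split; last by rewrite [ip e e]E1 // eqxx orbT.
apply/allP => d ds; apply/eqP/Eo => //; first exact: sE'.
by move=> ed; rewrite ed ds in es.
Qed.

Definition fin_union s w := undup (s ++ w).

Lemma finite_in_union s w : finite_in s -> finite_in w -> finite_in (fin_union s w).
Proof.
move=> [_ sE] [_ wE]; split; first exact: undup_uniq.
by move=> e; rewrite mem_undup mem_cat => /orP[/sE|/wE].
Qed.

Lemma sub_fin_unionl s w : {subset s <= fin_union s w}.
Proof. by move=> e es; rewrite mem_undup mem_cat es. Qed.

Lemma sub_fin_unionr s w : {subset w <= fin_union s w}.
Proof. by move=> e es; rewrite mem_undup mem_cat es orbT. Qed.

(** Projections onto finite parts of [E] that nearly minimise the distance to [x] form a Cauchy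
    sequence. Its limit [y] has [x - y] orthogonal to [E], whence [x = y] by maximality of [E]. *)
Lemma parseval x (eps : R) : 0 < eps -> exists2 s0, finite_in s0 &
  forall s, finite_in s -> {subset s0 <= s} -> nrm (x - proj s x) <= eps.
Proof.
move=> eps0; suff [s0 f0 s0x] : exists2 s0, finite_in s0 & nrm (x - proj s0 x) <= eps.
  exists s0 => // s fs s0s; apply: le_trans s0x.
  rewrite -ler_sqr ?nnegrE ?nrm_ge0 // [leRHS](@proj_subset s0 s) ?lerDl ?sqr_ge0 //;
    exact: finite_in_ortho.
pose D := [set nrm (x - proj s x) ^+ 2 | s in finite_in].
have D_inf : has_inf D.
  split; first by exists (nrm (x - proj [::] x) ^+ 2), [::].
  by exists 0 => _ [s _ <-]; exact: sqr_ge0.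
have [r r0 r_small] := @small_sequence R.
have /choice[s_ Hs] : forall n, exists s, finite_in s /\ nrm (x - proj s x) ^+ 2 < inf D + r n ^+ 2.
  move=> n; have rn : 0 < r n ^+ 2 by rewrite exprn_gt0.
  by have [_ [s fs <-] Hs] := inf_adherent rn D_inf; exists s.
have fs n : finite_in (s_ n) by have [] := Hs n.
have os n : ortho (s_ n) by apply: finite_in_ortho.
(* Enlarging a nearly optimal family can gain little, so by Pythagoras it hardly moves the
   projection. *)
have close n w : finite_in w -> {subset s_ n <= w} ->
    nrm (proj w x - proj (s_ n) x) <= r n.
  move=> fw sw; rewrite -ler_sqr ?nnegrE ?nrm_ge0 ?(ltW (r0 _)) //.
  have ow := finite_in_ortho fw.
  have : inf D <= nrm (x - proj w x) ^+ 2.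
    by apply: ge_inf; [exact: D_inf.2 | exists w].
  by have [_] := Hs n; rewrite (@proj_subset (s_ n) w) //; lra.
have [y yx] : exists y, tends (fun n => proj (s_ n) x) y.
  apply: nrm_complete => e e0; have e2 : 0 < e / 2 by rewrite divr_gt0.
  have [N HN] := r_small _ e2; exists N => n m Nn Nm.
  have fw := finite_in_union (fs n) (fs m).
  apply: (le_trans (nrm_triangle (proj (fin_union (s_ n) (s_ m)) x) _ _)).
  rewrite (splitr e); apply: lerD; first rewrite nrmB.
    by apply: le_trans (HN n Nn); apply: close => //; exact: sub_fin_unionl.
  by apply: le_trans (HN m Nm); apply: close => //; exact: sub_fin_unionr.
have yE e : E e -> ip (x - y) e = 0.
  move=> Ee; have ne : nrm e = 1.
    have [E1 _ _] := Eonb; have := E1 e Ee; rewrite -/(ip e e) ipxx => -[] /eqP.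
    by rewrite sqrp_eq1 ?nrm_ge0 // => /eqP.
  apply: eq_nrm0 => d d0; have d2 : 0 < d / 2 by rewrite divr_gt0.
  have [N1 HN1] := r_small _ d2; have [N2 HN2] := yx _ d2; pose n := maxn N1 N2.
  have -> : ip (x - y) e = ip (x - proj (s_ n) x) e + ip (proj (s_ n) x - y) e.
    by rewrite -ipDl addrA subrK.
  apply: (le_trans (nrmD _ _)); rewrite (splitr d); apply: lerD; last first.
    apply: (le_trans (cauchy_schwarz _ _)); rewrite ne mulr1.
    exact: (HN2 n (leq_maxr _ _)).
  apply: le_trans (HN1 n (leq_maxl _ _)).
  (* If [e] is not in [s_ n], adding it moves the projection by [ip x e *: e], which [close]
     bounds. *)
  have [es|es] := boolP (e \in s_ n); first by rewrite ip_sub_proj // nrm0 ltW.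
  have := close n (e :: s_ n) (finite_in_cons Ee es (fs n)).
  rewrite {1}/proj big_cons -/(proj _ _) addrK nrmZ ne mulr1 ipBl ip_projl.
  rewrite [\sum_(d <- _) _]big_seq big1 ?subr0.
    by apply=> c cs; rewrite inE cs orbT.
  move=> f fsn; have [_ Eo _] := Eonb.
  rewrite [ip f e]Eo ?mulr0 //; first exact: (fs n).2.
  by move=> fe; rewrite -fe fsn in es.
have xy : x = y.
  by apply/eqP; rewrite -subr_eq0; apply/eqP; have [_ _ Ec] := Eonb; exact: Ec.
have [N HN] := yx _ eps0; exists (s_ N); first exact: fs.
by rewrite nrmB {2}xy; exact: HN.
Qed.

Lemma parseval_ip u v (eps : R) : 0 < eps -> exists2 s0, finite_in s0 &
  forall s, finite_in s -> {subset s0 <= s} ->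
    nrm (ip u v - \sum_(e <- s) ip u e * ip e v) <= eps.
Proof.
move=> eps0; have v1 : 0 < nrm v + 1 by rewrite ltr_wpDl ?nrm_ge0.
have [|s0 f0 H0] := @parseval u (eps / (nrm v + 1)); first by rewrite divr_gt0.
exists s0 => // s fs s0s; rewrite -ip_projl -ipBl.
apply: (le_trans (cauchy_schwarz _ _)); have := H0 s fs s0s; rewrite ler_pdivlMr //.
by apply: le_trans; rewrite ler_wpM2l ?nrm_ge0 // lerDl.
Qed.

Lemma parseval_nrm x (eps : R) : 0 < eps -> exists2 s0, finite_in s0 &
  forall s, finite_in s -> {subset s0 <= s} ->
    nrm x ^+ 2 <= \sum_(e <- s) nrm (ip x e) ^+ 2 + eps.
Proof.
move=> eps0; have [s0 f0 H0] := parseval_ip x x eps0; exists s0 => // s fs s0s.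
have := H0 s fs s0s; rewrite -ip_projl ip_projx ipxx -rmorphB nrm_real => Hs.
by have := ler_norm (nrm x ^+ 2 - \sum_(e <- s) nrm (ip x e) ^+ 2); lra.
Qed.

End Parseval.

(** * Schatten ideals and the trace *)

Section FiniteRank.
Context {R : realType} {H : hilbertType R}.
Local Notation C := R[i].
Implicit Types (S T D : op H) (x y : H) (s : seq H) (l k : seq (H * H)).

Definition opbd T (t : R) := forall x, nrm (T x) <= t * nrm x.

Lemma opbd_exists T : exists2 t, 0 <= t & opbd T t.
Proof. exact: op_bounded. Qed.

Lemma opbd_le T a b : a <= b -> opbd T a -> opbd T b.
Proof. by move=> ab Ta x; apply: (le_trans (Ta x)); rewrite ler_wpM2r ?nrm_ge0. Qed.

Lemma opbdD S T a b : opbd S a -> opbd T b -> opbd (S + T) (a + b).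
Proof. by move=> Sa Tb x; apply: (le_trans (nrmD _ _)); rewrite mulrDl lerD. Qed.

Lemma opbdN T a : opbd T a -> opbd (- T) a.
Proof. by move=> Ta x; rewrite nrmN. Qed.

Lemma opbdM S T a b : 0 <= a -> opbd S a -> opbd T b -> opbd (S * T) (a * b).
Proof.
move=> a0 Sa Tb x; apply: (le_trans (Sa _)); rewrite -mulrA ler_wpM2l //; exact: Tb.
Qed.

(** A list of pairs presents a finite-rank operator. The presentation is kept because its length
    bounds the rank and its trace [ftr] is a finite sum, with no basis involved. *)
Definition frk_fun l x : H := \sum_(uv <- l) ip x uv.2 *: uv.1.

Fact frk_subproof l : lin_bounded (frk_fun l).
Proof.
split=> [a x y|].
  rewrite /frk_fun scaler_sumr -big_split; apply: eq_bigr => uv _ /=.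
  by rewrite ipDl ipZl scalerDl scalerA.
exists (\sum_(uv <- l) nrm uv.1 * nrm uv.2) => [|x].
  by apply: sumr_ge0 => uv _; rewrite mulr_ge0 ?nrm_ge0.
apply: (le_trans (nrm_sum _ _ _)); rewrite mulr_suml; apply: ler_sum => uv _.
rewrite nrmZ mulrC -mulrA ler_wpM2l ?nrm_ge0 // mulrC.
exact: cauchy_schwarz.
Qed.

Definition frk l : op H := Op (frk_subproof l).

Definition ftr l : C := \sum_(uv <- l) ip uv.1 uv.2.

Definition lmap T l : seq (H * H) := [seq (T uv.1, uv.2) | uv <- l].
Definition rmap T l : seq (H * H) := [seq (uv.1, adj T uv.2) | uv <- l].

Lemma frk_lmap T l : frk (lmap T l) = T * frk l.
Proof.
apply: op_ext => x; rewrite /= /frk_fun big_map op_sum.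
by apply: eq_bigr => uv _; rewrite opZ.
Qed.

Lemma frk_rmap T l : frk (rmap T l) = frk l * T.
Proof.
apply: op_ext => x; rewrite /= /frk_fun big_map.
by apply: eq_bigr => uv _; rewrite adjP.
Qed.

Lemma frk_cat l k : frk (l ++ k) = frk l + frk k.
Proof. by apply: op_ext => x; rewrite /= /frk_fun big_cat. Qed.

Lemma frk0 : frk [::] = 0.
Proof. by apply: op_ext => x; rewrite /= /frk_fun big_nil. Qed.

Lemma ftr_lrmap T l : ftr (lmap T l) = ftr (rmap T l).
Proof. by rewrite /ftr !big_map; apply: eq_bigr => uv _; exact: adjP. Qed.

Lemma ftr_cat l k : ftr (l ++ k) = ftr l + ftr k.
Proof. exact: big_cat. Qed.

Definition partial_trace s T : C := \sum_(e <- s) ip (T e) e.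

Lemma partial_traceB s S T : partial_trace s (S - T) = partial_trace s S - partial_trace s T.
Proof. by rewrite -sumrB; apply: eq_bigr => e _; rewrite -ipBl. Qed.

Lemma nrm_ortho s e : ortho s -> e \in s -> nrm e <= 1.
Proof.
move=> /andP[_ /allP e1] /e1 /orP[/eqP->|]; first by rewrite nrm0.
by rewrite ipxx => /eqP[/eqP]; rewrite sqrp_eq1 ?nrm_ge0 // => /eqP->.
Qed.

Lemma partial_trace_le s T t : ortho s -> 0 <= t -> opbd T t ->
  nrm (partial_trace s T) <= (size s)%:R * t.
Proof.
move=> os t0 Tt; apply: (le_trans (nrm_sum _ _ _)).
rewrite -[X in X%:R]count_predT -sum1_count natr_sum mulr_suml.
rewrite big_seq [leRHS]big_seq; apply: ler_sum => e es; rewrite mul1r.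
apply: (le_trans (cauchy_schwarz _ _)); have ne := nrm_ortho os es.
apply: (@le_trans _ _ (t * nrm e * 1)); first by rewrite ler_pM ?nrm_ge0.
by rewrite mulr1 ler_piMr.
Qed.

(** The length of [s] must not enter the bound. Gram-Schmidt on the range gives a list [fs] as long
    as [l], and exchanging sums leaves one term of norm at most [t] for each vector of [fs]. *)
Lemma partial_trace_rank s l t : ortho s -> 0 <= t -> opbd (frk l) t ->
  nrm (partial_trace s (frk l)) <= (size l)%:R * t.
Proof.
move=> os t0 lt; have [fs [ofs sfs fsl]] := gram_schmidt [seq uv.1 | uv <- l].
have frkE x : proj fs (frk l x) = frk l x.
  have projD : {morph proj fs : a b / a + b}.
    by move=> a b; rewrite /proj -big_split; apply: eq_bigr => e _; rewrite /= ipDl scalerDl.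
  rewrite /= /frk_fun (big_morph (proj fs) projD (id1 := 0)); last first.
    by rewrite /proj big1 // => e _; rewrite ip0l scale0r.
  rewrite big_seq [RHS]big_seq; apply: eq_bigr => uv uvl.
  rewrite -[in RHS](fsl uv.1) ?map_f // /proj scaler_sumr.
  by apply: eq_bigr => e _; rewrite ipZl scalerA.
have -> : partial_trace s (frk l) = \sum_(f <- fs) ip (proj s f) (adj (frk l) f).
  rewrite /partial_trace; under eq_bigr => e _ do rewrite -frkE ip_projl.
  rewrite exchange_big; apply: eq_bigr => f _; rewrite ip_projl; apply: eq_bigr => e _.
  by rewrite adjP mulrC.
apply: (le_trans (nrm_sum _ _ _)).
rewrite -(size_map (fun uv => uv.1)) -sfs -[X in X%:R]count_predT -sum1_count natr_sum mulr_suml.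
rewrite big_seq [leRHS]big_seq; apply: ler_sum => f ffs; rewrite mul1r.
have nf := nrm_ortho ofs ffs.
apply: (le_trans (cauchy_schwarz _ _)).
have nfs : nrm (proj s f) <= 1 by apply: le_trans nf; exact: nrm_proj.
have naf : nrm (adj (frk l) f) <= t.
  by apply: (le_trans (adj_bound t0 lt f)); rewrite ler_piMr.
by rewrite -[t]mul1r ler_pM ?nrm_ge0.
Qed.

End FiniteRank.

Section BoundedSums.
Context {R : realType}.
Implicit Types (a b : nat -> R).

Definition sumbd a := exists S : R, forall n, \sum_(0 <= i < n) a i <= S.

Lemma sumbd_le a b : (forall i, a i <= b i) -> sumbd b -> sumbd a.
Proof. by move=> ab [S HS]; exists S => n; apply: le_trans (HS n); exact: ler_sum. Qed.

Lemma sumbdD a b : sumbd a -> sumbd b -> sumbd (fun i => a i + b i).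
Proof.
by move=> [S HS] [T HT]; exists (S + T) => n; rewrite big_split lerD.
Qed.

Lemma sumbdZ (k : R) a : 0 <= k -> sumbd a -> sumbd (fun i => k * a i).
Proof.
by move=> k0 [S HS]; exists (k * S) => n; rewrite -mulr_sumr ler_wpM2l.
Qed.

Lemma sumbd_tail a : (forall i, 0 <= a i) -> sumbd a -> forall eps : R, 0 < eps ->
  exists N, forall n m, (N <= n)%N -> (n <= m)%N -> \sum_(n <= i < m) a i <= eps.
Proof.
move=> a0 [S HS] eps eps0; pose A := range (fun n => \sum_(0 <= i < n) a i).
have supA : has_sup A by split; [exists (\sum_(0 <= i < 0) a i), 0%N | exists S => _ [n _ <-]].
have [_ [N _ <-] HN] := sup_adherent eps0 supA.
have mono n m : (n <= m)%N -> \sum_(0 <= i < n) a i <= \sum_(0 <= i < m) a i.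
  move=> nm; rewrite (@big_cat_nat _ _ _ n 0 m) //= lerDl.
  by apply: sumr_ge0 => i _.
exists N => n m Nn nm; have : \sum_(0 <= i < m) a i <= sup A.
  by apply: sup_upper_bound => //; exists m.
rewrite (@big_cat_nat _ _ _ n 0 m) //=; have := mono _ _ Nn; lra.
Qed.

Lemma sumbd_small a : (forall i, 0 <= a i) -> sumbd a -> forall eps : R, 0 < eps ->
  exists N, forall n, (N <= n)%N -> a n <= eps.
Proof.
move=> a0 aS eps eps0; have [N HN] := sumbd_tail a0 aS eps0.
by exists N => n Nn; have := HN n n.+1 Nn (leqnSn n); rewrite big_nat1.
Qed.

Lemma real_complete (u : nat -> R) :
  (forall eps : R, 0 < eps -> exists N, forall n m, (N <= n)%N -> (N <= m)%N ->
     `|u n - u m| <= eps) ->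
  exists l, forall eps : R, 0 < eps -> exists N, forall n, (N <= n)%N -> `|u n - l| <= eps.
Proof.
move=> uC; suff: cvg (u @ \oo).
  move=> ul; exists (lim (u @ \oo)) => e e0; move/cvgrPdist_le: ul => /(_ e e0)[N _ HN].
  by exists N => n Nn; rewrite distrC; exact: HN.
apply: cauchy_cvg; apply/cauchyP => e e0.
have [|N HN] := uC (e / 2); first by rewrite divr_gt0.
exists (u N); exists N => // n /= Nn; rewrite -ball_normE /=.
by apply: (le_lt_trans (HN _ _ _ Nn)); rewrite // ltr_pdivrMr // mulr_natr mulr2n ltrDl.
Qed.

Lemma Im_le_nrm (z : R[i]) : `|complex.Im z| <= nrm z.
Proof.
have := Re_le_nrm (z * 'i); rewrite nrmM ReiNIm normrN.
by rewrite [nrm 'i](_ : _ = 1) ?mulr1 // /nrm normc_def /= expr0n add0r expr1n sqrtr1.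
Qed.

Lemma nrm_le_ReIm (z : R[i]) : nrm z <= `|complex.Re z| + `|complex.Im z|.
Proof.
have zE : z = (complex.Re z)%:C + (complex.Im z)%:C * 'i by case: z => a b; simpc.
rewrite {1}zE; apply: (le_trans (nrmD _ _)); rewrite nrmM !nrm_real.
by rewrite [nrm 'i](_ : _ = 1) ?mulr1 // /nrm normc_def /= expr0n add0r expr1n sqrtr1.
Qed.

Lemma complex_complete (u : nat -> R[i]) :
  (forall eps : R, 0 < eps -> exists N, forall n m, (N <= n)%N -> (N <= m)%N ->
     nrm (u n - u m) <= eps) -> exists l, tends u l.
Proof.
move=> uC.
have ReB (a b : R[i]) : complex.Re a - complex.Re b = complex.Re (a - b) by case: a b => [? ?] [].
have ImB (a b : R[i]) : complex.Im a - complex.Im b = complex.Im (a - b) by case: a b => [? ?] [].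
have [|a Ha] := @real_complete (fun n => complex.Re (u n)).
  move=> e /uC[N HN]; exists N => n m Nn Nm; rewrite ReB.
  by apply: (le_trans (Re_le_nrm _)); exact: HN.
have [|b Hb] := @real_complete (fun n => complex.Im (u n)).
  move=> e /uC[N HN]; exists N => n m Nn Nm; rewrite ImB.
  by apply: (le_trans (Im_le_nrm _)); exact: HN.
exists (a +i* b) => e e0; have e2 : 0 < e / 2 by rewrite divr_gt0.
have [N1 H1] := Ha _ e2; have [N2 H2] := Hb _ e2.
exists (maxn N1 N2) => n; rewrite geq_max => /andP[n1 n2].
apply: (le_trans (nrm_le_ReIm _)); rewrite -ReB -ImB (splitr e).
by apply: lerD; [exact: H1 | exact: H2].
Qed.

End BoundedSums.

(** * The trace as a limit of traces of finite-rank approximants *)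

Section TraceClass.
Context {R : realType} {H : hilbertType R}.
Local Notation C := R[i].
Implicit Types (S T D : op H) (x y : H) (s : seq H).

(** Cauchy condensation of the trace-class condition: up to constants, the summability of
    [2 ^+ i * tau i] is that of the singular values. *)
Record approximants (c : nat) (tau : nat -> R) (l : nat -> seq (H * H)) T := Approximants {
  appr_size : forall i, (size (l i) <= c * 2 ^ i)%N;
  appr_ge0 : forall i, 0 <= tau i;
  appr_bd : forall i, opbd (T - frk (l i)) (tau i);
  appr_sum : sumbd (fun i => 2 ^+ i * tau i)
}.

Section Trace.
Variables (c : nat) (tau : nat -> R) (l : nat -> seq (H * H)) (T : op H).
Hypothesis Tl : approximants c tau l T.

Let sg i := 2 ^+ i * tau i.
Let sg0 i : 0 <= sg i. Proof. by rewrite mulr_ge0 ?exprn_ge0 ?(appr_ge0 Tl). Qed.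

Lemma partial_trace_chunk s i : ortho s ->
  nrm (partial_trace s (frk (l i.+1)) - partial_trace s (frk (l i))) <=
  (3 * c)%:R * (sg i + sg i.+1).
Proof.
move=> os; rewrite -partial_traceB.
have E : frk (l i.+1) - frk (l i) = frk (l i.+1 ++ lmap (- 1) (l i)).
  by rewrite frk_cat frk_lmap mulN1r.
have t0 : 0 <= tau i + tau i.+1 by rewrite addr_ge0 ?(appr_ge0 Tl).
have bd : opbd (frk (l i.+1) - frk (l i)) (tau i + tau i.+1).
  have -> : frk (l i.+1) - frk (l i) = (T - frk (l i)) - (T - frk (l i.+1)).
    by rewrite opprB [RHS]addrC addrA subrK.
  by apply: opbdD; [|apply: opbdN]; exact: (appr_bd Tl).
rewrite E in bd *; apply: (le_trans (partial_trace_rank os t0 bd)).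
(* Two consecutive approximants differ by rank at most [c * 2 ^ i + c * 2 ^ i.+1], hence [3 * c]. *)
have -> : (3 * c)%:R * (sg i + sg i.+1) =
    (3 * c * 2 ^ i)%:R * (tau i + 2 * tau i.+1) :> R.
  by rewrite /sg exprS !natrM natrX; ring.
apply: ler_pM => //; last by rewrite lerD2l ler_peMl ?(appr_ge0 Tl) // ler1n.
rewrite ler_nat size_cat size_map.
by have := appr_size Tl i; have := appr_size Tl i.+1; rewrite expnS; lia.
Qed.

Lemma partial_trace_telescope s n m : ortho s -> (n <= m)%N ->
  nrm (partial_trace s (frk (l m)) - partial_trace s (frk (l n))) <=
  \sum_(n <= i < m) (3 * c)%:R * (sg i + sg i.+1).
Proof.
move=> os; elim: m => [|m IHm] nm.
  by have -> : n = 0%N by [lia]; rewrite subrr nrm0 big_geq.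
have [->|nm'] := eqVneq n m.+1; first by rewrite subrr nrm0 big_geq.
rewrite big_nat_recr /=; last by lia.
apply: (le_trans (nrm_triangle (partial_trace s (frk (l m))) _ _)); rewrite [leLHS]addrC.
by apply: lerD; [apply: IHm; lia | exact: partial_trace_chunk].
Qed.

(** [N] serves all [s] at once, which is what permits exchanging the limit in [n] with the one over
    finite parts of the basis. *)
Lemma partial_trace_uniform (eps : R) : 0 < eps -> exists N, forall n s,
  (N <= n)%N -> ortho s -> nrm (partial_trace s T - partial_trace s (frk (l n))) <= eps.
Proof.
move=> eps0; have e2 : 0 < eps / 2 by rewrite divr_gt0.
have aS : sumbd (fun i => (3 * c)%:R * (sg i + sg i.+1)).
  apply: sumbdZ => //; apply: sumbdD; first exact: (appr_sum Tl).
  have [S HS] := appr_sum Tl; exists S => n; apply: le_trans (HS n.+1).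
  by rewrite big_nat_recl //=; apply: ler_wpDl; first exact: (sg0 0%N).
have [|N HN] := sumbd_tail _ aS e2; first by move=> i; rewrite mulr_ge0 ?addr_ge0.
exists N => n s Nn os; have s1 : 0 < (size s)%:R + 1 :> R by rewrite ltr_wpDl.
(* Here the index may depend on [s]: the crude bound [size s * tau m] is enough at a late [m], and
   telescoping returns from [m] to [n]. *)
have [|M HM] := sumbd_small sg0 (appr_sum Tl) (eps := eps / 2 / ((size s)%:R + 1)).
  by rewrite divr_gt0.
pose m := maxn n M.
apply: (le_trans (nrm_triangle (partial_trace s (frk (l m))) _ _)).
rewrite (splitr eps); apply: lerD; last first.
  apply: le_trans (HN n m Nn (leq_maxl _ _)).
  exact: (partial_trace_telescope os (leq_maxl _ _)).
rewrite -partial_traceB.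
apply: (le_trans (partial_trace_le os (appr_ge0 Tl m) (appr_bd Tl m))).
have : sg m <= eps / 2 / ((size s)%:R + 1) by apply: HM; exact: leq_maxr.
rewrite ler_pdivlMr // => Hm; apply: le_trans Hm.
rewrite mulrC; apply: ler_pM => //; first exact: (appr_ge0 Tl).
  by rewrite /sg ler_peMl ?(appr_ge0 Tl) // exprn_ege1 // ler1n.
by rewrite lerDl.
Qed.

Hypothesis onbP : is_onb (@onb R H).

Lemma ftr_parseval (k : seq (H * H)) (eps : R) : 0 < eps ->
  exists2 s0, finite_in (@onb R H) s0 &
    forall s, finite_in (@onb R H) s -> {subset s0 <= s} ->
      nrm (ftr k - partial_trace s (frk k)) <= eps.
Proof.
elim: k eps => [|[u v] k IHk] eps eps0.
  exists [::]; first by split.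
  move=> s _ _; rewrite /ftr big_nil frk0 /partial_trace big1 ?subr0 ?nrm0 ?ltW //.
  by move=> e _; rewrite /= ip0l.
have e2 : 0 < eps / 2 by rewrite divr_gt0.
have [s1 f1 H1] := IHk _ e2; have [s2 f2 H2] := parseval_ip onbP u v e2.
exists (fin_union s1 s2); first exact: finite_in_union.
move=> s fs ss; rewrite /ftr big_cons -/(ftr k) /=.
have -> : partial_trace s (frk ((u, v) :: k)) =
    (\sum_(e <- s) ip u e * ip e v) + partial_trace s (frk k).
  rewrite /partial_trace -big_split; apply: eq_bigr => e _ /=.
  by rewrite /frk_fun big_cons ipDl ipZl /= mulrC.
rewrite opprD addrACA (splitr eps); apply: (le_trans (nrmD _ _)); apply: lerD.
  by apply: H2 => // e es; apply: ss; exact: sub_fin_unionr.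
by apply: H1 => // e es; apply: ss; exact: sub_fin_unionl.
Qed.

(** [ftr (l n)] is close to all partial traces of [T] along large finite parts of the basis. So the
    sequence is Cauchy, and the net of partial sums shares its limit. *)
Lemma op_trace_tends : tends (fun n => ftr (l n)) (op_trace T).
Proof.
have ftr_close (eps : R) : 0 < eps -> exists N, forall n, (N <= n)%N ->
    exists2 s0, finite_in (@onb R H) s0 &
    forall s, finite_in (@onb R H) s -> {subset s0 <= s} ->
      nrm (ftr (l n) - partial_trace s T) <= eps.
  move=> e0; have e2 : 0 < eps / 2 by rewrite divr_gt0.
  have [N HN] := partial_trace_uniform e2; exists N => n Nn.
  have [s0 f0 H0] := ftr_parseval (l n) e2; exists s0 => // s fs ss.
  apply: (le_trans (nrm_triangle (partial_trace s (frk (l n))) _ _)).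
  rewrite (splitr eps); apply: lerD; first exact: H0.
  by rewrite nrmB; apply: HN => //; exact: finite_in_ortho fs.
have [L HL] : exists L, tends (fun n => ftr (l n)) L.
  apply: complex_complete => e e0; have e2 : 0 < e / 2 by rewrite divr_gt0.
  have [N HN] := ftr_close _ e2; exists N => n m Nn Nm.
  have [s1 f1 H1] := HN n Nn; have [s2 f2 H2] := HN m Nm.
  have fs := finite_in_union f1 f2; pose s := fin_union s1 s2.
  apply: (le_trans (nrm_triangle (partial_trace s T) _ _)).
  rewrite (splitr e); apply: lerD; first by apply: H1 => //; exact: sub_fin_unionl.
  by rewrite nrmB; apply: H2 => //; exact: sub_fin_unionr.
suff -> : op_trace T = L by [].
have totallyP := @totally_filter H.
apply: (@cvg_lim C^o (@norm_hausdorff _ _) _ _ totallyP).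
apply/cvgrPdist_le => e e0.
have eE : e = (complex.Re e)%:C by rewrite RRe_real // gtr0_real.
have e2 : 0 < complex.Re e / 2 by rewrite divr_gt0 // -ltcR -eE.
have [N1 H1] := ftr_close _ e2; have [N2 H2] := HL _ e2; pose n := maxn N1 N2.
have [s0 f0 H0] := H1 n (leq_maxl _ _).
exists (finmap.seq_fset tt s0) => // B BA; have sB := elimT (@finmap.fsubsetP H _ _) BA.
rewrite /=.
(* The net runs over finite subsets of all of [H]; outside [onb] the summand is 0. *)
pose s := [seq e <- finmap.enum_fset B | e \in @onb R H].
have fs : finite_in (@onb R H) s.
  split; first by rewrite filter_uniq ?finmap.fset_uniq.
  by move=> f; rewrite mem_filter => /andP[/set_mem].
have -> : partial_sum ((fun e : H => hdot (T e) e : C^o) \_ onb) B = partial_trace s T.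
  rewrite /partial_sum -(finmap.big_seq_fsetE _ _ xpredT) /= /partial_trace big_filter [RHS]big_mkcond /=.
  by apply: eq_bigr => f _; rewrite /patch.
rewrite eE nrmE lecR.
apply: (le_trans (nrm_triangle (ftr (l n)) _ _)); rewrite (splitr (complex.Re e)).
apply: lerD; first by rewrite nrmB; apply: H2; exact: leq_maxr.
apply: H0 => // f fs0; rewrite mem_filter; apply/andP; split.
  by apply/mem_set; exact: f0.2.
by apply: sB; rewrite finmap.seq_fsetE.
Qed.

End Trace.
End TraceClass.

(** * Schatten ideals form a filtration on which the trace is cyclic *)

Section SchattenClasses.
Context {R : realType} {H : hilbertType R} (q : nat).
Local Notation C := R[i].
Local Notation p := q.+1.
Implicit Types (S T x y : op H) (lx ly : seq (H * H)).

(* The Schatten ideal of exponent [2 p / k], through dyadic approximation by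
   finite-rank operators; the weights [2 ^ j] make the numbers [t j] behave as
   the [2 ^ j]-th terms of a decreasing sequence in [l^(2 p)]. *)
Definition schatten_ideal (k : nat) T := exists c (M : R) (t : nat -> R) l,
  [/\ 0 <= M, forall j, 0 <= t j, sumbd (fun j => 2 ^+ j * t j ^+ p.*2),
      forall j, (size (l j) <= c * 2 ^ j)%N
    & forall j, opbd (T - frk (l j)) (M * t j ^+ k)].

(** Sums and products of two operators need one weight sequence for both. *)
Lemma sumbd_max (t t' : nat -> R) n : (forall j, 0 <= t j) -> (forall j, 0 <= t' j) ->
  sumbd (fun j => 2 ^+ j * t j ^+ n) -> sumbd (fun j => 2 ^+ j * t' j ^+ n) ->
  sumbd (fun j => 2 ^+ j * Num.max (t j) (t' j) ^+ n).
Proof.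
move=> t0 t'0 tS t'S; apply: sumbd_le (sumbdD tS t'S) => j.
rewrite -mulrDr ler_wpM2l ?exprn_ge0 //.
by rewrite maxEle; case: ifP => _; rewrite ?lerDl ?lerDr exprn_ge0.
Qed.

Lemma schatten_ideal_all T : schatten_ideal 0 T.
Proof.
have [M M0 TM] := opbd_exists T.
(* With [t = 0] and [k = 0] the error bound is [M], because [0 ^+ 0 = 1]. *)
exists 0%N, M, (fun=> 0), (fun=> [::]); split=> //.
  by exists 0 => n; rewrite big1 // => j _; rewrite expr0n mulr0.
by move=> j; rewrite frk0 subr0 expr0 mulr1.
Qed.

Lemma schatten_ideal0 k : schatten_ideal k 0.
Proof.
exists 0%N, 0, (fun=> 0), (fun=> [::]); split=> //.
  by exists 0 => n; rewrite big1 // => j _; rewrite expr0n mulr0.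
by move=> j x; rewrite frk0 subr0 mul0r /= nrm0 mul0r.
Qed.

Lemma schatten_idealN k T : schatten_ideal k T -> schatten_ideal k (- T).
Proof.
move=> [c [M [t [l [M0 t0 tS sl Tl]]]]].
exists c, M, t, (fun j => lmap (- 1) (l j)); split=> // [j|j].
  by rewrite size_map.
by rewrite frk_lmap mulN1r -opprD; apply: opbdN; exact: Tl.
Qed.

Lemma ler_max_exp (a b : R) k : 0 <= a -> 0 <= b ->
  a ^+ k <= Num.max a b ^+ k /\ b ^+ k <= Num.max a b ^+ k.
Proof.
by move=> a0 b0; split; apply: lerXn2r; rewrite ?nnegrE ?le_max ?a0 ?b0 ?lexx ?orbT.
Qed.

Lemma schatten_idealD k S T :
  schatten_ideal k S -> schatten_ideal k T -> schatten_ideal k (S + T).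
Proof.
move=> [c [M [t [l [M0 t0 tS sl Sl]]]]] [c' [M' [t' [l' [M'0 t'0 t'S sl' Tl]]]]].
exists (c + c')%N, (M + M'), (fun j => Num.max (t j) (t' j)), (fun j => l j ++ l' j).
split=> [|j||j|j]; first exact: addr_ge0.
- by rewrite le_max t0.
- exact: sumbd_max.
- by rewrite size_cat mulnDl leq_add.
have [le1 le2] := ler_max_exp k (t0 j) (t'0 j).
rewrite frk_cat opprD addrACA mulrDl.
by apply: opbdD; [apply: opbd_le (Sl j) | apply: opbd_le (Tl j)]; rewrite ler_wpM2l.
Qed.

(** This list presents [lx y + x ly - lx ly], whose distance to [x y] factors as
    [(x - lx) (y - ly)]: errors multiply, so exponents add as in the inequality of Hölder. *)
Definition mul_approx x y lx ly : seq (H * H) :=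
  rmap y lx ++ lmap x ly ++ lmap (- frk lx) ly.

Lemma frk_mul_approx x y lx ly :
  x * y - frk (mul_approx x y lx ly) = (x - frk lx) * (y - frk ly).
Proof.
rewrite !frk_cat frk_rmap !frk_lmap; move: (frk lx) (frk ly) => a b; ncring.
Qed.

(** Cyclicity at the finite level: each of the three summands has the trace of its mirror image. *)
Lemma ftr_mul_approx x y lx ly :
  ftr (mul_approx x y lx ly) = ftr (mul_approx y x ly lx).
Proof.
rewrite !ftr_cat -!ftr_lrmap [RHS]addrCA; congr (_ + (_ + _)).
rewrite /ftr !big_map.
have E l l' : \sum_(uv <- l) ip ((- frk l') uv.1) uv.2 =
    - \sum_(uv <- l) \sum_(wz <- l') ip uv.1 wz.2 * ip wz.1 uv.2.
  rewrite -sumrN; apply: eq_bigr => uv _.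
  rewrite [LHS](ipNl (frk l' uv.1)) /= /frk_fun ip_suml; congr (- _).
  by apply: eq_bigr => wz _; rewrite ipZl.
rewrite !E exchange_big; congr (- _).
by apply: eq_bigr => a _; apply: eq_bigr => b _; rewrite mulrC.
Qed.

Lemma schatten_mul_approximants j k x y : schatten_ideal j x -> schatten_ideal k y ->
  exists (lx ly : nat -> seq (H * H)) c (M : R) (t : nat -> R),
  [/\ 0 <= M, forall i, 0 <= t i, sumbd (fun i => 2 ^+ i * t i ^+ p.*2),
      forall i, (size (mul_approx x y (lx i) (ly i)) <= c * 2 ^ i)%N /\
                (size (mul_approx y x (ly i) (lx i)) <= c * 2 ^ i)%N
    & forall i, opbd (x * y - frk (mul_approx x y (lx i) (ly i))) (M * t i ^+ (j + k)) /\
                opbd (y * x - frk (mul_approx y x (ly i) (lx i))) (M * t i ^+ (j + k))].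
Proof.
move=> [c [M [t [l [M0 t0 tS sl xl]]]]] [c' [M' [t' [l' [M'0 t'0 t'S sl' yl]]]]].
exists l, l', (2 * (c + c'))%N, (M * M'), (fun i => Num.max (t i) (t' i)).
split=> [|i||i|i]; first exact: mulr_ge0.
- by rewrite le_max t0.
- exact: sumbd_max.
- have := sl i; have := sl' i; rewrite /mul_approx !size_cat !size_map; nia.
rewrite !frk_mul_approx.
have [le1 _] := ler_max_exp j (t0 i) (t'0 i); have [_ le2] := ler_max_exp k (t0 i) (t'0 i).
set m := Num.max (t i) (t' i) in le1 le2 *; have m0 : 0 <= m by rewrite le_max t0.
have xb : opbd (x - frk (l i)) (M * m ^+ j) by apply: opbd_le (xl i); rewrite ler_wpM2l.
have yb : opbd (y - frk (l' i)) (M' * m ^+ k) by apply: opbd_le (yl i); rewrite ler_wpM2l.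
have -> : M * M' * m ^+ (j + k) = (M * m ^+ j) * (M' * m ^+ k) by rewrite exprD mulrACA.
split; last rewrite mulrC; apply: opbdM => //; exact: mulr_ge0 (exprn_ge0 _ _).
Qed.

Lemma schatten_idealM j k x y :
  schatten_ideal j x -> schatten_ideal k y -> schatten_ideal (j + k) (x * y).
Proof.
move=> Lx Ly; have [lx [ly [c [M [t [M0 t0 tS sl bl]]]]]] := schatten_mul_approximants Lx Ly.
exists c, M, t, (fun i => mul_approx x y (lx i) (ly i)); split=> // i.
- by have [] := sl i.
- by have [] := bl i.
Qed.

(** Since [2 ^+ j * t j ^+ p.*2 <= A], either [t j <= 1] or [t j <= A]; one factor [t j] is thus
    absorbed by the constant. *)
Lemma schatten_ideal_decr k T : schatten_ideal k.+1 T -> schatten_ideal k T.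
Proof.
move=> [c [M [t [l [M0 t0 [A tA] sl Tl]]]]].
have A0 : 0 <= A by have := tA 0%N; rewrite big_geq.
have tB j : t j <= A + 1.
  have [t1|t1] := leP (t j) 1; first by apply: le_trans t1 _; rewrite lerDr.
  have : 2 ^+ j * t j ^+ p.*2 <= A.
    apply: le_trans (tA j.+1); rewrite big_nat_recr //= lerDr.
    by apply: sumr_ge0 => i _; rewrite mulr_ge0 ?exprn_ge0.
  have le2 : 1 <= 2 ^+ j :> R by apply: exprn_ege1; rewrite ler1n.
  have tj : t j <= t j ^+ p.*2.
    by rewrite -{1}[t j]expr1; apply: ler_weXn2l => //; exact: ltW.
  have : t j ^+ p.*2 <= 2 ^+ j * t j ^+ p.*2 by rewrite ler_peMl ?exprn_ge0.
  by lra.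
exists c, (M * (A + 1)), t, l; split=> //; first by rewrite mulr_ge0 ?addr_ge0.
  by exists A.
move=> j; apply: opbd_le (Tl j); rewrite exprS mulrA.
by rewrite ler_wpM2r ?exprn_ge0 // ler_wpM2l.
Qed.

Lemma schatten_ideal_approximants T : schatten_ideal p.*2 T ->
  exists c tau l, approximants c tau l T.
Proof.
move=> [c [M [t [l [M0 t0 tS sl Tl]]]]].
exists c, (fun j => M * t j ^+ p.*2), l; split=> // [i|].
  by rewrite mulr_ge0 ?exprn_ge0.
apply: sumbd_le (sumbdZ M0 tS) => i; by rewrite mulrCA.
Qed.

(** When no orthonormal basis exists, [onb] takes its default [set0] and every trace is an empty
    sum. *)
Lemma op_trace_no_onb (T : H -> H) : ~ is_onb (@onb R H) -> op_trace T = 0.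
Proof.
move=> nonb; have E : @onb R H = set0.
  by move: nonb; rewrite /onb; case: xgetP.
rewrite /op_trace E /summability.sum.
have totallyP := @totally_filter H.
apply: (@cvg_lim C^o (@norm_hausdorff _ _) _ _ totallyP).
rewrite (_ : partial_sum _ = fun=> 0); first exact: cvg_cst.
apply/funext => A; rewrite /partial_sum big1 // => i _.
by rewrite /patch; case: ifP => // /set_mem.
Qed.

Lemma op_trace_filtration : trace_filtration q schatten_ideal (fun T : op H => op_trace T).
Proof.
split.
- exact: schatten_ideal_all.
- exact: schatten_ideal0.
- exact: schatten_idealD.
- exact: schatten_idealN.
- exact: schatten_idealM.
- exact: schatten_ideal_decr.
- move=> x y /schatten_ideal_approximants[c [tau [l xl]]].
  move=> /schatten_ideal_approximants[c' [tau' [l' yl]]].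
  case: (pselect (is_onb (@onb R H))) => onbP; last by rewrite !op_trace_no_onb ?addr0.
  have xyl : approximants (c + c') (fun i => tau i + tau' i) (fun i => l i ++ l' i) (x + y).
    split=> [i|i|i|].
    + rewrite size_cat mulnDl; exact: leq_add (appr_size xl i) (appr_size yl i).
    + exact: addr_ge0 (appr_ge0 xl i) (appr_ge0 yl i).
    + rewrite frk_cat opprD addrACA; exact: opbdD (appr_bd xl i) (appr_bd yl i).
    + apply: sumbd_le (sumbdD (appr_sum xl) (appr_sum yl)) => i; by rewrite mulrDr.
  apply: (tends_unique (op_trace_tends xyl onbP)).
  have := tendsD (op_trace_tends xl onbP) (op_trace_tends yl onbP).
  by congr tends; apply/funext => i; rewrite ftr_cat.
move=> j k x y jk Lx Ly; case: (pselect (is_onb (@onb R H))) => onbP; last first.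
  by rewrite !op_trace_no_onb.
have [lx [ly [c [M [t [M0 t0 tS sl]]]]]] := schatten_mul_approximants Lx Ly.
rewrite jk => bl.
have appr (z : op H) l : (forall i, (size (l i) <= c * 2 ^ i)%N) ->
    (forall i, opbd (z - frk (l i)) (M * t i ^+ p.*2)) ->
    approximants c (fun i => M * t i ^+ p.*2) l z.
  move=> sz bz; split=> // [i|]; first by rewrite mulr_ge0 ?exprn_ge0.
  by apply: sumbd_le (sumbdZ M0 tS) => i; rewrite mulrCA.
have a1 := appr (x * y) (fun i => mul_approx x y (lx i) (ly i)) (fun i => (sl i).1) (fun i => (bl i).1).
have a2 := appr (y * x) (fun i => mul_approx y x (ly i) (lx i)) (fun i => (sl i).2) (fun i => (bl i).2).
apply: (tends_unique (op_trace_tends a1 onbP)).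
have := op_trace_tends a2 onbP.
by congr tends; apply/funext => i; exact: ftr_mul_approx.
Qed.

End SchattenClasses.

(** * From a finite Schatten norm to dyadic approximants *)

Section SchattenNorm.
Context {R : realType} {H : hilbertType R} (q : nat).
Local Notation C := R[i].
Local Notation p := q.+1.
Local Notation E := (@onb R H).
Hypothesis onbP : is_onb E.
Implicit Types (S T B : op H) (x y : H) (s xs : seq H).

Lemma adjK T : adj (adj T) = T.
Proof.
apply: op_ext => y; apply/eqP; rewrite -subr_eq0; apply/eqP/ip_ge0_eq.
by rewrite ipBr -adjP -adjPr subrr.
Qed.

Definition hs_bounded B (S : R) :=
  forall xs, finite_in E xs -> \sum_(e <- xs) nrm (B e) ^+ 2 <= S.

Lemma parseval_seq B xs (eps : R) : 0 < eps -> exists2 s0, finite_in E s0 &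
  forall s, finite_in E s -> {subset s0 <= s} ->
    \sum_(x <- xs) nrm (B x) ^+ 2 <=
    \sum_(x <- xs) \sum_(e <- s) nrm (ip (B x) e) ^+ 2 + eps.
Proof.
elim: xs eps => [|x xs IHxs] eps eps0.
  by exists [::] => // s _ _; rewrite !big_nil add0r ltW.
have e2 : 0 < eps / 2 by rewrite divr_gt0.
have [s1 f1 H1] := IHxs _ e2; have [s2 f2 H2] := parseval_nrm onbP (B x) e2.
exists (fin_union s1 s2); first exact: finite_in_union.
move=> s fs ss; rewrite !big_cons.
have := H1 s fs (fun e es => ss _ (@sub_fin_unionl _ _ _ _ _ es)).
by have := H2 s fs (fun e es => ss _ (@sub_fin_unionr _ _ _ _ _ es)); lra.
Qed.

(** Both sums come from the double sum of [|<B e, x>|^2]: Parseval expands the one over [xs], Bessel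
    bounds it by the one over the basis. *)
Lemma hs_adj B (S : R) : hs_bounded B S ->
  forall xs, ortho xs -> \sum_(x <- xs) nrm (adj B x) ^+ 2 <= S.
Proof.
move=> BS xs oxs; apply/ler_addgt0Pr => eps eps0.
have [s fs Hs] := parseval_seq (adj B) xs eps0.
apply: (le_trans (Hs s fs (fun _ es => es))); rewrite lerD2r exchange_big.
apply: le_trans (BS s fs); apply: ler_sum => e _ /=.
rewrite (eq_bigr (fun x => nrm (ip (B e) x) ^+ 2)); first exact: bessel.
by move=> x _; rewrite -adjPr ipC nrm_conj.
Qed.

(** Passing to the adjoint twice replaces the chosen basis by an arbitrary orthonormal list. *)
Lemma hs_ortho B (S : R) : hs_bounded B S ->
  forall xs, ortho xs -> \sum_(x <- xs) nrm (B x) ^+ 2 <= S.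
Proof.
move=> BS; have BS' : hs_bounded (adj B) S.
  by move=> xs /(finite_in_ortho onbP); exact: hs_adj.
by move=> xs oxs; have := hs_adj BS' oxs; rewrite adjK.
Qed.

(** [alt_prod T k.*2] is [(T^* T)^k]. Moving half of its factors across the inner product turns the
    diagonal coefficients into squared norms, so [|T|] itself need not be formed. *)
Fixpoint alt_prod T k : op H :=
  if k is j.+1 then (if odd j then adj T else T) * alt_prod T j else 1.

Lemma alt_prod_shift T j k x : odd j != odd k ->
  ip (alt_prod T j.+1 x) (alt_prod T k x) = ip (alt_prod T j x) (alt_prod T k.+1 x).
Proof. by move=> /=; case: (odd j); case: (odd k) => // _ /=; [rewrite -adjPr | rewrite adjP]. Qed.

Lemma alt_prod_double T k x : ip (alt_prod T k.*2 x) x = (nrm (alt_prod T k x) ^+ 2)%:C.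
Proof.
rewrite -ipxx; have shift i : (i <= k)%N ->
    ip (alt_prod T (k + i) x) (alt_prod T (k - i) x) =
    ip (alt_prod T k x) (alt_prod T k x).
  elim: i => [|i IHi] ik; first by rewrite addn0 subn0.
  rewrite addnS alt_prod_shift ?subnSK ?IHi //; first exact: ltnW.
  by rewrite oddD oddB // oddS; case: (odd k); case: (odd i).
by rewrite -(shift k) // subnn addnn.
Qed.

Lemma iter_adjoint T k x : iter k (op_adjoint T \o T) x = alt_prod T k.*2 x.
Proof.
elim: k => //= k ->; rewrite op_adjointE odd_double /=.
by case: (odd _).
Qed.

(** Cauchy-Schwarz makes the norms [m j] log-convex, so their ratios increase, and the first ratio
    is at least [m 1] because [m 0 <= 1]. *)
Lemma alt_prod_moment T k x : nrm x <= 1 -> nrm (T x) ^+ k.+1 <= nrm (alt_prod T k.+1 x).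
Proof.
move=> x1; pose m j := nrm (alt_prod T j x).
have m0 j : 0 <= m j by exact: nrm_ge0.
have convex j : m j.+1 ^+ 2 <= m j * m j.+2.
  have := cauchy_schwarz (alt_prod T j x) (alt_prod T j.+2 x).
  by rewrite -alt_prod_shift ?ipxx ?nrm_real ?ger0_norm ?sqr_ge0 //= ; case: (odd j).
have step j : m j * m 1%N <= m j.+1.
  elim: j => [|j IHj]; first by rewrite /m /= ler_piMl ?nrm_ge0.
  have [z|nz] := eqVneq (m j.+1) 0; first by rewrite z mul0r.
  have pz : 0 < m j.+1 by rewrite lt_neqAle eq_sym nz m0.
  rewrite -(ler_pM2l pz) mulrA -expr2.
  apply: (@le_trans _ _ (m j * m j.+2 * m 1%N)); first by rewrite ler_wpM2r.
  by rewrite mulrAC ler_wpM2r.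
have -> : nrm (T x) = m 1%N by [].
elim: k => [|k IHk]; first by rewrite expr1.
by rewrite exprSr; apply: le_trans (step k.+1); rewrite ler_wpM2r.
Qed.

Lemma schatten_norm_hs T : (schatten_norm p T < +oo)%E ->
  exists S : R, hs_bounded (alt_prod T p) S.
Proof.
move=> /lty_poweRy; have p0 : (p.*2%:R : R)^-1 != 0 by rewrite invr_eq0 pnatr_eq0.
move=> /(_ p0); set X := (\esum_(e in _) _)%E => Xfin.
have X0 : (0 <= X)%E.
  apply: esum_ge0 => e _; rewrite lee_fin iter_adjoint.
  by have := alt_prod_double T p e; rewrite /ip => ->; rewrite /= sqr_ge0.
exists (fine X) => xs [uxs xsE]; rewrite -lee_fin fineK ?ge0_fin_numE //.
rewrite /X; apply: esum_ge; exists [set` xs].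
  by split; [exact: finite_seq | move=> e /= /xsE].
rewrite -fsbig_seq // -sumEFin; apply: lee_sum => e _; rewrite lee_fin iter_adjoint.
by have := alt_prod_double T p e; rewrite /ip => ->.
Qed.

(** The supremum of [nrm (T x)] over unit vectors orthogonal to [s] need not be attained; half of it
    suffices, hence the factor 2. If it is 0, [v = 0] serves. *)
Lemma greedy_vector T s : exists v, [/\ forall e, e \in s -> ip v e = 0,
  (v == 0) || (ip v v == 1) &
  forall x, (forall e, e \in s -> ip x e = 0) -> nrm (T x) <= 2 * nrm (T v) * nrm x].
Proof.
have [M M0 TM] := opbd_exists T.
pose A := [set nrm (T x) | x in [set x | nrm x <= 1 /\ forall e, e \in s -> ip x e = 0]].
have A0 : A 0.
  by exists 0; [split; [rewrite nrm0 | move=> e _; rewrite ip0l] | rewrite op0 nrm0].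
have supA : has_sup A.
  split; first by exists 0.
  exists M => _ [x [x1 _] <-]; apply: (le_trans (TM x)); by rewrite ler_piMr.
have A_le x : (forall e, e \in s -> ip x e = 0) -> nrm (T x) <= sup A * nrm x.
  move=> xs; have [->|x0] := eqVneq x 0; first by rewrite op0 nrm0 mulr0.
  have nx : 0 < nrm x.
    by rewrite lt_neqAle nrm_ge0 andbT eq_sym; apply: contra_neq x0; exact: nrm_eq0.
  have : nrm (T ((nrm x)^-1%:C *: x)) <= sup A.
    apply: sup_upper_bound => //; exists ((nrm x)^-1%:C *: x) => //; split.
      by rewrite nrmZ nrm_real ger0_norm ?invr_ge0 ?nrm_ge0 // mulVf ?gt_eqF.
    by move=> e /xs xe; rewrite ipZl xe mulr0.
  rewrite opZ nrmZ nrm_real ger0_norm ?invr_ge0 ?nrm_ge0 //.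
  by rewrite mulrC ler_pdivrMr.
have supA0 : 0 <= sup A by apply: sup_upper_bound.
have [A00|A00] := eqVneq (sup A) 0.
  exists 0; split=> [e _||x xs]; rewrite ?ip0l ?eqxx // op0 nrm0 mulr0 mul0r.
  by have := A_le x xs; rewrite A00 mul0r.
have A1 : 0 < sup A by rewrite lt_neqAle eq_sym A00.
have [_ [x [x1 xs] <-] Hx] := sup_adherent (divr_gt0 A1 (ltr0Sn R 1)) supA.
have Tx : sup A / 2 < nrm (T x) by lra.
have x0 : x != 0 by apply: contraTneq Tx => ->; rewrite op0 nrm0 -leNgt divr_ge0.
have nx : 0 < nrm x.
  by rewrite lt_neqAle nrm_ge0 andbT eq_sym; apply: contra_neq x0; exact: nrm_eq0.
exists ((nrm x)^-1%:C *: x); split=> [e /xs xe||y ys].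
- by rewrite ipZl xe mulr0.
- apply/orP; right; rewrite ipZl ipZr ipxx conjCreal -!rmorphM /=.
  by have -> : (nrm x)^-1 * ((nrm x)^-1 * nrm x ^+ 2) = 1 by field; rewrite gt_eqF.
apply: (le_trans (A_le y ys)); rewrite ler_wpM2r ?nrm_ge0 //.
rewrite opZ nrmZ nrm_real ger0_norm ?invr_ge0 ?nrm_ge0 //.
have : nrm (T x) <= (nrm x)^-1 * nrm (T x).
  by rewrite ler_peMl ?nrm_ge0 // invf_ge1.
by lra.
Qed.

(** The greedy values are not known to decrease, so in each dyadic block one picks an index whose
    value is at most the average of the block. *)
Lemma dyadic_choice (a : nat -> R) (S : R) : (forall i, 0 <= a i) ->
  (forall n, \sum_(0 <= i < n) a i <= S) ->
  exists n : nat -> nat, (forall j, (n j < 2 ^ j.+1)%N) /\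
    forall J, \sum_(0 <= j < J) 2 ^+ j * a (n j) <= S.
Proof.
move=> a0 aS.
have /choice[n Hn] : forall j, exists n, (2 ^ j <= n < 2 ^ j.+1)%N /\
    2 ^+ j * a n <= \sum_(2 ^ j <= i < 2 ^ j.+1) a i.
  move=> j; apply: contrapT => /forallNP no.
  have : \sum_(2 ^ j <= i < 2 ^ j.+1) a i < \sum_(2 ^ j <= n < 2 ^ j.+1) a n.
    have lt2 : (2 ^ j < 2 ^ j.+1)%N by rewrite ltn_exp2l.
    have blk i : (2 ^ j <= i < 2 ^ j.+1)%N ->
        (\sum_(2 ^ j <= i < 2 ^ j.+1) a i) / 2 ^+ j < a i.
      move=> Hi; have := no i; rewrite Hi => /not_andP[//|/negP].
      by rewrite -ltNge ltr_pdivrMr ?exprn_gt0 // mulrC.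
    apply: le_lt_trans (_ : \sum_(2 ^ j <= i < 2 ^ j.+1)
       ((\sum_(2 ^ j <= i < 2 ^ j.+1) a i) / 2 ^+ j) < _).
      have e2 : (2 ^ j.+1 - 2 ^ j = 2 ^ j)%N by rewrite expnS mul2n -addnn addnK.
      by rewrite sumr_const_nat e2 -[leRHS]mulr_natr natrX divfK // expf_neq0.
    by apply: ltr_sum_nat.
  by rewrite ltxx.
exists n; split=> [j|J]; first by have [/andP[]] := Hn j.
apply: le_trans (aS (2 ^ J)%N).
elim: J => [|J IHJ]; first by rewrite big_geq // sumr_ge0.
rewrite big_nat_recr //= (@big_cat_nat _ _ _ (2 ^ J) 0 (2 ^ J.+1)) //=; last first.
  by rewrite leq_exp2l.
by apply: lerD => //; have [] := Hn J.
Qed.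

Lemma schatten_class_ideal T : schatten_class p T -> schatten_ideal q 1 T.
Proof.
move=> [_ /schatten_norm_hs[S BS]].
have /choice[pick Hpick] := greedy_vector T.
pose xs := fix xs n := if n is k.+1 then pick (xs k) :: xs k else [::].
pose v n := pick (xs n).
have oxs n : ortho (xs n).
  elim: n => //= n IHn; have [p0 p1 _] := Hpick (xs n).
  by rewrite ortho_cons IHn p1 !andbT; apply/allP => e /p0 ->.
have sxs n : size (xs n) = n by elim: n => //= n ->.
have xsE (F : H -> R) n : \sum_(e <- xs n) F e = \sum_(0 <= i < n) F (v i).
  elim: n => [|n IHn]; first by rewrite big_nil big_geq.
  by rewrite /= big_cons IHn big_nat_recr //= addrC.
pose a i := nrm (T (v i)) ^+ p.*2.
have a0 i : 0 <= a i by rewrite exprn_ge0 ?nrm_ge0.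
(* The moment inequality bounds [|T e|^(2 p)] by [|alt_prod T p e|^2], summable along orthonormal
   lists. *)
have aS n : \sum_(0 <= i < n) a i <= S.
  rewrite -(xsE (fun e => nrm (T e) ^+ p.*2)); apply: le_trans (hs_ortho BS (oxs n)).
  rewrite big_seq [leRHS]big_seq; apply: ler_sum => e es.
  by rewrite -muln2 exprM ler_sqr ?nnegrE ?exprn_ge0 ?nrm_ge0 // alt_prod_moment // (nrm_ortho (oxs n)).
have [n [n2 nS]] := dyadic_choice a0 aS.
(* [T] times the projection on the first [n j] vectors; the remainder acts on their complement,
   where the greedy choice bounds [T] by [2 * nrm (T (v (n j)))]. *)
pose l j := lmap T [seq (e, e) | e <- xs (n j)].
exists 2%N, 2, (fun j => nrm (T (v (n j)))), l; split=> //.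
- by move=> j; exact: nrm_ge0.
- by exists S.
- by move=> j; rewrite !size_map sxs -expnS ltnW.
move=> j x; rewrite frk_lmap expr1.
have -> : (T - T * frk [seq (e, e) | e <- xs (n j)]) x = T (x - proj (xs (n j)) x).
  by rewrite opB /= /frk_fun big_map.
have [_ _ Hx] := Hpick (xs (n j)).
apply: (le_trans (Hx _ _)); first by move=> e es; rewrite ip_sub_proj.
by rewrite ler_wpM2l ?mulr_ge0 ?nrm_ge0 //; exact: nrm_sub_proj.
Qed.

End SchattenNorm.

(** * The exponential of a commutative Banach algebra *)

Section BanachAlgebra.
Context {R : realType} {A : comBanachAlgType R[i]}.
Local Notation C := R[i].
Local Notation B := (alg_of A).
Implicit Types (x y : B).

(** [alg_of A] carries the ring and [A] the norm; [an] and [atends] read the latter on elements of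
    the former. *)
Definition an x : R := nrm (x : A).
Definition atends (u : nat -> B) (l : B) := tends (u : nat -> A) (l : A).

Lemma an_ge0 x : 0 <= an x. Proof. exact: nrm_ge0. Qed.
Lemma anD x y : an (x + y) <= an x + an y. Proof. exact: nrmD. Qed.
Lemma anN x : an (- x) = an x. Proof. exact: nrmN. Qed.
Lemma an0 : an 0 = 0. Proof. exact: nrm0. Qed.
Lemma an_eq0 x : an x = 0 -> x = 0. Proof. exact: nrm_eq0. Qed.
Lemma anZ (c : C) x : an (c *: x) = nrm c * an x. Proof. exact: nrmZ. Qed.

Lemma anM x y : an (x * y) <= an x * an y.
Proof.
have := @ler_norm_bmul _ A x y; rewrite !nrmE -rmorphM /= lecR; exact.
Qed.

Lemma an_sum (I : Type) (r : seq I) (P : pred I) (F : I -> B) :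
  an (\sum_(i <- r | P i) F i) <= \sum_(i <- r | P i) an (F i).
Proof. exact: nrm_sum. Qed.

Lemma an1_ge1 : 1 <= an 1.
Proof.
have an1 : 0 < an 1.
  rewrite lt_neqAle an_ge0 andbT eq_sym; apply/eqP => /an_eq0 /eqP.
  by rewrite oner_eq0.
by have := anM 1 1; rewrite mulr1 -{1}[an 1]mul1r ler_pM2r.
Qed.

Lemma anX1 x n : an (x ^+ n.+1) <= an x ^+ n.+1.
Proof.
elim: n => [|n IHn]; first by rewrite !expr1.
rewrite exprS [leRHS]exprS; apply: (le_trans (anM _ _)).
by rewrite ler_wpM2l ?an_ge0.
Qed.

Lemma atendsM u v x y : atends u x -> atends v y -> atends (fun n => u n * v n) (x * y).
Proof.
move=> ux vy e e0.
pose K := an x + an y + 1; have K0 : 0 < K by rewrite ltr_wpDl ?addr_ge0 ?an_ge0.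
pose d := Num.min 1 (e / (K *+ 2)).
have d0 : 0 < d by rewrite lt_min ltr01 divr_gt0 // pmulrn_lgt0.
have [N1 H1] := ux _ d0; have [N2 H2] := vy _ d0.
exists (maxn N1 N2) => n; rewrite geq_max => /andP[n1 n2].
have -> : (u n * v n - x * y : B) = (u n - x) * (v n) + x * (v n - y).
  by rewrite mulrBl mulrBr addrA subrK.
have h1 : an (u n - x) <= d := H1 n n1; have h2 : an (v n - y) <= d := H2 n n2.
have d1 : d <= 1 by rewrite ge_min lexx.
have dK : d * (K *+ 2) <= e.
  by rewrite -ler_pdivlMr ?pmulrn_lgt0 // ge_min lexx orbT.
have hv : an (v n) <= an y + 1.
  by rewrite -[v n](subrK y) addrC; apply: (le_trans (anD _ _)); rewrite lerD2l (le_trans h2).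
apply: le_trans dK; apply: (le_trans (anD _ _)).
have b1 : an ((u n - x) * v n) <= d * K.
  apply: (le_trans (anM _ _)); apply: ler_pM; rewrite ?an_ge0 // (le_trans hv) //.
  by rewrite /K; have := an_ge0 x; lra.
have b2 : an (x * (v n - y)) <= d * K.
  apply: (le_trans (anM _ _)); rewrite mulrC; apply: ler_pM; rewrite ?an_ge0 //.
  by rewrite /K; have := an_ge0 y; lra.
by rewrite mulrnAr mulr2n lerD.
Qed.

Lemma atends_sum (I : Type) (r : seq I) (P : pred I) (u : I -> nat -> B) (l : I -> B) :
  (forall i, atends (u i) (l i)) ->
  atends (fun n => \sum_(i <- r | P i) u i n) (\sum_(i <- r | P i) l i).
Proof.
move=> ul; elim: r => [|i r IHr].
  rewrite big_nil (_ : (fun n => _) = fun=> 0); first exact: tends_cst.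
  by apply/funext => n; rewrite big_nil.
rewrite big_cons (_ : (fun n => _) = fun n => (if P i then u i n else 0) +
    \sum_(j <- r | P j) u j n); last first.
  by apply/funext => n; rewrite big_cons; case: (P i); rewrite ?add0r.
case: (P i); first exact: (@tendsD R A _ _ _ _ (ul i) IHr).
by under eq_fun do rewrite add0r.
Qed.

Lemma atends_prod (I : Type) (r : seq I) (u : I -> nat -> B) (l : I -> B) :
  (forall i, atends (u i) (l i)) ->
  atends (fun n => \prod_(i <- r) u i n) (\prod_(i <- r) l i).
Proof.
move=> ul; elim: r => [|i r IHr].
  rewrite big_nil (_ : (fun n => _) = fun=> 1); first exact: tends_cst.
  by apply/funext => n; rewrite big_nil.
rewrite big_cons; under eq_fun do rewrite big_cons; exact: atendsM.
Qed.

Lemma atends_det k (u : nat -> 'M[B]_k) (l : 'M[B]_k) :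
  (forall i j, atends (fun n => u n i j) (l i j)) -> atends (fun n => \det (u n)) (\det l).
Proof.
move=> ul; apply: atends_sum => s; apply: atendsM; first exact: tends_cst.
by apply: atends_prod => i.
Qed.

Section MatrixNorm.
Variable k : nat.
Implicit Types (a b : 'M[B]_k).

Definition mn a : R := \sum_i \sum_j an (a i j).

Lemma mn_ge0 a : 0 <= mn a.
Proof. by apply: sumr_ge0 => i _; apply: sumr_ge0 => j _; exact: an_ge0. Qed.

Lemma an_le_mn a i j : an (a i j) <= mn a.
Proof.
rewrite /mn (bigD1 i) //= (bigD1 j) //= -addrA lerDl addr_ge0 //.
  by apply: sumr_ge0 => *; exact: an_ge0.
by apply: sumr_ge0 => *; apply: sumr_ge0 => *; exact: an_ge0.
Qed.

Lemma mnM a b : mn (a * b) <= mn a * mn b.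
Proof.
rewrite {2}/mn mulr_suml; apply: ler_sum => i _.
apply: (@le_trans _ _ (\sum_j \sum_l an (a i l) * an (b l j))).
  apply: ler_sum => j _; rewrite mxE; apply: (le_trans (an_sum _ _ _)).
  by apply: ler_sum => l _; exact: anM.
rewrite exchange_big mulr_suml; apply: ler_sum => l _ /=.
rewrite -mulr_sumr ler_wpM2l ?an_ge0 // /mn [leRHS](bigD1 l) //= lerDl.
by apply: sumr_ge0 => *; apply: sumr_ge0 => *; exact: an_ge0.
Qed.

Lemma mnX a n : mn (a ^+ n) <= mn 1 * mn a ^+ n.
Proof.
elim: n => [|n IHn]; first by rewrite !expr0 mulr1.
rewrite !exprS; apply: (le_trans (mnM _ _)); rewrite mulrCA.
by rewrite ler_wpM2l ?mn_ge0.
Qed.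

End MatrixNorm.

Lemma exp_series_le (r : R) n : 0 <= r -> \sum_(0 <= i < n) r ^+ i / i`!%:R <= expR r.
Proof.
move=> r0; have := nondecreasing_cvgn_le _ (@is_cvg_series_exp_coeff R r) n.
by rewrite /series /exp_coeff /= /expR; apply; apply: nondecreasing_series => i _ _; rewrite divr_ge0 ?exprn_ge0.
Qed.

Lemma exp_term_sumbd (M r : R) : 0 <= M -> 0 <= r -> sumbd (fun i => M * (r ^+ i / i`!%:R)).
Proof. by move=> M0 r0; apply: sumbdZ => //; exists (expR r) => n; exact: exp_series_le. Qed.

Lemma atends_series (t : nat -> B) (g : nat -> R) :
  (forall n, an (t n) <= g n) -> sumbd g ->
  atends (fun n => \sum_(0 <= i < n) t i) (limn (series (t : nat -> A))).
Proof.
move=> tg gS; have g0 n : 0 <= g n by apply: le_trans (tg n); exact: an_ge0.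
suff [l tl] : exists l, atends (fun n => \sum_(0 <= i < n) t i) l.
  have := tends_cvg tl; rewrite -[fun n => _]/(series (t : nat -> A)) => tl'.
  by rewrite (cvg_lim _ tl') //.
apply: (@nrm_complete _ A) => e e0.
have [N HN] := sumbd_tail g0 gS e0.
suff H n m : (N <= n)%N -> (n <= m)%N ->
    an (\sum_(0 <= i < m) t i - \sum_(0 <= i < n) t i) <= e.
  exists N => n m Nn Nm; have [nm|/ltnW mn] := leqP n m; last exact: H.
  by rewrite nrmB; exact: H.
move=> Nn nm; rewrite (@big_cat_nat _ _ _ n 0 m) //= addrAC subrr add0r.
apply: le_trans (HN n m Nn nm); apply: (le_trans (an_sum _ _ _)).
by apply: ler_sum.
Qed.

Lemma atends_le (u : nat -> B) l (M : R) : atends u l -> (forall n, an (u n) <= M) -> an l <= M.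
Proof.
move=> ul uM; apply/ler_addgt0Pr => e e0; have [N HN] := ul e e0.
have -> : l = u N - (u N - l) by rewrite opprB addrC subrK.
apply: (le_trans (anD _ _)); rewrite anN; exact: lerD (uM N) (HN N (leqnn _)).
Qed.

(** With [x = r / m.+1], the inequality [1 - x <= exp (- x)] gives [(1 - x^2) exp x <= 1 + x]. Take
    powers and apply the Bernoulli inequality to [1 - x^2]. *)
Lemma compound_interest (r : R) m : 0 <= r -> r < m.+1%:R ->
  expR r - (1 + r / m.+1%:R) ^+ m.+1 <= expR r * r ^+ 2 / m.+1%:R.
Proof.
move=> r0 rm; set M := m.+1%:R : R; have M0 : 0 < M by rewrite ltr0n.
pose x := r / M; have x0 : 0 <= x by rewrite divr_ge0 // ltW.
have x1 : x < 1 by rewrite /x ltr_pdivrMr // mul1r.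
have e1 : (1 - x ^+ 2) * expR x <= 1 + x.
  have : (1 - x) * expR x <= 1.
    have := expR_ge1Dx (- x); rewrite expRN => h.
    by rewrite -ler_pdivlMr ?expR_gt0 // mul1r.
  have -> : 1 - x ^+ 2 = (1 + x) * (1 - x) by ring.
  by move=> h; rewrite -mulrA ger_pMr ?ltr_pwDl.
have bern : 1 - m.+1%:R * x ^+ 2 <= (1 - x ^+ 2) ^+ m.+1.
  elim: (m.+1) => [|n IHn]; first by rewrite mul0r subr0 expr0.
  have y1 : 0 <= 1 - x ^+ 2 by rewrite subr_ge0 expr_le1 // ltW.
  rewrite [leRHS]exprSr; apply: le_trans (ler_wpM2r y1 IHn).
  rewrite -natr1; have := sqr_ge0 (x ^+ 2); have : 0 <= n%:R :> R by [].
  by nra.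
have : (1 - x ^+ 2) ^+ m.+1 * expR r <= (1 + x) ^+ m.+1.
  have -> : expR r = expR x ^+ m.+1 by rewrite -expRM_natl /x mulrC divfK ?gt_eqF.
  rewrite -exprMn lerXn2r ?nnegrE ?addr_ge0 // mulr_ge0 ?expR_ge0 //.
  by rewrite subr_ge0 expr_le1 // ltW.
have : (1 - m.+1%:R * x ^+ 2) * expR r <= (1 - x ^+ 2) ^+ m.+1 * expR r.
  by rewrite ler_wpM2r ?expR_ge0.
rewrite -/M; have -> : M * x ^+ 2 = r ^+ 2 / M by rewrite /x; field; rewrite gt_eqF.
rewrite -/x -[expR r * _ / _]mulrA; move: (expR r) (r ^+ 2 / M) => E t; lra.
Qed.

(** Gives a sign to the difference between the coefficients of the exponential series and those of
    its Euler approximant. *)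
Lemma bin_coef_le m n : 'C(m.+1, n)%:R / m.+1%:R ^+ n <= (n`!%:R)^-1 :> R.
Proof.
rewrite ler_pdivrMr ?exprn_gt0 ?ltr0n // mulrC ler_pdivlMr ?ltr0n ?fact_gt0 //.
rewrite -natrM -natrX ler_nat bin_ffact.
elim: n => // n IHn; rewrite ffactnSr expnSr leq_mul //; lia.
Qed.

End BanachAlgebra.

(** * Exponentials as limits of [(1 + a / m)^m] *)

Section Exponential.
Context {R : realType} {A : comBanachAlgType R[i]}.
Local Notation C := R[i].
Local Notation B := (alg_of A).
Implicit Types (x y : B).

Lemma nrm_realV (r : R) : 0 <= r -> nrm (r%:C : C) = r.
Proof. by move=> r0; rewrite nrm_real ger0_norm. Qed.

Lemma natVC n : (n%:R : C)^-1 = ((n%:R : R)^-1)%:C.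
Proof. by rewrite fmorphV /= rmorph_nat. Qed.

Lemma nrm_natV n : nrm ((n%:R : C)^-1) = n%:R^-1.
Proof. by rewrite natVC nrm_realV ?invr_ge0. Qed.

Lemma inv_small (K : R) : 0 <= K -> forall e : R, 0 < e ->
  exists N, forall n, (N <= n)%N -> K / n.+1%:R <= e.
Proof.
move=> K0 e e0; exists (Num.truncn (K / e)) => n Nn.
rewrite ler_pdivrMr ?ltr0n // mulrC -ler_pdivrMr //.
by apply: ltW; apply: lt_le_trans (truncnS_gt _) _; rewrite ler_nat.
Qed.

(** Factor [u - v] out of the difference of powers: [m.+1] terms remain, each bounded by the square
    of [an 1 * expR c], against a factor [K / m.+1 ^ 2]. *)
Lemma power_perturbation (u v : nat -> B) (c K : R) : 0 <= c -> 0 <= K ->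
  (forall m, an (u m - 1) <= c / m.+1%:R) -> (forall m, an (v m - 1) <= c / m.+1%:R) ->
  (forall m, an (u m - v m) <= K / m.+1%:R ^+ 2) ->
  atends (fun m => u m ^+ m.+1 - v m ^+ m.+1) 0.
Proof.
move=> c0 K0 uc vc uv.
have pow (w : B) m i : an (w - 1) <= c / m.+1%:R -> (i <= m.+1)%N ->
    an (w ^+ i) <= an (1 : B) * expR c.
  move=> wc im; have d0 : 0 <= c / m.+1%:R by rewrite divr_ge0.
  have : an (w ^+ i) <= an (1 : B) * (1 + c / m.+1%:R) ^+ i.
    elim: i {im} => [|i IHi]; first by rewrite !expr0 mulr1.
    have -> : w ^+ i.+1 = w ^+ i + w ^+ i * (w - 1) by rewrite mulrBr mulr1 addrC subrK exprSr.
    apply: (le_trans (anD _ _)).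
    apply: (@le_trans _ _ (an (w ^+ i) * (1 + c / m.+1%:R))).
      rewrite [leRHS]mulrDr mulr1 lerD2l; apply: (le_trans (anM _ _)).
      by rewrite ler_wpM2l ?an_ge0.
    by rewrite exprSr mulrA ler_wpM2r ?addr_ge0.
  move/le_trans; apply; rewrite ler_wpM2l ?an_ge0 //.
  apply: (@le_trans _ _ (expR (c / m.+1%:R) ^+ i)).
    by rewrite lerXn2r ?nnegrE ?addr_ge0 ?expR_ge0 ?expR_ge1Dx.
  rewrite -expRM_natl ler_expR mulrC -mulrA ler_piMr //.
  by rewrite mulrC ler_pdivrMr ?ltr0n // mul1r ler_nat.
pose G := an (1 : B) * expR c; have G0 : 0 <= G by rewrite mulr_ge0 ?an_ge0 ?expR_ge0.
have bound m : an (u m ^+ m.+1 - v m ^+ m.+1) <= K * (G * G) / m.+1%:R.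
  rewrite subrXX; apply: (le_trans (anM _ _)).
  have S : an (\sum_(i < m.+1) u m ^+ (m.+1.-1 - i) * v m ^+ i) <= m.+1%:R * (G * G).
    apply: (le_trans (an_sum _ _ _)).
    rewrite -[X in X%:R]card_ord -sum1_card natr_sum mulr_suml.
    apply: ler_sum => i _; rewrite mul1r; apply: (le_trans (anM _ _)).
    apply: ler_pM; rewrite ?an_ge0 //; apply: (pow _ m) => //.
      by apply: (leq_trans (leq_subr _ _)).
    exact: ltnW.
  apply: le_trans (ler_pM (an_ge0 _) (an_ge0 _) (uv m) S) _.
  have -> : K / m.+1%:R ^+ 2 * (m.+1%:R * (G * G)) = K * (G * G) / m.+1%:R.
    by field; rewrite addr_eq0 gt_eqF ?ltr0n //; apply: contraTneq => //.
  exact: lexx.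
move=> e e0; have [N HN] := @inv_small (K * (G * G)) (mulr_ge0 K0 (mulr_ge0 G0 G0)) e e0.
exists N => n Nn; rewrite subr0; exact: le_trans (bound n) (HN n Nn).
Qed.

Section MatrixExponential.
Variable k : nat.
Implicit Types (a b : 'M[B]_k).

Lemma expmx_series a i j :
  atends (fun m => \sum_(0 <= n < m) (n`!%:R : C)^-1 *: (a ^+ n) i j) (expmx a i j).
Proof.
rewrite mxE; apply: (@atends_series _ _ _ (fun n => mn (1 : 'M[B]_k) * (mn a ^+ n / n`!%:R))).
  move=> n; rewrite anZ nrm_natV mulrC mulrA ler_wpM2r ?invr_ge0 //.
  by apply: le_trans (mnX a n); exact: an_le_mn.
by apply: exp_term_sumbd; exact: mn_ge0.
Qed.

(** The complex scalar enters as a scalar matrix because these matrices form an algebra over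
    [alg_of A], not directly over [R[i]]. *)
Definition euler a m : 'M[B]_k :=
  (1 + ((m.+1%:R : C)^-1%:A : B)%:M * a) ^+ m.+1.

Lemma eulerE a m i j : euler a m i j =
  \sum_(n < m.+2) ('C(m.+1, n)%:R / m.+1%:R ^+ n : C) *: (a ^+ n) i j.
Proof.
set e := (m.+1%:R : C)^-1.
have pw n : ((e%:A : B)%:M * a) ^+ n = (e ^+ n)%:A *: a ^+ n.
  elim: n => [|n IHn]; first by rewrite !expr0 scale1r scale1r.
  rewrite exprS IHn [a ^+ n.+1]exprS [e ^+ n.+1]exprS.
  rewrite -[X in X * _]/(_ *m a) mul_scalar_mx.
  rewrite -[LHS]/(_ *m _) -scalemxAl -scalemxAr scalerA.
  by rewrite -scalerAl mul1r scalerA.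
rewrite /euler exprDn_comm; last exact/commr_sym/commr1.
rewrite summxE; apply: eq_bigr => n _.
rewrite expr1n mul1r pw mulmxnE mxE -scalerAl mul1r -scaler_nat scalerA.
by rewrite /e exprVn.
Qed.

(** The coefficients of the difference being nonnegative, its norm is at most [mn 1] times the same
    difference at the real number [mn a], where [compound_interest] applies. *)
Lemma euler_expmx a i j : atends (fun m => euler a m i j) (expmx a i j).
Proof.
have r0 := mn_ge0 a; set r := mn a in r0.
pose K := mn (1 : 'M[B]_k) * (expR r * r ^+ 2).
have K0 : 0 <= K by rewrite !mulr_ge0 ?mn_ge0 ?expR_ge0 ?exprn_ge0.
have dist m : r < m.+1%:R ->
    an (\sum_(0 <= n < m.+2) (n`!%:R : C)^-1 *: (a ^+ n) i j - euler a m i j) <= K / m.+1%:R.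
  move=> rm; rewrite eulerE big_mkord -sumrB; apply: (le_trans (an_sum _ _ _)).
  apply: (@le_trans _ _ (\sum_(n < m.+2) mn (1 : 'M[B]_k) *
      (r ^+ n / n`!%:R - 'C(m.+1, n)%:R / m.+1%:R ^+ n * r ^+ n))).
    apply: ler_sum => n _; rewrite -scalerBl anZ.
    have -> : (n`!%:R : C)^-1 - 'C(m.+1, n)%:R / m.+1%:R ^+ n =
        ((n`!%:R : R)^-1 - 'C(m.+1, n)%:R / m.+1%:R ^+ n)%:C.
      by rewrite rmorphB /= -natVC fmorph_div rmorphXn /= !rmorph_nat.
    rewrite nrm_realV ?subr_ge0 ?bin_coef_le //.
    have -> : r ^+ n / n`!%:R - 'C(m.+1, n)%:R / m.+1%:R ^+ n * r ^+ n =
        ((n`!%:R : R)^-1 - 'C(m.+1, n)%:R / m.+1%:R ^+ n) * r ^+ n.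
      by rewrite mulrBl [_ / n`!%:R]mulrC.
    rewrite mulrCA ler_wpM2l ?subr_ge0 ?bin_coef_le //.
    by apply: le_trans (mnX a n); exact: an_le_mn.
  rewrite -mulr_sumr /K -[leRHS]mulrA ler_wpM2l ?mn_ge0 //.
  rewrite sumrB; apply: le_trans (compound_interest r0 rm).
  apply: lerB; first by rewrite -(big_mkord xpredT (fun n => r ^+ n / n`!%:R)) exp_series_le.
  rewrite exprDn; apply: ler_sum => n _.
  rewrite expr1n mul1r expr_div_n -mulr_natl; have -> : forall x y z : R, x * (y / z) = x / z * y by move=> x y z; ring.
  exact: lexx.
move=> e e0; have e2 : 0 < e / 2 by rewrite divr_gt0.
have [N1 H1] := expmx_series a i j e2.
have [N2 H2] := inv_small K0 e2.
exists (maxn (maxn N1 N2) (Num.truncn r)) => m; rewrite !geq_max => /andP[/andP[n1 n2] n3].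
rewrite (splitr e).
apply: (le_trans (nrm_triangle (\sum_(0 <= n < m.+2) (n`!%:R : C)^-1 *: (a ^+ n) i j : A) _ _)).
apply: lerD; last by apply: H1; apply: leq_trans n1 _; rewrite -addn2 leq_addr.
rewrite nrmB; apply: le_trans (H2 m n2); apply: dist.
by apply: lt_le_trans (truncnS_gt _) _; rewrite ler_nat.
Qed.

End MatrixExponential.
End Exponential.

(** * The determinant of an exponential *)

Section DetExp.
Context {R : realType} {A : comBanachAlgType R[i]}.
Local Notation C := R[i].
Local Notation B := (alg_of A).
Implicit Types (x y : B).

(** The scalar exponential is the case of size 1, so that both share their series and Euler
    limit. *)
Definition bexp x : B := expmx (x%:M : 'M[B]_1) ord0 ord0.

Lemma scalar_mx1X x n : ((x%:M : 'M[B]_1) ^+ n) ord0 ord0 = x ^+ n.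
Proof. by rewrite -rmorphXn mxE eqxx. Qed.

Lemma bexp_series x : atends (fun m => \sum_(0 <= n < m) (n`!%:R : C)^-1 *: x ^+ n) (bexp x).
Proof.
have := expmx_series (x%:M : 'M[B]_1) ord0 ord0; congr atends; apply/funext => m.
by apply: eq_bigr => n _; rewrite scalar_mx1X.
Qed.

Lemma bexp_euler x : atends (fun m => (1 + (m.+1%:R : C)^-1 *: x) ^+ m.+1) (bexp x).
Proof.
have := euler_expmx (x%:M : 'M[B]_1) ord0 ord0; congr atends; apply/funext => m.
rewrite /euler -[X in 1 + X]/(_ *m _) -scalar_mxM -[X in X + _]/(1%:M) -raddfD /=.
by rewrite scalar_mx1X -scalerAl mul1r.
Qed.

Lemma an_stepE x m : an ((m.+1%:R : C)^-1 *: x) = an x / m.+1%:R.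
Proof. by rewrite anZ nrm_natV mulrC. Qed.

Lemma atends_unique (u : nat -> B) x y : atends u x -> atends u y -> x = y.
Proof. exact: tends_unique. Qed.

Lemma atends_sub0 (u v : nat -> B) x : atends u x -> atends (fun m => v m - u m) 0 -> atends v x.
Proof.
move=> ux uv; have := @tendsD R A _ _ _ _ uv ux; rewrite add0r; congr tends.
by apply/funext => m; rewrite subrK.
Qed.

(** The Euler factors of [x + y] and the products of those of [x] and [y] differ by
    [x * y / m.+1 ^ 2], a perturbation without effect in the limit. *)
Lemma bexpD x y : bexp (x + y) = bexp x * bexp y.
Proof.
apply: atends_unique (bexp_euler _) _.
apply: atends_sub0 (atendsM (bexp_euler x) (bexp_euler y)) _.
pose u m : B := 1 + (m.+1%:R : C)^-1 *: (x + y).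
pose v m : B := (1 + (m.+1%:R : C)^-1 *: x) * (1 + (m.+1%:R : C)^-1 *: y).
have vE m : v m = u m + ((m.+1%:R : C)^-1 ^+ 2) *: (x * y).
  rewrite /v /u mulrDl mul1r mulrDr mulr1 -scalerAl -scalerAr scalerA expr2 scalerDr.
  by rewrite !addrA; congr (_ + _); rewrite addrAC.
have e2 m : an (((m.+1%:R : C)^-1 ^+ 2) *: (x * y)) <= an (x * y) / m.+1%:R ^+ 2.
  by rewrite anZ expr2 nrmM !nrm_natV -expr2 exprVn mulrC.
rewrite (_ : (fun m => _) = fun m => u m ^+ m.+1 - v m ^+ m.+1); last first.
  by apply/funext => m; rewrite /v exprMn.
have ge0 : 0 <= an (x + y) + an (x * y) by rewrite addr_ge0 ?an_ge0.
apply: (power_perturbation ge0 (an_ge0 (x * y))) => m.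
- rewrite /u addrAC subrr add0r an_stepE ler_wpM2r ?invr_ge0 // lerDl; exact: an_ge0.
- rewrite vE /u -(addrA 1) addrAC subrr add0r; apply: (le_trans (anD _ _)).
  rewrite an_stepE mulrDl lerD2l; apply: (le_trans (e2 m)).
  rewrite ler_wpM2l ?an_ge0 // lef_pV2 ?posrE ?exprn_gt0 ?ltr0n //.
  by rewrite expr2 ler_peMl // ler1n.
by rewrite vE opprD addrA subrr sub0r anN.
Qed.

Lemma bexp0 : bexp 0 = 1.
Proof.
apply: atends_unique (bexp_euler 0) _; under eq_fun do rewrite scaler0 addr0 expr1n.
exact: tends_cst.
Qed.

Lemma bexpMn x n : bexp (x *+ n) = bexp x ^+ n.
Proof. by elim: n => [|n IHn]; rewrite ?bexp0 // mulrS bexpD IHn exprS. Qed.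

Lemma bexp_eq_sub x y : bexp x = bexp y -> bexp (x - y) = 1.
Proof. by move=> xy; rewrite bexpD xy -bexpD subrr bexp0. Qed.

Lemma char_poly_horner k (a : 'M[B]_k) x : \det (x%:M + a) = (char_poly (- a)).[x].
Proof.
rewrite -[RHS]/(horner_eval x (char_poly (- a))) /char_poly -det_map_mx.
congr (\det _); apply/matrixP => i j; rewrite !mxE /= /horner_eval.
by case: (i == j); rewrite ?mulr1n ?mulr0n !hornerE ?opprK.
Qed.

(** For [t = 1 / m.+1], the determinant is [t^k] times the characteristic polynomial of [- a] at
    [1 / t]. Its two top coefficients give [1 + t tr a], the others carry at least [t^2]. *)
Lemma det_first_order k (a : 'M[B]_k) : exists2 K : R, 0 <= K & forall m,
  an (\det (1 + ((m.+1%:R : C)^-1%:A : B)%:M * a) - (1 + (m.+1%:R : C)^-1 *: \tr a))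
  <= K / m.+1%:R ^+ 2.
Proof.
(* The coefficient equal to the trace exists only in positive size. *)
case: k => [|k] in a *.
  exists 0 => // m; rewrite det_mx00 /mxtrace big_ord0 scaler0 addr0 subrr mul0r.
  by rewrite an0.
set p := char_poly (- a).
exists (\sum_(i < k) an p`_i) => [|m]; first by apply: sumr_ge0 => i _; exact: an_ge0.
set e := (m.+1%:R : C)^-1; have e0 : (m.+1%:R : C) != 0 by rewrite pnatr_eq0.
have eM : (e%:A : B) * (m.+1%:R : C)%:A = 1.
  by rewrite -scalerAl mul1r scalerA (mulVf e0) scale1r.
have -> : 1 + (e%:A : B)%:M * a = (e%:A : B)%:M * ((m.+1%:R : C)%:A%:M + a).
  rewrite mulrDr -[(e%:A)%:M * _%:M]/(_ *m _) -scalar_mxM eM.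
  reflexivity.
have pk1 : p`_k.+1 = 1.
  by have /monicP := char_poly_monic (- a); rewrite /lead_coef size_char_poly.
have pk : p`_k = \tr a by have := char_poly_trace (- a) isT; rewrite /= => ->; rewrite raddfN /= opprK.
rewrite -[_ * _]/(_ *m _) det_mulmx det_scalar char_poly_horner -/p.
rewrite horner_coef size_char_poly big_ord_recr big_ord_recr /= pk1 mul1r pk.
have AX (c : C) n : (c%:A : B) ^+ n = (c ^+ n)%:A by rewrite exprZn expr1n.
have AA (c : C) x : (c%:A : B) * x = c *: x by rewrite -scalerAl mul1r.
have Ae i : (i <= k.+1)%N -> e ^+ k.+1 * (m.+1%:R : C) ^+ i = e ^+ (k.+1 - i).
  move=> ik; rewrite -{1}(subnK ik) exprD -mulrA -exprMn mulVf // expr1n mulr1 //.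
rewrite AX AA !scalerDr.
rewrite [p in an (_ - p)]addrC.
rewrite (_ : e ^+ k.+1 *: (m.+1%:R : C)%:A ^+ k.+1 = 1); last first.
  by rewrite AX scalerA Ae // subnn expr0 scale1r.
rewrite (_ : e ^+ k.+1 *: (\tr a * (m.+1%:R : C)%:A ^+ k) = e *: \tr a); last first.
  by rewrite AX mulrC AA scalerA Ae // subSnn expr1.
rewrite -(addrA _ (e *: \tr a) 1) addrK scaler_sumr; apply: (le_trans (an_sum _ _ _)).
rewrite mulr_suml; apply: ler_sum => i _.
rewrite AX mulrC AA scalerA Ae; last exact: leqW (ltnW (ltn_ord i)).
rewrite anZ mulrC ler_wpM2l ?an_ge0 //.
have nrmX (c : C) n : nrm (c ^+ n) = nrm c ^+ n.
  by elim: n => [|n IHn]; rewrite ?nrm1 // !exprS nrmM IHn.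
rewrite nrmX nrm_natV -exprVn.
have -> : (k.+1 - i = (k.+1 - i - 2) + 2)%N by have := ltn_ord i; lia.
by rewrite exprD ler_piMl ?exprn_ge0 ?invr_ge0 // exprn_ile1 ?invr_ge0 // invf_le1 ?ltr0n // ler1n.
Qed.

Lemma det_exp k (a : 'M[B]_k) n : \det (a ^+ n) = \det a ^+ n.
Proof.
elim: n => [|n IHn]; first by rewrite !expr0 det1.
by rewrite !exprS -IHn -det_mulmx.
Qed.

(** The determinant is continuous and multiplicative, so it suffices to compare
    [\det (1 + a / m.+1)] with [1 + \tr a / m.+1] to first order. *)
Lemma det_expmx k (a : 'M[B]_k) : \det (expmx a) = bexp (\tr a).
Proof.
have detE : atends (fun m => \det (euler a m)) (\det (expmx a)).
  by apply: atends_det => i j; exact: euler_expmx.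
apply: atends_unique detE _; apply: atends_sub0 (bexp_euler _) _.
have [K K0 HK] := det_first_order a.
rewrite (_ : (fun m => _) = fun m => \det (1 + ((m.+1%:R : C)^-1%:A : B)%:M * a) ^+ m.+1 -
   (1 + (m.+1%:R : C)^-1 *: \tr a) ^+ m.+1); last first.
  apply/funext => m; congr (_ - _); exact: det_exp.
have c0 : 0 <= an (\tr a) + K by rewrite addr_ge0 ?an_ge0.
apply: (power_perturbation c0 K0) => m.
- set d := \det _; have -> : d - 1 = (d - (1 + (m.+1%:R : C)^-1 *: \tr a)) + (m.+1%:R : C)^-1 *: \tr a.
    by rewrite opprD addrA subrK.
  apply: (le_trans (anD _ _)); rewrite an_stepE addrC mulrDl lerD2l.
  apply: (le_trans (HK m)); rewrite ler_wpM2l // lef_pV2 ?posrE ?exprn_gt0 ?ltr0n //.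
  by rewrite expr2 ler_peMl // ler1n.
- by rewrite addrAC subrr add0r an_stepE ler_wpM2r ?invr_ge0 // lerDl.
exact: HK.
Qed.

Lemma det_stabilize k d (g : 'M[B]_k) :
  \det (\matrix_(i < k + d, j < k + d) stabilize g i j) = \det g.
Proof.
have -> : \matrix_(i < k + d, j < k + d) stabilize g i j = block_mx g 0 0 1%:M.
  apply/matrixP => i j; rewrite mxE /stabilize.
  have lE (l : 'I_k) : insub (lshift d l : nat) = Some l by exact: (valK l).
  have rE (l : 'I_d) : insub (rshift k l : nat) = None :> option 'I_k.
    by rewrite insubF //= ltnNge leq_addr.
  case: (split_ordP i) => i' ->; case: (split_ordP j) => j' ->.
  - by rewrite block_mxEul !lE.
  - rewrite block_mxEur mxE lE rE eqn_leq [X in _ && X]leqNgt.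
    by rewrite (leq_trans (ltn_ord i')) ?leq_addr ?andbF.
  - by rewrite block_mxEdl mxE rE eqn_leq leqNgt (leq_trans (ltn_ord j')) ?leq_addr.
  - by rewrite block_mxEdr !mxE rE eqn_add2l.
by rewrite det_ublock det1 mulr1.
Qed.

(** The two matrices may have different sizes; both determinants are read off the common corner of
    size [tag a + tag b]. *)
Lemma expGL_trace (a b : Minf A) : expGL a = expGL b ->
  bexp ((TR a : B) - TR b) = 1.
Proof.
move=> ab; apply: bexp_eq_sub; rewrite /TR -!det_expmx.
rewrite -(det_stabilize (tag b) (expmx (tagged a))) -(det_stabilize (tag a) (expmx (tagged b))).
by move: ab; rewrite /expGL => ->; rewrite addnC.
Qed.

End DetExp.

Section ComplexExponential.
Context {R : realType}.
Local Notation C := R[i].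

Definition cis (t : R) : C := cos t +i* sin t.

Lemma cis_series (t : R) :
  tends (fun m => \sum_(0 <= n < m) (n`!%:R : C)^-1 * ('i * t%:C) ^+ n) (cis t).
Proof.
have term n : (n`!%:R : C)^-1 * ('i * t%:C) ^+ n = cos_coeff t n +i* sin_coeff t n.
  have i2 k : 'i ^+ k.*2 = ((-1) ^+ k : R)%:C.
    by rewrite -mul2n exprM sqr_i rmorphXn rmorphN1.
  rewrite natVC exprMn -rmorphXn /= -(odd_double_half n); case: (odd n).
    rewrite add1n cos_coeff_odd /sin_coeff /= odd_double doubleK exprS i2.
    by simpc; congr (_ +i* _); rewrite /= ?mul1r; field; rewrite pnatr_eq0 -lt0n fact_gt0.
  rewrite add0n sin_coeff_even /cos_coeff /= odd_double doubleK i2 -exprnP.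
  by simpc; congr (_ +i* _); rewrite /= ?mul1r; field; rewrite pnatr_eq0 -lt0n fact_gt0.
have cs := @is_cvg_series_cos_coeff R t; have ss := @is_cvg_series_sin_coeff R t.
have cosE : cos t = limn (series (cos_coeff t)) by rewrite unlock.
have sinE : sin t = limn (series (sin_coeff t)) by rewrite unlock.
rewrite -cosE in cs; rewrite -sinE in ss.
move=> e e0; have e2 : 0 < e / 2 by rewrite divr_gt0.
move/cvgrPdist_le: cs => /(_ _ e2)[N1 _ H1]; move/cvgrPdist_le: ss => /(_ _ e2)[N2 _ H2].
exists (maxn N1 N2) => m; rewrite geq_max => /andP[m1 m2].
have sumE : \sum_(0 <= n < m) (n`!%:R : C)^-1 * ('i * t%:C) ^+ n =
    series (cos_coeff t) m +i* series (sin_coeff t) m.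
  rewrite /series /=; elim: (m) => [|k IHk]; first by rewrite !big_geq.
  by rewrite !big_nat_recr //= IHk term.
rewrite sumE; apply: (le_trans (nrm_le_ReIm _)); rewrite /= (splitr e).
by apply: lerD; rewrite distrC; [exact: H1 | exact: H2].
Qed.

(** Near 1 the real part is positive and the argument is [asin] of the imaginary part, which is
    continuous at 0. *)
Lemma small_argument (eta : R) : 0 < eta -> exists2 delta : R, 0 < delta &
  forall z : C, nrm z = 1 -> nrm (z - 1) <= delta -> exists2 t, `|t| <= eta & cis t = z.
Proof.
move=> eta0.
have asin0 : asin (0 : R) = 0.
  rewrite -[X in asin X]sin0 sinK // in_itv /= oppr_le0 andbb.
  by have /andP[/ltW] := @pihalf_02 R.
have : {for 0, continuous (@asin R)} by apply: continuous_asin; rewrite ltr01 ltrN10.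
move/cvgrPdist_le => /(_ _ eta0)/nbhs_ballP[d /= d0 Hd].
exists (Num.min (d / 2) 2^-1) => [|[a b] z1 zd]; first by rewrite lt_min divr_gt0 //=.
have ab : a ^+ 2 + b ^+ 2 = 1.
  have : 0 <= a ^+ 2 + b ^+ 2 by rewrite addr_ge0 ?sqr_ge0.
  move=> h; rewrite -[LHS]sqr_sqrtr //; move: z1; rewrite /nrm normc_def /= => ->.
  by rewrite expr1n.
have hb : `|b| <= Num.min (d / 2) 2^-1.
  by apply: le_trans zd; have := Im_le_nrm ((a +i* b) - 1); rewrite /= subr0.
have ha : `|a - 1| <= 2^-1.
  apply: (@le_trans _ _ (Num.min (d / 2) 2^-1)); last by rewrite ge_min lexx orbT.
  by apply: le_trans zd; exact: Re_le_nrm ((a +i* b) - 1).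
have a0 : 0 < a by have := ler_norm (- (a - 1)); rewrite normrN; lra.
have b1 : -1 <= b <= 1.
  have : `|b| <= 2^-1 by apply: (le_trans hb); rewrite ge_min lexx orbT.
  by rewrite ler_norml => /andP[]; lra.
exists (asin b).
  have /Hd : ball (0 : R) d b.
    rewrite -ball_normE /= sub0r normrN; apply: (le_lt_trans hb).
    by rewrite gt_min ltr_pdivrMr // mulr_natr mulr2n ltrDl d0.
  by rewrite /= asin0 sub0r normrN.
rewrite /cis asinK ?in_itv // cos_asin // -ab addrK sqrtr_sqr gtr0_norm //.
Qed.

Lemma prim_root_exists n : (0 < n)%N -> exists z : C, n.-primitive_root z.
Proof.
pose p : {poly C} := 'X^n - 1; have [r Dp] := closed_field_poly_normal p.
move=> n_gt0; rewrite (monicP _) ?monicXnsubC // scale1r in Dp.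
have rn1 : all n.-unity_root r by apply/allP => z; rewrite -root_prod_XsubC -Dp.
have sz_r : (n < (size r).+1)%N by rewrite -(size_prod_XsubC r id) -Dp size_XnsubC.
have [|z] := hasP (has_prim_root n_gt0 rn1 _ sz_r); last by exists z.
by rewrite -separable_prod_XsubC -Dp separable_Xn_sub_1 // pnatr_eq0 -lt0n.
Qed.

End ComplexExponential.

(** * Elements with exponential 1 *)

Section ExpKernel.
Context {R : realType} {A : comBanachAlgType R[i]}.
Local Notation C := R[i].
Local Notation B := (alg_of A).
Implicit Types (x y u w : B).

Lemma half_series (m : nat) : \sum_(0 <= n < m) (2^-1 : R) ^+ n.+2 <= 2^-1.
Proof.
suff -> : \sum_(0 <= n < m) (2^-1 : R) ^+ n.+2 = 2^-1 - 2^-1 ^+ m.+1.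
  by rewrite gerBl exprn_ge0.
elim: m => [|m IHm]; first by rewrite big_geq // expr1 subrr.
by rewrite big_nat_recr //= IHm !exprS; field.
Qed.

(** The factor [w * u] is kept together instead of being split by submultiplicativity: [bexp_kernel]
    needs a contraction of [an (w * u)]. *)
Lemma bexp_second_order w u : an w <= 2^-1 ->
  an ((bexp w - 1 - w) * u) <= 2^-1 * an (w * u).
Proof.
move=> w2.
pose s m : B := \sum_(0 <= n < m) (n`!%:R : C)^-1 *: w ^+ n.
have sw : atends (fun m => s m.+2) (bexp w).
  move=> e /(bexp_series w)[N HN]; exists N => m Nm.
  by apply: HN; rewrite -addn2 (leq_trans Nm) ?leq_addr.
have lim : atends (fun m => (s m.+2 - 1 - w) * u) ((bexp w - 1 - w) * u).
  apply: atendsM; last exact: tends_cst.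
  rewrite -addrA; under eq_fun do rewrite -addrA.
  by apply: (@tendsD R A _ _ _ _ sw); exact: tends_cst.
apply: (atends_le lim) => m.
have -> : s m.+2 - 1 - w = \sum_(0 <= n < m) (n.+2`!%:R : C)^-1 *: w ^+ n.+2.
  rewrite /s big_nat_recl // big_nat_recl //= expr0 expr1 !invr1 !scale1r.
  abel.
rewrite mulr_suml; apply: (le_trans (an_sum _ _ _)).
apply: (@le_trans _ _ (\sum_(0 <= n < m) (2^-1 : R) ^+ n.+2 * an (w * u))); last first.
  by rewrite -mulr_suml ler_wpM2r ?an_ge0 ?half_series.
apply: ler_sum => n _; rewrite -scalerAl exprSr -mulrA anZ nrm_natV.
apply: (@le_trans _ _ (2^-1 * (2^-1 ^+ n.+1 * an (w * u)))); last by rewrite mulrA -exprS.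
apply: ler_pM; rewrite ?invr_ge0 ?an_ge0 //.
  rewrite lef_pV2 ?posrE ?ltr0n ?fact_gt0 // ler_nat.
  by rewrite (@leq_pfact 2 n.+2).
apply: (le_trans (anM _ _)); rewrite ler_wpM2r ?an_ge0 //.
apply: (le_trans (anX1 w n)); rewrite lerXn2r ?nnegrE ?an_ge0 ?invr_ge0 //.
Qed.

Lemma bexp_first_order w : an w <= 2^-1 -> an (bexp w - 1) <= 2 * an w.
Proof.
move=> w2; have := bexp_second_order 1 w2; rewrite !mulr1 => h.
have -> : bexp w - 1 = (bexp w - 1 - w) + w by rewrite subrK.
by apply: (le_trans (anD _ _)); have := an_ge0 w; lra.
Qed.

(** Local injectivity of the exponential on the multiples of [u]: the hypothesis turns [- (w * u)]
    into the second-order remainder, of at most half its norm. *)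
Lemma bexp_kernel w u : an w <= 2^-1 -> bexp w * u = u -> w * u = 0.
Proof.
move=> w2 wu; apply: an_eq0; apply/eqP; rewrite eq_le an_ge0 andbT.
have := bexp_second_order u w2; rewrite mulrBl mulrBl wu mul1r subrr sub0r anN.
by have := an_ge0 (w * u); lra.
Qed.

Lemma bexp_imaginary (t : R) : bexp (('i * t%:C) *: (1 : B)) = cis t *: 1.
Proof.
apply: atends_unique (bexp_series _) _.
have -> : (fun m => \sum_(0 <= n < m) (n`!%:R : C)^-1 *: (('i * t%:C) *: (1 : B)) ^+ n) =
    fun m => (\sum_(0 <= n < m) (n`!%:R : C)^-1 * ('i * t%:C) ^+ n) *: 1.
  apply/funext => m; rewrite scaler_suml; apply: eq_bigr => n _.
  by rewrite exprZn expr1n scalerA.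
have k0 : 0 < an (1 : B) by apply: lt_le_trans an1_ge1.
move=> e e0; have [|N HN] := @cis_series R t (e / an (1 : B)); first exact: divr_gt0.
exists N => m /HN; rewrite ler_pdivlMr // -anZ scalerBl; exact.
Qed.

(* [x] is diagonalised by the idempotents of the root of unity [bexp (x / m)]. *)
Lemma bexp1_idempotents x : bexp x = 1 -> exists m (c : 'I_m -> C) (e : 'I_m -> B),
  (forall k, e k * e k = e k) /\ x = \sum_k c k *: e k.
Proof.
move=> x1; set K := an (1 : B); have K1 : 1 <= K := an1_ge1.
have K0 : 0 < K by apply: lt_le_trans K1.
(* The constants give [v = w - i t] norm at most 1/4 + 1/4, as required by [bexp_kernel]; in [r],
   the bound [delta / 2] compensates the 2 of [bexp_first_order]. *)
have [delta d0 Hdelta] := @small_argument R (4 * K)^-1 (ltac:(by rewrite invr_gt0 mulr_gt0)).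
pose r := Num.min 4^-1 (delta / 2).
have r0 : 0 < r by rewrite lt_min invr_gt0 divr_gt0 // ltr0n.
have [M HM] := inv_small (an_ge0 x) r0; pose m := M.+1; exists m.
pose w : B := (m%:R : C)^-1 *: x.
have wr : an w <= r by rewrite an_stepE; exact: HM.
have w4 : an w <= 4^-1 by apply: (le_trans wr); rewrite ge_min lexx.
have w2 : an w <= 2^-1 by apply: (le_trans w4); lra.
have xw : x = (m%:R : C) *: w by rewrite scalerA mulfV ?scale1r // pnatr_eq0.
pose y := bexp w; have ym : y ^+ m = 1.
  by rewrite /y -bexpMn -scaler_nat -xw.
have [om prim] := @prim_root_exists R m (ltn0Sn M).
pose E (z : C) : B := (m%:R : C)^-1 *: \sum_(j < m) (z^-1) ^+ j *: y ^+ j.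
have natZ (u : B) : (m%:R : C)^-1 *: (u *+ m) = u.
  by rewrite -[u *+ m]scaler_nat scalerA mulVf ?scale1r // pnatr_eq0.
have yE z : z ^+ m = 1 -> y * E z = z *: E z.
  move=> zm; have z0 : z != 0 by apply: contra_eq_neq zm => ->; rewrite expr0n eq_sym oner_eq0.
  rewrite /E -scalerAr scalerA [z * _]mulrC -scalerA; congr (_ *: _).
  rewrite mulr_sumr scaler_sumr big_ord_recr [RHS]big_ord_recl /= addrC; congr (_ + _).
    rewrite expr0 expr0 scale1r -scalerAr -exprS ym.
    have -> : z^-1 ^+ M = z by apply: (mulIf (expf_neq0 M z0)); rewrite -exprMn mulVf // expr1n -exprS.
    by [].
  apply: eq_bigr => j _; rewrite -scalerAr -exprS scalerA; congr (_ *: _).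
  by rewrite exprS mulrA mulfV // mul1r.
have EE z : z ^+ m = 1 -> E z * E z = E z.
  move=> zm; have z0 : z != 0 by apply: contra_eq_neq zm => ->; rewrite expr0n eq_sym oner_eq0.
  have yX j : y ^+ j * E z = z ^+ j *: E z.
    elim: j => [|j IHj]; first by rewrite !expr0 scale1r mul1r.
    by rewrite exprSr -mulrA yE // -scalerAr IHj scalerA -exprS.
  rewrite {1}/E -scalerAl mulr_suml.
  rewrite (eq_bigr (fun=> E z)); last first.
    by move=> j _; rewrite -scalerAl yX scalerA -exprMn mulVf // expr1n scale1r.
  by rewrite sumr_const card_ord natZ.
have omk k : (om ^+ k) ^+ m = 1 by rewrite exprAC (prim_expr_order prim) expr1n.
have sumE : \sum_(k < m) E (om ^+ k) = 1.
  rewrite /E -scaler_sumr exchange_big /= (bigD1 ord0) //= [X in _ + X]big1 ?addr0.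
    rewrite (eq_bigr (fun=> 1)); last by move=> j _; rewrite /= !expr0 scale1r.
    by rewrite sumr_const card_ord natZ.
  move=> j j0; rewrite -scaler_suml.
  have -> : \sum_(k < m) (om ^+ k)^-1 ^+ j = \sum_(k < m) ((om ^+ j)^-1) ^+ k.
    by apply: eq_bigr => k _; rewrite !exprVn exprAC.
  have nz : (om ^+ j)^-1 - 1 != 0.
    rewrite subr_eq0 invr_eq1 -(prim_order_dvd prim) gtnNdvd // lt0n.
    by move: j0; rewrite -val_eqE.
  have := subrX1 ((om ^+ j)^-1) m; rewrite exprVn omk invr1 subrr => /esym/eqP.
  by rewrite mulf_eq0 (negPf nz) /= => /eqP->; rewrite scale0r.
(* On a nonzero [E z], [y] acts as [z], so [z] is as close to 1 as [y] and [z = e^(i t)] with [t]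
   small. Then [w - i t] has exponential 1 on [E z], and [bexp_kernel] gives [w * E z = i t E z]. *)
have xE k : exists c, x * E (om ^+ k) = c *: E (om ^+ k).
  set z := om ^+ k; have zm : z ^+ m = 1 := omk k.
  have [->|E0] := eqVneq (E z) 0; first by exists 0; rewrite mulr0 scaler0.
  have nE : 0 < an (E z).
    by rewrite lt_neqAle an_ge0 andbT eq_sym; apply: contra_neq E0; exact: an_eq0.
  have nz1 : nrm z = 1.
    have : nrm z ^+ m = 1.
      have nX n : nrm (z ^+ n) = nrm z ^+ n by elim: n => [|n IHn]; rewrite ?nrm1 // !exprS nrmM IHn.
      by rewrite -nX zm nrm1.
    by move/eqP; rewrite pexpr_eq1 ?nrm_ge0 // => /eqP.
  have z1 : nrm (z - 1) <= delta.
    have : nrm (z - 1) * an (E z) <= an (y - 1) * an (E z).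
      rewrite -anZ scalerBl scale1r -yE // -[X in _ - X]mul1r -mulrBl; exact: anM.
    rewrite ler_pM2r // => /le_trans; apply; apply: (le_trans (bexp_first_order w2)).
    by rewrite -ler_pdivlMl // mulrC (le_trans wr) // ge_min lexx orbT.
  have [t tK tz] := Hdelta z nz1 z1.
  have z0 : z != 0 by apply: contra_eq_neq zm => ->; rewrite expr0n eq_sym oner_eq0.
  pose v : B := w - ('i * t%:C) *: (1 : B).
  have v2 : an v <= 2^-1.
    apply: (le_trans (anD _ _)); rewrite anN (anZ ('i * t%:C)) nrmM nrm_real.
    have -> : nrm ('i : C) = 1 by rewrite /nrm normc_def /= expr0n add0r expr1n sqrtr1.
    rewrite mul1r; have : `|t| * K <= 4^-1.
      by move: tK; rewrite invfM -ler_pdivrMr ?invr_gt0 // invrK.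
    rewrite -/K; lra.
  have vE : bexp v * E z = E z.
    have := bexpD v (('i * t%:C) *: (1 : B)); rewrite subrK -/y bexp_imaginary tz => yv.
    have : z *: (bexp v * E z) = z *: E z by rewrite -yE // yv -(scalerAr z (bexp v) 1) mulr1 scalerAl.
    by move/(scalerI z0).
  have /eqP := bexp_kernel v2 vE; rewrite mulrBl subr_eq0 -(scalerAl ('i * t%:C) 1) mul1r => /eqP wE.
  by exists ((m%:R : C) * ('i * t%:C)); rewrite xw -(scalerAl m%:R w) wE scalerA.
have /choice[c Hc] : forall k : 'I_m, exists c, x * E (om ^+ k) = c *: E (om ^+ k).
  by move=> k; exact: xE.
exists c, (fun k => E (om ^+ k)); split=> [k|]; first exact: EE.
by rewrite -[LHS]mulr1 -sumE mulr_sumr; apply: eq_bigr => k _; exact: Hc.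
Qed.

End ExpKernel.

(** * The bracket *)

Section Assembly.
Context {R : realType} {A : comBanachAlgType R[i]} {H : hilbertType R} (q : nat).
Local Notation C := R[i].
Local Notation p := q.+1.
Variables (rho : A -> H -> H) (F : H -> H).
Hypothesis hF : odd_fredholm_module p rho F.

Let rho_rep : is_representation rho. Proof. by case: hF. Qed.

Definition rho_op (a : A) : op H :=
  Op (bounded_opP (let: And3 rho_bd _ _ := rho_rep in rho_bd a)).

Definition F_op : op H := Op (bounded_opP (let: And5 _ F_bd _ _ _ := hF in F_bd)).

Definition P_op : op H := op_scalar (2^-1 : C) * (F_op + 1).

Lemma rho_opD a b : rho_op (a + b) = rho_op a + rho_op b.
Proof.
apply: op_ext => x /=; have [_ lin _] := rho_rep.
by rewrite -{1}[a]scale1r lin /= scale1r.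
Qed.

Lemma rho_opZ (c : C) a : rho_op (c *: a) = op_scalar c * rho_op a.
Proof.
have r0 : rho_op 0 = 0 by apply: (addrI (rho_op 0)); rewrite -rho_opD !addr0.
apply: op_ext => x /=; have [_ lin _] := rho_rep.
rewrite -{1}[c *: a]addr0 lin /=.
by rewrite (_ : rho 0 x = 0) ?addr0 //; exact: (congr1 (fun T : op H => T x) r0).
Qed.

Lemma rho_opM a b : rho_op (bmul a b) = rho_op a * rho_op b.
Proof. by apply: op_ext => x /=; have [_ _ ->] := rho_rep. Qed.

Lemma rho_op_sum (I : Type) (r : seq I) (c : I -> C) (e : I -> A) :
  rho_op (\sum_(i <- r) c i *: e i) = \sum_(i <- r) op_scalar (c i) * rho_op (e i).
Proof.
have r0 : rho_op 0 = 0 by apply: (addrI (rho_op 0)); rewrite -rho_opD !addr0.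
by elim/big_rec2: _ => // i a b _ <-; rewrite rho_opD rho_opZ.
Qed.

Lemma P_op_idem : P_op * P_op = P_op.
Proof.
have FF x : F_op (F_op x) = x.
  by case: hF => _ _ _ FF _; exact: (congr1 (fun f => f x) FF).
apply: op_ext => x.
have PE y : P_op y = 2^-1 *: (F_op y + y) by [].
rewrite [LHS]PE PE opZ opD FF -scalerDr; congr (_ *: _).
rewrite [x + _]addrC; set u := _ + x.
by rewrite -[u + u]/(u *+ 2) -[u *+ 2]scaler_nat scalerA mulVf ?scale1r ?pnatr_eq0.
Qed.

Hypothesis onbP : is_onb (@onb R H).

Lemma P_op_commr a : schatten_ideal q 1 (commr P_op (rho_op a)).
Proof.
have -> : commr P_op (rho_op a) = op_scalar (2^-1 : C) * commr F_op (rho_op a).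
  rewrite /commr /P_op mulrA -op_scalarC -!mulrA -mulrBr; congr (_ * _); ncring.
apply: (@schatten_idealM _ _ q 0 1); first exact: schatten_ideal_all.
apply: schatten_class_ideal => //.
by case: hF => _ _ _ _ /(_ a).
Qed.

End Assembly.

Lemma opf_prod {R : realType} {H : hilbertType R} (n : nat) (T : 'I_n -> op H) :
  \big[comp/id]_(j < n) (T j : H -> H) = (\prod_(j < n) T j : op H).
Proof. by elim/big_rec2: _ => // i f g _ ->. Qed.

(** For [p = q.+1] the index type reduces to ['I_q.*2.+2] by computation; the condition defining
    [SE] becomes monotonicity on the pairs from 1 to [q]. *)
Lemma bracketE {R : realType} {A : comBanachAlgType R[i]} {H : hilbertType R} (q : nat)
    (rho : A -> H -> H) (F : H -> H) (hF : odd_fredholm_module q.+1 rho F)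
    (a : 'I_(q.+1.*2.-1).+1 -> Minf A) :
  bracket rho F a = (-1) ^+ q.+1 * cp q.+1 *
   \sum_(s : 'S_q.*2.+2 | (s ord0 == ord0) && increasing_pairs q s)
     alt_term (fun T : op H => op_trace T)
       (fun j => P_op hF * rho_op hF (TR (a j)) * P_op hF) s.
Proof.
rewrite /bracket; congr (_ * _).
rewrite -(@sum_lift0_perm _ q.*2.+1 (fun s => increasing_pairs q s)).
apply: eq_big => [s|s _].
  rewrite inE /increasing_pairs; apply/forallP/allP => h j.
    rewrite mem_iota => /andP[j0 jq]; have jp : (j < q.+1)%N by lia.
    by have := h (Ordinal jp); rewrite /= j0.
  by apply/implyP => j0; apply: h; rewrite mem_iota; have := ltn_ord j; lia.
rewrite /alt_term odd_lift_perm /=; congr (_ * op_trace _).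
by rewrite /comm_prod -opf_prod; apply: eq_bigr.
Qed.

Theorem mainTheorem2 (R : realType) (p : nat) (hp : (1 <= p)%N)
    (A : comBanachAlgType R[i]) (H : hilbertType R)
    (rho : A -> H -> H) (F : H -> H)
    (hF : odd_fredholm_module p rho F)
    (hrho : opnorm_continuous rho)
    (hcomm : schatten_continuous p (fun a => op_commutator F (rho a)))
    (a : 'I_(p.*2.-1).+1 -> Minf A) (i : 'I_(p.*2.-1).+1) (b : Minf A)
    (hb : expGL b = expGL (a i)) :
  exists m : int,
    bracket rho F a - bracket rho F [eta a with i |-> b] =
    ((2 * pi)%:C * 'i) ^+ p * m%:~R.
Proof.
exists 0; rewrite mulr0; apply/eqP; rewrite subr_eq0; apply/eqP.
case: p hp hF {hrho hcomm} a i hb => // q _ hF a i hb.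
rewrite !(bracketE hF); congr (_ * _).
(* Without an orthonormal basis all traces, hence both sums, are 0. *)
case: (pselect (is_onb (@onb R H))) => onbP; last first.
  by rewrite !big1 // => s _; rewrite /alt_term op_trace_no_onb ?mulr0.
have tf := @op_trace_filtration R H q.
set P := P_op hF; set a' := [eta a with i |-> b].
have PP : P * P = P := P_op_idem hF.
have LP x : schatten_ideal q 1 (commr P (rho_op hF x)) := P_op_commr hF onbP x.
have rhoC x y : rho_op hF x * rho_op hF y = rho_op hF y * rho_op hF x.
  by rewrite -!rho_opM bmulC.
have aX c : almost_commuting (schatten_ideal q) (fun j : 'I_q.*2.+2 => P * rho_op hF (c j) * P).
  by apply: (almost_commuting_compression tf PP).
apply: (eq_sum_increasing tf); [exact: aX | exact: aX |].
have [m [c [e [ee xE]]]] := bexp1_idempotents (expGL_trace (esym hb)).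
pose x : A := TR (a i) - TR b.
(* By additivity in argument [i], the family [d] accounts for the whole difference. *)
pose d j : A := if j == i then x else TR (a j).
have D0 : alt_trace (fun T : op H => op_trace T) (fun j : 'I_q.*2.+2 => P * rho_op hF (d j) * P) = 0.
  apply: (@alt_trace_compression_sum _ _ q _ _ tf P _ i m (fun k => op_scalar (c k)) (fun k => rho_op hF (e k))) => //.
  - by move=> k; rewrite -rho_opM; congr rho_op; exact: ee.
  - by move=> k T; exact: op_scalarC.
  - by rewrite /d eqxx -rho_op_sum; congr rho_op; exact: xE.
rewrite (@alt_trace_add _ _ q _ _ tf _ (fun j => P * rho_op hF (TR (a' j)) * P)
   (fun j => P * rho_op hF (d j) * P) i) ?D0 ?addr0 //.
- by rewrite /a' /d /= eqxx -mulrDl -mulrDr -rho_opD /x addrC subrK.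
- by move=> j nj; rewrite /a' /d /= (negPf nj).
Qed.
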